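(* Let $\alpha\in(0,n)$, $0<s<\frac{n}{\alpha}$, and $q\in[1,s)$. Then $$\dot{KV}_q\approx\dot{\widetilde{O}}^{\alpha,s}_q,$$ i.e. the two spaces are isomorphic: they consist of the same functions, and there are constants $c_1,c_2>0$ (independent of $f$) with $c_1\|f\|_{\dot{KV}_q}\le\|f\|_{\dot{\widetilde{O}}^{\alpha,s}_q}\le c_2\|f\|_{\dot{KV}_q}$ for all such $f$.
   Context: Here $n\ge1$ is an integer. For $0<\alpha<n$ the Riesz potential is $I_\alpha f(x)=\gamma(n,\alpha)\int_{\mathbb{R}^n}|x-y|^{\alpha-n}f(y)\,dy$, with $\gamma(n,\alpha)=\Gamma(\frac{n-\alpha}{2})/[\pi^{n/2}2^\alpha\Gamma(\frac{\alpha}{2})]$. The Riesz capacity of $E\subset\mathbb{R}^n$ is $\mathrm{cap}_{\alpha,s}(E)=\inf\{\|f\|_{L^s(\mathbb{R}^n)}^s: f\ge0,\ I_\alpha f\ge1\text{ on }E\}$. ''q.e.'' means except on a set of zero $\mathrm{cap}_{\alpha,s}$-capacity. For a q.e. defined $g$ with values in $[0,\infty]$, $\int_{\mathbb{R}^n}g\,d\mathrm{cap}_{\alpha,s}=\int_0^\infty\mathrm{cap}_{\alpha,s}(\{g>t\})\,dt$, and $\|u\|_{L^q(\mathrm{cap}_{\alpha,s})}=(\int|u|^q\,d\mathrm{cap}_{\alpha,s})^{1/q}$. A weight is a nonnegative locally integrable function on $\mathbb{R}^n$. For $1\le q<s$, $\dot{\widetilde{O}}^{\alpha,s}_q$ is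 the space of measurable functions $g$ on $\mathbb{R}^n$ with finite quasi-norm $\|g\|_{\dot{\widetilde{O}}^{\alpha,s}_q}=\inf_w(\int_{\{g\ne0\}}|g|^sw^{q-s}\,dx)^{1/s}$, the infimum being over all q.e. defined weights $w$ with $\|w\|_{L^q(\mathrm{cap}_{\alpha,s})}\le1$. The Kalton-Verbitsky space $\dot{KV}_q=\dot{KV}_q^{\alpha,s}$ is the set of Lebesgue measurable functions $f$ on $\mathbb{R}^n$ with $\|f\|_{\dot{KV}_q}<+\infty$, where $$\|f\|_{\dot{KV}_q}=\inf\Big\{\Big(\int_{\mathbb{R}^n}h^s(I_\alpha h)^{q-s}\,dx\Big)^{1/q}: h\in\dot{\widetilde{O}}^{\alpha,s}_q,\ h\ge|f|\text{ a.e.}\Big\}.$$ Convention: $h^s(I_\alpha h)^{q-s}$ is taken to be $0$ where $h=0$. *)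

(* Defs.v *)
(* MathComp-Analysis *)
From HB Require Import structures.
From mathcomp Require Import all_boot all_order all_algebra.
From mathcomp Require Import all_classical all_reals all_analysis.
From mathcomp Require Import measurable_realfun.

Set Implicit Arguments.
Unset Strict Implicit.
Unset Printing Implicit Defensive.

Import Order.TTheory GRing.Theory Num.Theory.
Import numFieldNormedType.Exports.

Local Open Scope classical_set_scope.
Local Open Scope ring_scope.

(* Lebesgue measure on R^n, which MathComp-Analysis has for n = 1 only: the
   outer measure obtained from countable covers by half-open boxes
   \prod_i ]a_i, b_i], restricted to its Caratheodory-measurable sets. *)
Section lebesgue_outer.
Variables (R : realType) (n : nat).
Local Notation vec := 'rV[R]_n.

(* [None] stands for the empty box: with it, covers by fewer than countably
   many boxes need no special treatment, and the construction also makes sense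
   for n = 0. *)
Definition box (B : option (vec * vec)) : set vec :=
  if B is Some (a, b) then [set x | forall i, a 0 i < x 0 i <= b 0 i]
  else set0.

Definition box_volume (B : option (vec * vec)) : \bar R :=
  if B is Some (a, b) then (\prod_i Num.max 0 (b 0 i - a 0 i))%:E else 0%E.

Definition box_cover (X : set vec) : set (nat -> option (vec * vec)) :=
  [set B | X `<=` \bigcup_k box (B k)].

Definition lebesgue_outer (X : set vec) : \bar R :=
  ereal_inf [set (\sum_(k <oo) box_volume (B k))%E | B in box_cover X].

Local Open Scope ereal_scope.

Lemma box_volume_ge0 B : 0 <= box_volume B.
Proof.
case: B => [[a b]|] //=; rewrite lee_fin; apply: prodr_ge0 => i _.
by rewrite le_max lexx.
Qed.

Lemma lebesgue_outer_ge0 X : 0 <= lebesgue_outer X.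
Proof.
apply: le_ereal_inf_tmp => _ [B _ <-].
by apply: nneseries_ge0 => k _ _; exact: box_volume_ge0.
Qed.

Lemma lebesgue_outer0 : lebesgue_outer set0 = 0.
Proof.
apply/eqP; rewrite eq_le lebesgue_outer_ge0 andbT.
apply: ereal_inf_lbound; exists (fun=> None); first by [].
by rewrite eseries0.
Qed.

Lemma lebesgue_outer_le : {homo lebesgue_outer : X Y / X `<=` Y >-> X <= Y}.
Proof.
move=> X Y XY; apply/ereal_inf_le_tmp => _ [B YB <-].
by exists B => //; exact: subset_trans XY YB.
Qed.

Lemma lebesgue_outer_sigma_subadditive : sigma_subadditive lebesgue_outer.
Proof.
move=> A; have [[i ioo]|] := pselect (exists i, lebesgue_outer (A i) = +oo).
  rewrite (eseries_pinfty _ _ ioo) ?leey// => k _.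
  by rewrite -ltNye (lt_le_trans _ (lebesgue_outer_ge0 _)).
rewrite -forallNE => Aoo.
apply/lee_addgt0Pr => e e0.
rewrite (le_trans _ (epsilon_trick _ _ (ltW e0)))//; last first.
  by move=> k; exact: lebesgue_outer_ge0.
have [G PG] : {G : nat -> nat -> option (vec * vec) & forall k,
    box_cover (A k) (G k) /\ \sum_(j <oo) box_volume (G k j) <=
      lebesgue_outer (A k) + (e / (2 ^ k.+1)%:R)%:E}.
  apply: (@choice _ _ (fun k (B : nat -> option (vec * vec)) =>
    box_cover (A k) B /\ \sum_(j <oo) box_volume (B j) <=
      lebesgue_outer (A k) + (e / (2 ^ k.+1)%:R)%:E)) => k.
  have fA : lebesgue_outer (A k) \is a fin_num.
    rewrite ge0_fin_numE ?lebesgue_outer_ge0// ltey; exact/eqP/Aoo.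
  have ek : (0 < e / (2 ^ k.+1)%:R)%R by rewrite divr_gt0// ltr0n expn_gt0.
  have [_ [B AB <-] /ltW lB] := lb_ereal_inf_adherent ek fA.
  by exists B.
pose v (p : nat * nat) := box_volume (G p.1 p.2).
have v0 p : 0 <= v p by exact: box_volume_ge0.
apply: (@le_trans _ _ (\esum_(p in setT) v p)).
  apply: ereal_inf_lbound => /=.
  have /card_esym/ppcard_eqP[f] := card_nat2.
  exists (fun k => G (f k).1 (f k).2).
    move=> t [i _ /(PG i).1 [j _ Gt]].
    by exists (f^-1%FUN (i, j)) => //=; rewrite invK ?inE.
  by rewrite -(esum_pred_image v _ xpredT) ?[fun=> _]set_true// image_eq.
rewrite (_ : esum _ _ = \sum_(i <oo) \sum_(j <oo) v (i, j)); last first.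
  pose J : nat -> set (nat * nat) := fun i => [set (i, j) | j in setT].
  rewrite (_ : setT = \bigcup_k J k); last first.
    by rewrite predeqE => -[a b]; split => // _; exists a => //; exists b.
  rewrite esum_bigcupT /=; [| |by move=> *; exact: v0].
    rewrite -(image_id [set: nat]) -fun_true esum_pred_image//; last first.
      by move=> k _; exact: esum_ge0.
    apply: eq_eseriesr => /= j _.
    rewrite -(esum_pred_image v (pair j) predT)//=; last first.
      by move=> ? ? _ _; exact: (@can_inj _ _ _ snd).
    by congr esum; rewrite predeqE => -[a b]; split; move=> [i _ <-]; exists i.
  apply/trivIsetP => i j _ _ ij.
  rewrite predeqE => -[k m] /=; split => //= -[] [_] _ [<-{k} _].
  by move=> [m' _] [] /esym/eqP; rewrite (negbTE ij).
apply: lee_nneseries => [k _ _|k _]; last exact: (PG k).2.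
by apply: nneseries_ge0 => m _ _; exact: v0.
Qed.

HB.instance Definition _ := isOuterMeasure.Build R vec lebesgue_outer
  lebesgue_outer0 lebesgue_outer_ge0 lebesgue_outer_le
  lebesgue_outer_sigma_subadditive.

End lebesgue_outer.

(* R^n with the sigma-algebra of all Lebesgue-measurable sets. *)
Notation Rn R n := (caratheodory_type (@lebesgue_outer R n)).

Definition lebesgue_Rn {R : realType} {n : nat} : set (Rn R n) -> \bar R :=
  @lebesgue_outer R n.

Section lebesgue_Rn_measure.
Variables (R : realType) (n : nat).
Let mu : {outer_measure set 'rV[R]_n -> \bar R} := @lebesgue_outer R n.

HB.instance Definition _ := isMeasure.Build _ (Rn R n) R (@lebesgue_Rn R n)
  (@caratheodory_measure0 _ _ mu) (@caratheodory_measure_ge0 _ _ mu)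
  (@caratheodory_measure_sigma_additive _ _ mu).

End lebesgue_Rn_measure.

(* The norm that MathComp puts on row vectors is the sup norm. *)
Definition enorm {R : realType} {n : nat} (x : 'rV[R]_n) : R :=
  Num.sqrt (\sum_i x 0 i ^+ 2).

(* x ^ r for x in [0, +oo], with 0 ^ r = +oo and +oo ^ r = 0 when r < 0
   (the library's poweR gives 0 and +oo respectively). *)
Definition epow {R : realType} (x : \bar R) (r : R) : \bar R :=
  if r < 0 then ((x `^ (- r))^-1)%E else (x `^ r)%E.

Definition Gamma {R : realType} (a : R) : R :=
  \int[lebesgue_measure]_(t in `]0, +oo[) (t `^ (a - 1) * expR (- t)).

Section riesz.
Context {R : realType} {n : nat}.
Implicit Types (alpha s : R).

Definition riesz_const alpha : R :=
  Gamma ((n%:R - alpha) / 2) /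
  (pi `^ (n%:R / 2) * 2 `^ alpha * Gamma (alpha / 2)).

Definition riesz_potential alpha (f : Rn R n -> R) (x : Rn R n) : \bar R :=
  ((riesz_const alpha)%:E *
   \int[lebesgue_Rn]_y (epow (enorm (x - y : 'rV[R]_n))%:E (alpha - n%:R)
                        * (f y)%:E))%E.

Definition riesz_cap alpha s (E : set (Rn R n)) : \bar R :=
  ereal_inf [set ('N[lebesgue_Rn]_(s%:E)[EFin \o f] `^ s)%E | f in
    [set f : Rn R n -> R |
      [/\ measurable_fun [set: Rn R n] f, (forall x, 0 <= f x) &
          forall x, E x -> (1 <= riesz_potential alpha f x)%E]]].

Definition quasi_everywhere alpha s (P : Rn R n -> Prop) : Prop :=
  exists N, riesz_cap alpha s N = 0%E /\ forall x, ~ N x -> P x.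

(* Choquet integral of g with values in [0, +oo]. *)
Definition cap_integral alpha s (g : Rn R n -> \bar R) : \bar R :=
  (\int[lebesgue_measure]_(t in `]0%R, +oo[)
     riesz_cap alpha s [set x | t%:E < g x])%E.

Definition Lq_cap_norm alpha s (q : R) (u : Rn R n -> \bar R) : \bar R :=
  (cap_integral alpha s (fun x => `|u x| `^ q) `^ q^-1)%E.

(* A quasi-everywhere defined function is represented by a total one, whose
   values on some set of zero capacity are arbitrary. *)
Definition qe_weight alpha s (w : Rn R n -> \bar R) : Prop :=
  [/\ quasi_everywhere alpha s (fun x => 0 <= w x)%E,
      measurable_fun [set: Rn R n] w &
      forall K : set 'rV[R]_n, compact K ->
        (\int[lebesgue_Rn]_(x in (K : set (Rn R n))) `|w x| < +oo)%E].

Definition O_norm alpha s (q : R) (g : Rn R n -> R) : \bar R :=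
  ereal_inf [set ((\int[lebesgue_Rn]_(x in [set x | g x != 0%R])
                     ((`|g x| `^ s)%:E * epow (w x) (q - s))) `^ s^-1)%E
            | w in [set w : Rn R n -> \bar R | qe_weight alpha s w /\
                      (Lq_cap_norm alpha s q w <= 1)%E]].

Definition O_space alpha s (q : R) : set (Rn R n -> R) :=
  [set g | measurable_fun [set: Rn R n] g /\ (O_norm alpha s q g < +oo)%E].

Definition KV_norm alpha s (q : R) (f : Rn R n -> R) : \bar R :=
  ereal_inf [set ((\int[lebesgue_Rn]_x
                     (if h x == 0%R then 0
                      else (h x `^ s)%:E *
                           epow (riesz_potential alpha h x) (q - s)))
                  `^ q^-1)%E
            | h in [set h | O_space alpha s q h /\
                      {ae lebesgue_Rn, forall x, `|f x| <= h x}]].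

Definition KV_space alpha s (q : R) : set (Rn R n -> R) :=
  [set f | measurable_fun [set: Rn R n] f /\ (KV_norm alpha s q f < +oo)%E].

End riesz.

(* Main.v *)
(** For [h >= 0] let [I(h)] be the integral of [h^s u^(q - s)], where [u] is the
    Riesz potential of [h]. The key is the capacitary strong type inequality: the
    Choquet integral of [u^q] is at most [C I(h)]. The power
    [u^((s - q) / (s - 1))] is an A_1 weight because [q >= 1], so Muckenhoupt's
    theorem, applied to dyadic maximal functions on finitely many shifted grids,
    replaces [h] by a maximal function [H] with the integral of [H^s u^(q - s)]
    still at most [C I(h)]. A multiple of [H / t], cut to the points where [u] is
    comparable to [t], is a test function for the capacity of [{u > t}], and one
    integrates in [t]. Thus a multiple of [u] is an admissible weight, which
    bounds the [O]-norm by the [KV]-norm.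

    Conversely let [w] be an admissible weight. Adding up test functions for the
    sets [{|w|^q > 2^j}] gives [phi] in [L^s] whose potential [v] is at least
    [|w|^(q / s)]. By the pointwise inequality
    [v^(k + 1) <= C pot (phi v^k)], the function [g = phi v^((s - q) / q)] has a
    potential at least [c |w|], while [I(g) <= C]. If [A] is close to the
    [O]-norm of [f], then [max(|f|, A g)] competes in the [KV]-norm of [f].

    All estimates hold for the kernel [rho^(-b)] on a quasi-metric measure space
    whose balls of radius [r] have measure comparable to [r^N], [N > b]. *)

Require Import Defs.
From HB Require Import structures.
From mathcomp Require Import all_boot all_order all_algebra.
From mathcomp Require Import all_classical all_reals all_analysis.
From mathcomp Require Import measurable_realfun ring lra zify.

Set Implicit Arguments.
Unset Strict Implicit.
Unset Printing Implicit Defensive.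

Import Order.TTheory GRing.Theory Num.Theory.
Import numFieldNormedType.Exports.

Local Open Scope classical_set_scope.
Local Open Scope ring_scope.

(** * Powers and integrals over shells *)

(** The strong type inequality is proved for densities whose truncated potentials [tpot] are finite.
    This makes [pot] finite almost everywhere, permits stopping arguments in the radius, and makes
    the weight of the maximal inequality locally integrable. A finite energy I(h) does not visibly
    give it, because u^(q - s) is small where u is large. Densities in L^s have it, since s < n /
    alpha puts the truncated kernel in the dual Lebesgue space. For the competitor built from an
    admissible weight it comes from the strong type inequality for bounded truncations, together
    with the positive capacity of balls ([finite_weighted]). For a competitor in the KV-norm it
    comes from membership in the O-space.

    The exponent (s - q) / (s - 1) makes u^(q - s) the dual weight v^(1 - s): a bound for h in
    L^s(v^(1 - s)) is one for h / v in L^s(v), where the dyadic maximal function with respect to v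
    dx is bounded with a constant independent of v. The A_1 condition then brings back the means for
    the underlying measure. *)

Lemma lty_mulEFin {R : realType} (k : R) (x : \bar R) :
  (0 <= k)%R -> (x < +oo)%E -> (k%:E * x < +oo)%E.
Proof. by move=> k0 xy; rewrite lte_mul_pinfty// lee_fin. Qed.

Section epow_theory.
Context {R : realType}.

Lemma powR_le (x y r : R) : 0 <= r -> 0 <= x -> x <= y -> x `^ r <= y `^ r.
Proof.
move=> r0 x0 xy.
by apply: ge0_ler_powR; rewrite ?nnegrE// (le_trans x0).
Qed.

Lemma powR_leN (x y r : R) : r <= 0 -> 0 < x -> x <= y -> y `^ r <= x `^ r.
Proof.
move=> r0 x0 xy; have y0 := lt_le_trans x0 xy.
rewrite -(opprK r) !(powRN _ (- r)) lef_pV2 ?posrE ?powR_gt0//.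
by rewrite powR_le ?oppr_ge0// ltW.
Qed.

Lemma powRD0 (x a b : R) : 0 < x -> x `^ (a + b) = x `^ a * x `^ b.
Proof. by move=> x0; rewrite powRD// (gt_eqF x0) implybT. Qed.

Local Open Scope ereal_scope.
Implicit Types (x y : \bar R) (r : R).

Lemma epow_ge0 x r : 0 <= epow x r.
Proof. by rewrite /epow; case: ifPn => _; rewrite ?inve_ge0 poweR_ge0. Qed.

Lemma epow_EFin (a : R) r : (0 < a)%R -> epow a%:E r = (a `^ r)%:E.
Proof.
move=> a0; rewrite /epow; case: ifPn => r0; rewrite poweR_EFin//.
by rewrite inver gt_eqF ?powR_gt0// powRN invrK.
Qed.

Lemma epow0 r : (r < 0)%R -> epow (0 : \bar R) r = +oo.
Proof.
by move=> r0; rewrite /epow r0 poweR0r ?inve0// oppr_eq0 lt_eqF.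
Qed.

Lemma epowy r : (r < 0)%R -> epow (+oo : \bar R) r = 0.
Proof.
by move=> r0; rewrite /epow r0 poweRyr ?invey// oppr_eq0 lt_eqF.
Qed.

Lemma le_epow x y r : (r < 0)%R -> 0 <= x -> x <= y -> epow y r <= epow x r.
Proof.
move=> r0; case: x => [x| |]//; case: y => [y| |]//.
- rewrite !lee_fin le_eqVlt => /predU1P[<-|x0] xy; first by rewrite epow0// leey.
  have y0 := lt_le_trans x0 xy.
  by rewrite !epow_EFin// lee_fin powR_leN// ltW.
- by move=> _ _; rewrite epowy// epow_ge0.
Qed.

Lemma epowM (k : R) x r : (0 < k)%R -> (r < 0)%R -> 0 <= x ->
  epow (k%:E * x) r = (k `^ r)%:E * epow x r.
Proof.
move=> k0 r0; case: x => [x| |]//.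
  rewrite lee_fin le_eqVlt => /predU1P[<-|x0].
    by rewrite mule0 epow0// gt0_muley// lte_fin powR_gt0.
  by rewrite -EFinM !epow_EFin// ?mulr_gt0// powRM ?ltW.
by move=> _; rewrite gt0_muley ?lte_fin// epowy// mule0.
Qed.

Lemma measurable_epow r : measurable_fun [set: \bar R] (epow ^~ r).
Proof.
rewrite /epow; case: (ltP r 0%R) => r0; last exact: measurable_poweR.
pose g x : \bar R := if x \is a fin_num then
  (if x == 0 then +oo else (fine x `^ r)%:E) else (if x == +oo then 0 else +oo).
rewrite (_ : (fun _ => _) = g); last first.
  apply/funext => -[x| |]; rewrite /g/=.
  - rewrite inver powR_eq0 oppr_eq0 (lt_eqF r0) andbT eqe.
    by case: ifPn => //_; rewrite powRN invrK.
  - by rewrite oppr_eq0 (lt_eqF r0) invey.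
  - by rewrite oppr_eq0 (lt_eqF r0) inve0.
apply: measurable_fun_ifT => //=.
- apply: (measurable_fun_bool true) => //=.
  have := @emeasurable_fin_num _ _ R setT id measurableT (@measurable_id _ _ _).
  exact.
- apply: measurable_fun_ifT => //=; first exact: measurable_fun_eqe.
  apply/measurable_EFinP.
  exact: (@measurableT_comp _ _ _ _ _ _ (@powR R ^~ r)).
- by apply: measurable_fun_ifT => //=; first exact: measurable_fun_eqe.
Qed.

End epow_theory.

(** Restriction to a set is written as multiplication by [ind]: integrals then run over the whole
    space, and Tonelli's theorem sees the restriction as one more factor. *)
Definition ind {R : realType} (b : bool) : \bar R := (b%:R)%:E.

Lemma indT {R : realType} : ind true = 1%E :> \bar R.
Proof. by []. Qed.

Lemma indF {R : realType} : ind false = 0%E :> \bar R.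
Proof. by []. Qed.

(** * Integrals of nonnegative extended real functions *)

Section integral_tools.
Context d {T : measurableType d} {R : realType}.
Local Open Scope ereal_scope.
Implicit Types (f g : T -> \bar R) (P : T -> bool).

Lemma ind_ge0 b : 0 <= ind b :> \bar R.
Proof. by rewrite lee_fin. Qed.

Lemma measurable_ind P : measurable_fun setT P ->
  measurable_fun setT (fun x => ind (P x) : \bar R).
Proof.
move=> mP; rewrite (_ : (fun _ => _) = (fun x => if P x then 1 else 0 : \bar R)).
  exact: measurable_fun_ifT.
by apply/funext => x; rewrite /ind; case: (P x).
Qed.

(** The integral of a nonnegative function is a supremum over the simple functions below it, hence
    monotone for arbitrary functions. Choquet integrals are compared in this way, without a study of
    the measurability of their integrands. *)
Lemma le_int (mu : {measure set T -> \bar R}) (D : set T) f g :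
  (forall x, D x -> 0 <= f x) -> (forall x, D x -> f x <= g x) ->
  \int[mu]_(x in D) f x <= \int[mu]_(x in D) g x.
Proof.
move=> f0 fg; rewrite [leLHS]integral_mkcond [leRHS]integral_mkcond.
rewrite !ge0_integralTE; last 2 first.
- by apply: erestrict_ge0 => x Dx; exact: le_trans (f0 _ Dx) (fg _ Dx).
- exact: erestrict_ge0.
apply: ereal_sup_le => _ [h hf <-]; exists h => // x.
by apply: (le_trans (hf x)); exact: lee_restrict.
Qed.

Lemma leI (mu : {measure set T -> \bar R}) f g :
  (forall x, 0 <= f x) -> (forall x, f x <= g x) ->
  \int[mu]_x f x <= \int[mu]_x g x.
Proof. by move=> f0 fg; apply: le_int. Qed.

Lemma intD (mu : {measure set T -> \bar R}) f g :
  measurable_fun setT f -> measurable_fun setT g ->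
  (forall x, 0 <= f x) -> (forall x, 0 <= g x) ->
  \int[mu]_x (f x + g x) = \int[mu]_x f x + \int[mu]_x g x.
Proof. by move=> mf mg f0 g0; rewrite ge0_integralD. Qed.

Lemma intZ (mu : {measure set T -> \bar R}) f (k : R) : (0 <= k)%R ->
  measurable_fun setT f -> (forall x, 0 <= f x) ->
  \int[mu]_x (k%:E * f x) = k%:E * \int[mu]_x f x.
Proof. by move=> k0 mf f0; rewrite ge0_integralZl_EFin. Qed.

Lemma int_ind (mu : {measure set T -> \bar R}) P f :
  \int[mu]_x (ind (P x) * f x) = \int[mu]_(x in [set x | P x]) f x.
Proof.
rewrite [RHS]integral_mkcond; apply: eq_integral => x _.
rewrite patchE /ind; case: (boolP (P x)) => Px.
  by rewrite mem_set// mul1e.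
by rewrite memNset ?mul0e//; exact/negP.
Qed.

Lemma int_indE (mu : {measure set T -> \bar R}) P : measurable_fun setT P ->
  \int[mu]_x (ind (P x)) = mu [set x | P x].
Proof.
move=> mP; under eq_integral do rewrite -[ind _]mule1.
rewrite (int_ind mu P (cst 1)) integral_cst ?mul1e//.
by rewrite -[X in measurable X]setTI; exact: mP.
Qed.

Lemma int_ge0 (mu : {measure set T -> \bar R}) f :
  (forall x, 0 <= f x) -> 0 <= \int[mu]_x f x.
Proof. by move=> f0; apply: integral_ge0. Qed.

Lemma int0_ae (mu : {measure set T -> \bar R}) f : measurable_fun setT f ->
  (forall x, 0 <= f x) -> \int[mu]_x f x = 0 -> {ae mu, forall x, f x = 0}.
Proof.
move=> mf f0 i0.
have /(ae_eq_integral_abs mu measurableT mf).1 : \int[mu]_x `|f x| = 0.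
  by rewrite -i0; apply: eq_integral => x _; rewrite gee0_abs.
by apply: filterS => x /(_ I).
Qed.

Lemma int_lty_ae (mu : {measure set T -> \bar R}) f : measurable_fun setT f ->
  (forall x, 0 <= f x) -> \int[mu]_x f x < +oo ->
  {ae mu, forall x, f x < +oo}.
Proof.
move=> mf f0 ify; have : mu.-integrable setT f.
  apply/integrableP; split => //.
  by under eq_integral => x _ do rewrite gee0_abs//.
move/(integrable_ae measurableT); apply: filterS => x /(_ I).
by rewrite ge0_fin_numE.
Qed.

End integral_tools.

Section tonelli.
Context d1 d2 (S : measurableType d1) (T : measurableType d2) {R : realType}.
Local Open Scope ereal_scope.
Variable K : S -> T -> \bar R.
Hypotheses (mK : measurable_fun setT (fun p : S * T => K p.1 p.2))
           (K0 : forall x y, 0 <= K x y).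

Lemma measurable_int2 (m2 : {sigma_finite_measure set T -> \bar R}) :
  measurable_fun setT (fun x => \int[m2]_y K x y).
Proof.
exact: (measurable_fun_fubini_tonelli_F (m2 := m2) (fun p => K p.1 p.2)).
Qed.

Lemma measurable_kerr y : measurable_fun setT (K ^~ y).
Proof.
rewrite (_ : K ^~ y = (fun p => K p.1 p.2) \o (pair^~ y))//.
exact: (measurableT_comp mK).
Qed.

Lemma tonelli (m1 : {sigma_finite_measure set S -> \bar R})
    (m2 : {sigma_finite_measure set T -> \bar R}) :
  \int[m1]_x \int[m2]_y K x y = \int[m2]_y \int[m1]_x K x y.
Proof. exact: (fubini_tonelli (m1 := m1) (m2 := m2) (fun p => K p.1 p.2)). Qed.

End tonelli.

(** * Powers of a distance integrated over dyadic shells *)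

Section shells.
Context d {T : measurableType d} {R : realType}.
Variable mu : {measure set T -> \bar R}.
Local Open Scope ereal_scope.

Lemma geom_series (a z : R) : (0 <= a)%R -> (0 <= z)%R -> (z < 1)%R ->
  \sum_(i <oo) (a * z ^+ i)%:E = (a / (1 - z))%:E.
Proof.
move=> a0 z0 z1.
have := @cvg_geometric_series _ a z; rewrite ger0_norm// => /(_ z1) h.
apply/cvg_lim => //=.
rewrite (_ : (fun n => _) = EFin \o series (geometric a z)).
  by apply/fine_cvgP; split; [exact: nearW|exact: h].
by apply/funext => n /=; rewrite sumEFin.
Qed.

(** The majorant is integrated term by term. In both uses [P i] is a ball of radius r 2^(-i) or r
    2^i and [b i] bounds the kernel on the corresponding shell, which makes [b i * m i]
    geometric. *)
Lemma int_shells (P : nat -> T -> bool) (g : T -> \bar R) (b m : nat -> R)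
    (a z : R) :
  (forall i, measurable_fun setT (P i)) -> (forall x, 0 <= g x) ->
  (forall i, 0 <= b i)%R ->
  (forall x, g x <= \sum_(i <oo) ((b i)%:E * ind (P i x))) ->
  (forall i, mu [set x | P i x] <= (m i)%:E) ->
  (forall i, b i * m i <= a * z ^+ i)%R ->
  (0 <= a)%R -> (0 <= z)%R -> (z < 1)%R ->
  \int[mu]_x g x <= (a / (1 - z))%:E.
Proof.
move=> mP g0 b0 gle mle bm a0 z0 z1.
apply: (le_trans (leI mu g0 gle)).
rewrite integral_nneseries//; last 2 first.
- by move=> i; apply: measurable_funeM; exact: measurable_ind.
- by move=> i x _; rewrite mule_ge0 ?lee_fin// ind_ge0.
rewrite -geom_series//; apply: lee_nneseries => [i _ _|i _].
  by apply: integral_ge0 => x _; rewrite mule_ge0 ?lee_fin// ind_ge0.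
rewrite ge0_integralZl_EFin//; last 2 first.
- by move=> x _; exact: ind_ge0.
- exact: measurable_ind.
rewrite int_indE// (@le_trans _ _ ((b i)%:E * (m i)%:E))//.
  by rewrite lee_wpmul2l// lee_fin.
by rewrite -EFinM lee_fin.
Qed.


Lemma ex_dyadic_le (t : R) : (0 < t)%R -> exists i : nat, (2^-1 ^+ i <= t)%R.
Proof.
move=> t0; have h : (`|2^-1| < 1 :> R)%R by rewrite ger0_norm// invf_lt1// ltr1n.
have /cvgrPdist_lt /(_ _ t0)[i _ /(_ i (leqnn i))] := cvg_geometric 1%R h.
rewrite /geometric/= sub0r normrN mul1r ger0_norm ?exprn_ge0// => /ltW ?.
by exists i.
Qed.

Lemma ex_dyadic_ge (t : R) : exists i : nat, (t <= 2 ^+ i)%R.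
Proof.
have [t0|t0] := ltP 0%R t; last by exists 0%N; rewrite (le_trans t0).
have [i it] := @ex_dyadic_le t^-1 ltac:(by rewrite invr_gt0).
by exists i; rewrite -lef_pV2 ?posrE ?exprn_gt0// -exprVn.
Qed.

Lemma esum_ge (u : nat -> \bar R) i : (forall j, 0 <= u j) ->
  u i <= \sum_(j <oo) u j.
Proof.
move=> u0; apply: (@le_trans _ _ (\sum_(0 <= j < i.+1) u j)).
  by rewrite big_nat_recr//= leeDr// sume_ge0.
by apply: nneseries_lim_ge => j _ _; exact: u0.
Qed.

Lemma powRX (a r : R) i : (0 <= a)%R -> ((a ^+ i) `^ r = (a `^ r) ^+ i)%R.
Proof.
by move=> a0; rewrite -(powR_mulrn i a0) -(powR_mulrn i (powR_ge0 _ _)) powRAC.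
Qed.

Lemma powR2_lt1 (r : R) : (r < 0)%R -> (2 `^ r < 1 :> R)%R.
Proof.
move=> r0; rewrite /powR gt_eqF// -[ltRHS]expR0 ltr_expR.
by rewrite nmulr_rlt0// ln_gt0// ltr1n.
Qed.

(* The point [rho x = 0] costs nothing: the bound on the measure of the balls
   makes its fibre negligible, and the series below is infinite there. *)
Lemma int_ball_power (N g C : R) :
  (0 <= C)%R -> (0 < g)%R -> (g < N)%R ->
  exists2 K : R, (0 < K)%R & forall rho : T -> R,
  measurable_fun setT rho -> (forall x, 0 <= rho x)%R ->
  (forall r : R, (0 < r)%R -> mu [set x | rho x <= r]%R <= (C * r `^ N)%:E) ->
  forall r : R, (0 < r)%R ->
   \int[mu]_x (ind (rho x <= r)%R * epow (rho x)%:E (- g)) <=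
   (K * r `^ (N - g))%:E.
Proof.
move=> C0 g0 gN.
pose z : R := (2 `^ (g - N))%R.
have z0 : (0 <= z)%R by exact: powR_ge0.
have z1 : (z < 1)%R by rewrite powR2_lt1// subr_lt0.
(* The summand 1 keeps the constant positive when C = 0. *)
exists ((C * 2 `^ g + 1) / (1 - z))%R.
  by rewrite divr_gt0 ?subr_gt0// ltr_wpDl// mulr_ge0// powR_ge0.
move=> rho mrho rho0 muC r r0.
have a0 : (0 <= C * 2 `^ g * r `^ (N - g))%R.
  by rewrite !mulr_ge0// powR_ge0.
apply: (@le_trans _ _ ((C * 2 `^ g * r `^ (N - g)) / (1 - z))%:E); last first.
  rewrite lee_fin mulrAC ler_wpM2r ?powR_ge0//.
  by rewrite ler_wpM2r ?lerDl// invr_ge0 subr_ge0 ltW.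
have hr0 i : (0 < r * 2^-1 ^+ i)%R by rewrite mulr_gt0// exprn_gt0.
(* On the shell r 2^-(i + 1) < rho <= r 2^-i the power is at most its value at the inner radius,
   hence the index [i.+1] in the coefficient. *)
apply: (@int_shells (fun i x => rho x <= r * 2^-1 ^+ i)%R _
   (fun i => (r * 2^-1 ^+ i.+1) `^ (- g)) (fun i => C * (r * 2^-1 ^+ i) `^ N))%R => //.
- by move=> i; apply: measurable_fun_ler.
- by move=> x; rewrite mule_ge0 ?ind_ge0 ?epow_ge0.
- by move=> i; exact: powR_ge0.
- move=> x; pose u i := ((r * 2^-1 ^+ i.+1) `^ (- g))%:E *
    ind (rho x <= r * 2^-1 ^+ i)%R.
  rewrite -/(\sum_(i <oo) u i).
  have [rx|_] := leP (rho x) r; last first.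
    rewrite indF mul0e; apply: nneseries_ge0 => i _ _.
    by rewrite mule_ge0 ?ind_ge0// lee_fin powR_ge0.
  rewrite indT mul1e; have [x0|x0] := ltP 0%R (rho x); last first.
    have {}x0 : rho x = 0%R by apply/eqP; rewrite eq_le x0 rho0.
    rewrite [leRHS](_ : _ = +oo) ?leey//; apply/eq_infty => M.
    pose t : R := ((Num.max M 1) `^ (- g^-1))%R.
    have M0 : (0 < Num.max M 1)%R by rewrite lt_max ltr01 orbT.
    have [i hi] := @ex_dyadic_le (t / r) ltac:(by rewrite divr_gt0// powR_gt0).
    apply: (@le_trans _ _ (u i)); last first.
      apply: esum_ge => j; rewrite mule_ge0 ?ind_ge0// lee_fin powR_ge0//.
    rewrite /u x0 (ltW (hr0 i)) indT mule1 lee_fin (@le_trans _ _ (t `^ (- g))%R)//.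
      by rewrite -powRrM mulrNN mulVf ?gt_eqF// powRr1 ?(ltW M0)// le_max lexx.
    rewrite powR_leN ?oppr_le0// ?(ltW g0)//.
    apply: (@le_trans _ _ (r * 2^-1 ^+ i)%R).
      by rewrite ltW// ltr_pM2l// exprSr gtr_pMr ?exprn_gt0// invf_lt1// ltr1n.
    by rewrite mulrC -ler_pdivlMr.
  have [i0 hi0] : exists i, (r * 2^-1 ^+ i.+1 < rho x)%R.
    have [i hi] := @ex_dyadic_le (rho x / r) ltac:(by rewrite divr_gt0).
    exists i; apply: (@lt_le_trans _ _ (r * 2^-1 ^+ i)%R).
      by rewrite ltr_pM2l// exprSr gtr_pMr ?exprn_gt0// invf_lt1// ltr1n.
    by rewrite mulrC -ler_pdivlMr.
  have := ex_minnP (ex_intro (fun i => r * 2^-1 ^+ i.+1 < rho x)%R i0 hi0).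
  case=> i hi mini.
  have hri : (rho x <= r * 2^-1 ^+ i)%R.
    case: i hi mini => [_ _|i _ mini]; first by rewrite expr0 mulr1.
    by rewrite leNgt; apply/negP => /mini; rewrite ltnn.
  apply: (@le_trans _ _ (u i)); last first.
    by apply: esum_ge => j; rewrite mule_ge0 ?ind_ge0// lee_fin powR_ge0.
  rewrite /u hri indT mule1 epow_EFin// lee_fin powR_leN// ?oppr_le0; exact: ltW.
- by move=> i; exact: muC.
- move=> i; rewrite !powRM ?mulr_ge0 ?exprn_ge0 ?(ltW r0) ?invr_ge0// !powRX ?invr_ge0//.
  have h2 w : ((2^-1) `^ w = 2 `^ (- w) :> R)%R.
    by rewrite -powR_inv1// -powRrM mulN1r.
  rewrite !h2 exprS opprK.
  have -> : z = (2 `^ (- N) * 2 `^ g)%R.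
    by rewrite -powRD0// addrC.
  have -> : (r `^ (N - g) = r `^ N * r `^ (- g))%R.
    by rewrite powRD0.
  by rewrite exprMn le_eqVlt; apply/orP; left; apply/eqP; ring.
Qed.

(** The shells now grow outwards, and N < g makes the ratio 2^(N - g) smaller than 1. *)
Lemma int_tail_power (N g C : R) :
  (0 <= C)%R -> (0 < g)%R -> (N < g)%R ->
  exists2 K : R, (0 < K)%R & forall rho : T -> R,
  measurable_fun setT rho -> (forall x, 0 <= rho x)%R ->
  (forall r : R, (0 < r)%R -> mu [set x | rho x <= r]%R <= (C * r `^ N)%:E) ->
  forall r : R, (0 < r)%R ->
   \int[mu]_x ((Num.max r (rho x)) `^ (- g))%:E <= (K * r `^ (N - g))%:E.
Proof.
move=> C0 g0 gN.
pose z : R := (2 `^ (N - g))%R.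
have z0 : (0 <= z)%R by exact: powR_ge0.
have z1 : (z < 1)%R by rewrite powR2_lt1// subr_lt0.
exists ((C * 2 `^ g + 1) / (1 - z))%R.
  by rewrite divr_gt0 ?subr_gt0// ltr_wpDl// mulr_ge0// powR_ge0.
move=> rho mrho rho0 muC r r0.
have a0 : (0 <= C * 2 `^ g * r `^ (N - g))%R by rewrite !mulr_ge0// powR_ge0.
apply: (@le_trans _ _ ((C * 2 `^ g * r `^ (N - g)) / (1 - z))%:E); last first.
  rewrite lee_fin mulrAC ler_wpM2r ?powR_ge0//.
  by rewrite ler_wpM2r ?lerDl// invr_ge0 subr_ge0 ltW.
have hr0 i : (0 < r * 2 ^+ i)%R by rewrite mulr_gt0// exprn_gt0.
(* At the least i with rho <= r 2^i, the maximum of r and rho is at least half of r 2^i, hence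
   [r / 2] in the coefficient. *)
apply: (@int_shells (fun i x => rho x <= r * 2 ^+ i)%R _
   (fun i => (r / 2 * 2 ^+ i) `^ (- g)) (fun i => C * (r * 2 ^+ i) `^ N))%R => //.
- by move=> i; apply: measurable_fun_ler.
- by move=> x; rewrite lee_fin powR_ge0.
- by move=> i; exact: powR_ge0.
- move=> x; pose u i := ((r / 2 * 2 ^+ i) `^ (- g))%:E *
    ind (rho x <= r * 2 ^+ i)%R.
  rewrite -/(\sum_(i <oo) u i).
  have [i0 hi0] : exists i, (rho x <= r * 2 ^+ i)%R.
    have [i hi] := ex_dyadic_ge (rho x / r).
    by exists i; rewrite mulrC -ler_pdivrMr.
  have := ex_minnP (ex_intro (fun i => rho x <= r * 2 ^+ i)%R i0 hi0).
  case=> i hi mini.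
  have hri : (r / 2 * 2 ^+ i <= Num.max r (rho x))%R.
    rewrite le_max; case: i hi mini => [_ _|i _ mini].
      by rewrite expr0 mulr1 ler_pdivrMr// ler_pMr// ler1n.
    rewrite exprS mulrA divfK// orbC; apply/orP; left.
    by rewrite leNgt; apply/negP => /ltW/mini; rewrite ltnn.
  apply: (@le_trans _ _ (u i)); last first.
    by apply: esum_ge => j; rewrite mule_ge0 ?ind_ge0// lee_fin powR_ge0.
  rewrite /u hi indT mule1 lee_fin powR_leN// ?oppr_le0 ?(ltW g0)//.
  by rewrite mulr_gt0 ?divr_gt0// exprn_gt0.
- by move=> i; exact: muC.
- move=> i; rewrite !powRM ?mulr_ge0 ?exprn_ge0 ?(ltW r0) ?invr_ge0// !powRX ?invr_ge0//.
  have -> : ((2^-1) `^ (- g) = 2 `^ g :> R)%R.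
    by rewrite -powR_inv1// -powRrM mulrNN mul1r.
  have -> : z = (2 `^ N * 2 `^ (- g))%R.
    by rewrite -powRD// pnatr_eq0 implybT.
  have -> : (r `^ (N - g) = r `^ N * r `^ (- g))%R.
    by rewrite powRD0.
  by rewrite exprMn le_eqVlt; apply/orP; left; apply/eqP; ring.
Qed.

End shells.

(** * Potentials on regular spaces *)

(** Ahlfors regularity of dimension N for a quasi-metric. The quasi-triangle inequality is put in
    maximum form because truncated kernels are powers of maxima and then scale directly. *)
Record regular_space {d} {T : measurableType d} {R : realType}
    (mu : set T -> \bar R) (rho : T -> T -> R) (N c C : R) : Prop := {
  rho_ge0 : forall x y, 0 <= rho x y;
  rho_refl : forall x, rho x x = 0;
  rho_sym : forall x y, rho x y = rho y x;
  rho_qtri : forall x y z, rho x z <= 4 * Num.max (rho x y) (rho y z);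
  rho_meas : measurable_fun setT (fun p : T * T => rho p.1 p.2);
  dim_gt0 : 0 < N;
  low_gt0 : 0 < c;
  upp_gt0 : 0 < C;
  ball_low : forall x (r : R), 0 < r -> ((c * r `^ N)%:E <= mu [set y | (rho x y <= r)%R])%E;
  ball_upp : forall x (r : R), 0 < r -> (mu [set y | (rho x y <= r)%R] <= (C * r `^ N)%:E)%E
}.

Section potentials.
Context d {T : measurableType d} {R : realType}.
Variable mu : {sigma_finite_measure set T -> \bar R}.
Variables (rho : T -> T -> R) (b : R).
Local Open Scope ereal_scope.

Definition pot (f : T -> \bar R) (x : T) : \bar R :=
  \int[mu]_y (epow (rho x y)%:E (- b) * f y).

(* The potential with the kernel truncated at height [r ^ (- b)]: up to a
   constant, the mean of [pot f] over the ball of radius [r]. *)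
Definition tpot (r : R) (f : T -> \bar R) (x : T) : \bar R :=
  \int[mu]_y ((Num.max r (rho x y) `^ (- b))%:E * f y).

End potentials.

Section potential_theory.
Context d {T : measurableType d} {R : realType}.
Variable mu : {sigma_finite_measure set T -> \bar R}.
Variables (rho : T -> T -> R) (N c C b : R).
Hypothesis reg : regular_space mu rho N c C.
Hypotheses (b_gt0 : 0 < b) (b_ltN : b < N).
Local Open Scope ereal_scope.
Local Notation pot := (pot mu rho b).
Local Notation tpot := (tpot mu rho b).
Implicit Types (f : T -> \bar R) (r : R).

Let rho0 := rho_ge0 reg.

Lemma max_gt0 r x y : (0 < r)%R -> (0 < Num.max r (rho x y))%R.
Proof. by move=> r0; rewrite lt_max r0. Qed.

Lemma measurable_rhol x : measurable_fun setT (rho x).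
Proof.
rewrite (_ : rho x = (fun p => rho p.1 p.2) \o (pair x))//.
exact: (measurableT_comp (rho_meas reg)).
Qed.

Lemma measurable_ball x r : measurable_fun setT (fun y => rho x y <= r)%R.
Proof. by apply: measurable_fun_ler => //; exact: measurable_rhol. Qed.

Lemma measurable_ballset x r : measurable [set y | rho x y <= r]%R.
Proof.
have := @measurable_ball x r measurableT [set true] I.
by rewrite setTI.
Qed.

Lemma measurable_ker : measurable_fun setT
  (fun p : T * T => epow (rho p.1 p.2)%:E (- b)).
Proof.
apply: (measurableT_comp (measurable_epow (- b))).
by apply/measurable_EFinP; exact: rho_meas reg.
Qed.

Lemma measurable_snd_comp f : measurable_fun setT f ->
  measurable_fun setT (fun p : T * T => f p.2).
Proof. by move=> mf; apply: (measurableT_comp mf). Qed.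

Lemma measurable_fst_comp f : measurable_fun setT f ->
  measurable_fun setT (fun p : T * T => f p.1).
Proof. by move=> mf; apply: (measurableT_comp mf). Qed.

Lemma ker_ge0 x y : 0 <= epow (rho x y)%:E (- b).
Proof. exact: epow_ge0. Qed.

Lemma tker_ge0 r x y : 0 <= (Num.max r (rho x y) `^ (- b))%:E.
Proof. by rewrite lee_fin powR_ge0. Qed.

Lemma tker_le r x y : (0 < r)%R ->
  (Num.max r (rho x y) `^ (- b))%:E <= epow (rho x y)%:E (- b).
Proof.
move=> r0; rewrite -epow_EFin ?max_gt0//.
by rewrite le_epow ?oppr_lt0// lee_fin ?rho0// le_max lexx orbT.
Qed.

Lemma tker_le_r r x y : (0 < r)%R -> (Num.max r (rho x y) `^ (- b) <= r `^ (- b))%R.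
Proof.
by move=> r0; rewrite powR_leN// ?oppr_le0 ?(ltW b_gt0)// le_max lexx.
Qed.

Lemma tker_cmp (k r r' : R) x y x' y' : (0 < k)%R -> (0 < r)%R -> (0 < r')%R ->
  (Num.max r (rho x y) <= k * Num.max r' (rho x' y'))%R ->
  (Num.max r' (rho x' y') `^ (- b) <= k `^ b * Num.max r (rho x y) `^ (- b))%R.
Proof.
move=> k0 r0 r'0 h.
have := powR_leN (r := - b) _ (max_gt0 x y r0) h.
rewrite oppr_le0 (ltW b_gt0) => /(_ isT).
rewrite powRM ?(ltW k0)//; last by rewrite ltW// max_gt0.
rewrite powRN mulrC ler_pdivrMr ?powR_gt0// => h'.
by rewrite mulrC.
Qed.

Lemma measurable_pot f : measurable_fun setT f -> (forall x, 0 <= f x) ->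
  measurable_fun setT (pot f).
Proof.
move=> mf f0; apply: measurable_int2 => [|x y].
  apply: emeasurable_funM; first exact: measurable_ker.
  exact: measurable_snd_comp.
by rewrite mule_ge0// ker_ge0.
Qed.

Lemma pot_ge0 f x : (forall x, 0 <= f x) -> 0 <= pot f x.
Proof. by move=> f0; apply: int_ge0 => y; rewrite mule_ge0// ker_ge0. Qed.

Lemma tpot_ge0 r f x : (forall x, 0 <= f x) -> 0 <= tpot r f x.
Proof. by move=> f0; apply: int_ge0 => y; rewrite mule_ge0// tker_ge0. Qed.

Lemma le_pot f g x : (forall x, 0 <= f x) -> (forall x, f x <= g x) ->
  pot f x <= pot g x.
Proof.
move=> f0 fg; apply: leI => y; first by rewrite mule_ge0// ker_ge0.
by rewrite lee_wpmul2l// ker_ge0.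
Qed.

Lemma le_tpot r f g x : (forall x, 0 <= f x) -> (forall x, f x <= g x) ->
  tpot r f x <= tpot r g x.
Proof.
move=> f0 fg; apply: leI => y; first by rewrite mule_ge0// tker_ge0.
by rewrite lee_wpmul2l// tker_ge0.
Qed.

Lemma measurable_kerx x : measurable_fun setT (fun y => epow (rho x y)%:E (- b)).
Proof.
apply: (measurableT_comp (measurable_epow (- b))).
exact/measurable_EFinP/measurable_rhol.
Qed.

Lemma measurable_tkerx r x :
  measurable_fun setT (fun y => (Num.max r (rho x y) `^ (- b))%:E).
Proof.
apply/measurable_EFinP; apply: (@measurableT_comp _ _ _ _ _ _ (@powR R ^~ (- b))%R).
  exact: measurable_powR.
by apply: measurable_maxr => //; exact: measurable_rhol.
Qed.

Lemma eq_pot f g x : measurable_fun setT f -> measurable_fun setT g ->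
  (forall x, 0 <= f x) -> (forall x, 0 <= g x) ->
  {ae mu, forall x, f x = g x} -> pot f x = pot g x.
Proof.
move=> mf mg f0 g0 fg; apply: ge0_ae_eq_integral => //.
- by apply: emeasurable_funM => //; exact: measurable_kerx.
- by apply: emeasurable_funM => //; exact: measurable_kerx.
- by move=> y _; rewrite mule_ge0// ker_ge0.
- by move=> y _; rewrite mule_ge0// ker_ge0.
- by apply: filterS fg => y /= -> _.
Qed.

Lemma eq_tpot r f g x : measurable_fun setT f -> measurable_fun setT g ->
  (forall x, 0 <= f x) -> (forall x, 0 <= g x) ->
  {ae mu, forall x, f x = g x} -> tpot r f x = tpot r g x.
Proof.
move=> mf mg f0 g0 fg; apply: ge0_ae_eq_integral => //.
- by apply: emeasurable_funM => //; exact: measurable_tkerx.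
- by apply: emeasurable_funM => //; exact: measurable_tkerx.
- by move=> y _; rewrite mule_ge0// tker_ge0.
- by move=> y _; rewrite mule_ge0// tker_ge0.
- by apply: filterS fg => y /= -> _.
Qed.

(** Pointwise comparison of the kernels; changes of centre and changes of radius are both
    instances. *)
Lemma tpot_cmp (k r r' : R) x x' f : measurable_fun setT f ->
  (forall x, 0 <= f x) -> (0 < k)%R -> (0 < r)%R -> (0 < r')%R ->
  (forall y, Num.max r (rho x y) <= k * Num.max r' (rho x' y))%R ->
  tpot r' f x' <= (k `^ b)%:E * tpot r f x.
Proof.
move=> mf f0 k0 r0 r'0 h.
rewrite -ge0_integralZl_EFin ?powR_ge0//; last 2 first.
- by move=> y _; rewrite mule_ge0// tker_ge0.
- by apply: emeasurable_funM => //; exact: measurable_tkerx.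
apply: leI => y; first by rewrite mule_ge0// tker_ge0.
by rewrite muleA -EFinM lee_wpmul2r// lee_fin tker_cmp.
Qed.

Lemma max_qtri r x y z : (rho x y <= r)%R ->
  (Num.max r (rho x z) <= 4 * Num.max r (rho y z))%R.
Proof.
move=> xy; have r0 : (0 <= r)%R := le_trans (rho0 x y) xy.
rewrite ge_max; apply/andP; split.
  apply: (@le_trans _ _ (4 * r)%R); first by rewrite ler_peMl// ler1n.
  by rewrite ler_pM2l// le_max lexx.
apply: (le_trans (rho_qtri reg x y z)).
by rewrite ler_pM2l// ge_max !le_max xy lexx orbT.
Qed.

(** A Harnack property: truncation at radius r hides a displacement of the centre by at most r. *)
Lemma tpot_near r x y f : measurable_fun setT f -> (forall x, 0 <= f x) ->
  (0 < r)%R -> (rho x y <= r)%R ->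
  tpot r f y <= (4 `^ b)%:E * tpot r f x.
Proof.
move=> mf f0 r0 xy; apply: tpot_cmp => // z.
exact: max_qtri.
Qed.

Lemma tpot_scale r k x f : measurable_fun setT f -> (forall x, 0 <= f x) ->
  (0 < r)%R -> (1 <= k)%R -> tpot r f x <= (k `^ b)%:E * tpot (k * r) f x.
Proof.
move=> mf f0 r0 k1; have k0 : (0 < k)%R := lt_le_trans ltr01 k1.
apply: tpot_cmp => //; first exact: mulr_gt0.
move=> z; rewrite ge_max; apply/andP; split.
  by rewrite ler_pM2l// le_max lexx.
apply: (@le_trans _ _ (k * rho x z)%R); first by rewrite ler_peMl.
by rewrite ler_pM2l// le_max lexx orbT.
Qed.

Lemma tpot_anti r r' x f : (forall x, 0 <= f x) -> (0 < r)%R -> (r <= r')%R ->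
  tpot r' f x <= tpot r f x.
Proof.
move=> f0 r0 rr'; apply: leI => y; first by rewrite mule_ge0// tker_ge0.
rewrite lee_wpmul2r// lee_fin powR_leN ?max_gt0// ?oppr_le0 ?(ltW b_gt0)//.
by rewrite ge_max !le_max rr' lexx orbT.
Qed.

Lemma tpot_le_pot r x f : (forall x, 0 <= f x) -> (0 < r)%R ->
  tpot r f x <= pot f x.
Proof.
move=> f0 r0; apply: leI => y; first by rewrite mule_ge0// tker_ge0.
by rewrite lee_wpmul2r// tker_le.
Qed.

(** Source of every lower bound for a potential on a whole ball: a truncated potential at the centre
    controls it from below. *)
Lemma pot_low r x y f : measurable_fun setT f -> (forall x, 0 <= f x) ->
  (0 < r)%R -> (rho x y <= r)%R -> tpot r f x <= (4 `^ b)%:E * pot f y.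
Proof.
move=> mf f0 r0 xy; apply: (@le_trans _ _ ((4 `^ b)%:E * tpot r f y)).
  by apply: tpot_near => //; rewrite (rho_sym reg).
by rewrite lee_wpmul2l ?lee_fin ?powR_ge0// tpot_le_pot.
Qed.

(** The radius is enlarged until the ball about x0 contains x, and the centre is then moved.
    Finiteness of one truncated potential is thus a condition on f alone. *)
Lemma tpot_fin_all f x0 r0 : measurable_fun setT f -> (forall x, 0 <= f x) ->
  (0 < r0)%R -> tpot r0 f x0 < +oo ->
  forall x r, (0 < r)%R -> tpot r f x < +oo.
Proof.
move=> mf f0 r00 h x r rp.
pose R1 := Num.max (Num.max r r0) (rho x0 x).
have R1r : (r <= R1)%R by rewrite !le_max lexx.
have R1r0 : (r0 <= R1)%R by rewrite !le_max lexx !orbT.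
have R1d : (rho x0 x <= R1)%R by rewrite !le_max lexx !orbT.
have R10 : (0 < R1)%R := lt_le_trans rp R1r.
have k1 : (1 <= R1 / r)%R by rewrite ler_pdivlMr// mul1r.
apply: (le_lt_trans (tpot_scale x mf f0 rp k1)).
have -> : (R1 / r * r = R1)%R by rewrite divfK// (gt_eqF rp).
apply: lty_mulEFin; first exact: powR_ge0.
apply: (le_lt_trans (tpot_near mf f0 R10 R1d)).
apply: lty_mulEFin; first exact: powR_ge0.
by apply: le_lt_trans h; exact: tpot_anti.
Qed.

End potential_theory.

(** * Means of potentials over balls and the behaviour of truncations at small and large radii *)

Section potential_limits.
Context d {T : measurableType d} {R : realType}.
Variable mu : {sigma_finite_measure set T -> \bar R}.
Variables (rho : T -> T -> R) (N c C b : R).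
Hypothesis reg : regular_space mu rho N c C.
Hypotheses (b_gt0 : 0 < b) (b_ltN : b < N).
Local Open Scope ereal_scope.
Local Notation pot := (pot mu rho b).
Local Notation tpot := (tpot mu rho b).
Implicit Types (f : T -> \bar R) (r : R).

Let rho0 := rho_ge0 reg.
Let C0 : (0 <= C)%R := ltW (upp_gt0 reg).

(** The A_1 property of the kernel. If the pole z is within 4r of x, the ball lies in the ball of
    radius 16 r about z and the kernel is integrated there; otherwise the kernel is comparable to a
    constant on the ball. *)
Lemma ker_ball_int : exists2 K : R, (0 < K)%R & forall x z r, (0 < r)%R ->
  \int[mu]_y (ind (rho x y <= r)%R * epow (rho y z)%:E (- b)) <=
  (K * r `^ N * Num.max r (rho x z) `^ (- b))%:E.
Proof.
have [K K0 hK] := @int_ball_power _ T R mu N b C C0 b_gt0 b_ltN.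
(* The first summand serves a far pole, the second a near one. *)
exists (4 `^ b * C + K * 16 `^ (N - b) * 4 `^ b)%R.
  by rewrite ltr_wpDl// ?mulr_ge0 ?powR_ge0// !mulr_gt0// powR_gt0.
move=> x z r r0; have [xz|xz] := leP (rho x z) (4 * r)%R.
  apply: (@le_trans _ _ (\int[mu]_y (ind (rho z y <= 16 * r)%R *
      epow (rho z y)%:E (- b)))).
    apply: leI => y; first by rewrite mule_ge0 ?ind_ge0 ?ker_ge0.
    rewrite (rho_sym reg y z); have [xy|] := leP (rho x y) r; last first.
      by rewrite indF mul0e mule_ge0 ?ind_ge0 ?ker_ge0.
    suff -> : (rho z y <= 16 * r)%R by [].
    apply: (le_trans (rho_qtri reg z x y)).
    rewrite (_ : 16 * r = 4 * (4 * r))%R; last by ring.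
    rewrite ler_pM2l// ge_max (rho_sym reg) xz/=.
    by rewrite (le_trans xy)// ler_peMl ?ler1n// ltW.
  have r16 : (0 < 16 * r)%R by rewrite mulr_gt0.
  apply: (le_trans (hK _ (measurable_rhol reg z) (rho0 z) (ball_upp reg z) _ r16)).
  rewrite lee_fin powRM ?(ltW r0)// (powRD0 _ _ r0).
  apply: (@le_trans _ _ (K * 16 `^ (N - b) * 4 `^ b * r `^ N *
     (4 * r) `^ (- b)))%R.
    rewrite (powRM _ _ (ltW r0))// le_eqVlt; apply/orP; left; apply/eqP.
    rewrite [RHS](_ : _ = K * 16 `^ (N - b) * (r `^ N * r `^ (- b)) *
      (4 `^ b * 4 `^ (- b)))%R; last by ring.
    by rewrite -(@powRD0 _ 4)// subrr powRr0 mulr1; ring.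
  rewrite ler_pM ?mulr_ge0 ?powR_ge0 ?(ltW K0)//.
    by rewrite ler_wpM2r ?powR_ge0// lerDr mulr_ge0// powR_ge0.
  rewrite powR_leN ?max_gt0 ?oppr_le0 ?(ltW b_gt0)// ge_max xz andbT.
  by rewrite ler_peMl ?ler1n// ltW.
have rz0 : (0 < rho x z)%R by rewrite (lt_trans _ xz)// mulr_gt0.
have -> : Num.max r (rho x z) = rho x z.
  by apply/max_idPr; rewrite (le_trans _ (ltW xz))// ler_peMl ?ler1n// ltW.
apply: (@le_trans _ _ (\int[mu]_y ((4 `^ b * rho x z `^ (- b))%:E *
    ind (rho x y <= r)%R))).
  apply: leI => y; first by rewrite mule_ge0 ?ind_ge0 ?ker_ge0.
  have [xy|] := leP (rho x y) r; last by rewrite indF mul0e mule0.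
  rewrite indT mul1e mule1.
  have h : (rho x z <= 4 * rho y z)%R.
    have := rho_qtri reg x y z; rewrite maxC; case: (leP (rho x y) (rho y z)) => //.
    move=> _ h; move: (lt_le_trans xz h); rewrite ltr_pM2l//.
    by rewrite ltNge xy.
  have yz0 : (0 < rho y z)%R by rewrite -(pmulr_rgt0 _ (_ : 0 < 4)%R)// (lt_le_trans rz0).
  rewrite epow_EFin// lee_fin.
  have := powR_leN (r := - b) _ rz0 h; rewrite oppr_le0 (ltW b_gt0) => /(_ isT).
  rewrite powRM// powRN mulrC ler_pdivrMr ?powR_gt0// => h'.
  by rewrite mulrC.
rewrite ge0_integralZl_EFin//; last 3 first.
- by move=> y _; exact: ind_ge0.
- by apply: measurable_ind; exact: (measurable_ball reg).
- by rewrite mulr_ge0 ?powR_ge0.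
rewrite int_indE; last exact: (measurable_ball reg).
apply: (@le_trans _ _ ((4 `^ b * rho x z `^ (- b))%:E * (C * r `^ N)%:E)).
  rewrite lee_wpmul2l ?lee_fin ?mulr_ge0 ?powR_ge0//; exact: (ball_upp reg _ r0).
rewrite -EFinM lee_fin mulrAC mulrA ler_wpM2r ?powR_ge0//.
rewrite ler_wpM2r ?powR_ge0// lerDl ?mulr_ge0 ?powR_ge0//.
exact: ltW.
Qed.

(** Tonelli's theorem moves the integration over the ball onto the kernel, where [ker_ball_int]
    applies. *)
Lemma pot_ball_int : exists2 K : R, (0 < K)%R & forall f x r,
  measurable_fun setT f -> (forall x, 0 <= f x) -> (0 < r)%R ->
  \int[mu]_y (ind (rho x y <= r)%R * pot f y) <= (K * r `^ N)%:E * tpot r f x.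
Proof.
have [K K0 hK] := ker_ball_int; exists K => // f x r mf f0 r0.
have mk : measurable_fun setT (fun p : T * T => ind (rho x p.1 <= r)%R *
    (epow (rho p.1 p.2)%:E (- b) * f p.2)).
  apply: emeasurable_funM.
    apply: (@measurable_fst_comp _ _ _ (fun y => ind (rho x y <= r)%R)).
    by apply: measurable_ind; exact: (measurable_ball reg).
  apply: emeasurable_funM; first exact: (measurable_ker b reg).
  exact: measurable_snd_comp.
have k0 y z : 0 <= ind (rho x y <= r)%R * (epow (rho y z)%:E (- b) * f z).
  by rewrite !mule_ge0 ?ind_ge0 ?ker_ge0.
rewrite (_ : \int[mu]_y _ = \int[mu]_y \int[mu]_z (ind (rho x y <= r)%R *
    (epow (rho y z)%:E (- b) * f z))); last first.
  apply: eq_integral => y _; rewrite ge0_integralZl_EFin//.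
    by move=> z _; rewrite mule_ge0 ?ker_ge0.
  by apply: emeasurable_funM => //; exact: (measurable_kerx b reg).
rewrite (tonelli mk k0) /tpot -ge0_integralZl_EFin//; last 3 first.
- by move=> z _; rewrite mule_ge0 ?tker_ge0.
- by apply: emeasurable_funM => //; exact: (measurable_tkerx b reg).
- by rewrite mulr_ge0 ?powR_ge0// ltW.
apply: leI => z; first by apply: int_ge0 => y; exact: k0.
under eq_integral do rewrite muleA.
rewrite ge0_integralZr//; last 2 first.
- apply: emeasurable_funM.
    by apply: measurable_ind; exact: (measurable_ball reg).
  exact: (measurable_kerr (K := fun y z => epow (rho y z)%:E (- b)) (measurable_ker b reg) z).
- by move=> y _; rewrite mule_ge0 ?ind_ge0 ?ker_ge0.
by rewrite muleA -EFinM lee_wpmul2r// hK.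
Qed.

Lemma fibre_null x : mu [set y | rho x y <= 0]%R = 0.
Proof.
apply/eqP; rewrite eq_le measure_ge0 andbT; apply/lee_addgt0Pr => e e0.
(* This radius solves C r^N = e. *)
rewrite add0e; pose r := ((e / C) `^ (N^-1))%R.
have Cp := upp_gt0 reg; have Np := dim_gt0 reg.
have r0 : (0 < r)%R by rewrite powR_gt0// divr_gt0.
apply: (@le_trans _ _ (mu [set y | rho x y <= r]%R)).
  apply: le_measure; rewrite ?inE; first 2 last.
  - by move=> y /= /le_trans; apply; exact: ltW.
  - exact: (measurable_ballset reg).
  - exact: (measurable_ballset reg).
apply: (le_trans (ball_upp reg x r0)).
rewrite lee_fin /r -powRrM mulVf ?(gt_eqF Np)// powRr1; last first.
  by rewrite divr_ge0// ltW.
by rewrite mulrC divfK// (gt_eqF Cp).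
Qed.

(** Monotone convergence as the radius decreases; the fibre rho x y = 0, where the cut kernels do
    not reach the full one, is null. *)
Lemma pot_small f x (t : R) : measurable_fun setT f -> (forall x, 0 <= f x) ->
  t%:E < pot f x -> exists i, t%:E < tpot (2^-1 ^+ i) f x.
Proof.
move=> mf f0 tpf.
(* The kernel is set to 0 inside radius 2^-i rather than truncated: it then stays below the
   truncated kernel and is eventually constant in i at each point with rho x y > 0. *)
pose g i y := ind (2^-1 ^+ i <= rho x y)%R * (epow (rho x y)%:E (- b) * f y).
have g0 i y : 0 <= g i y by rewrite !mule_ge0 ?ind_ge0 ?ker_ge0.
have mg i : measurable_fun setT (g i).
  apply: emeasurable_funM.
    apply: measurable_ind; apply: measurable_fun_ler => //.
    exact: (measurable_rhol reg x).
  by apply: emeasurable_funM => //; exact: (measurable_kerx b reg).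
have ndg y : nondecreasing_seq (g ^~ y).
  move=> i j ij; rewrite /g lee_wpmul2r ?mule_ge0 ?ker_ge0//.
  rewrite lee_fin ler_nat; case: (leP _ (rho x y)) => // h.
  case: leP => //; rewrite ltNge (le_trans _ h)//.
  by apply: ler_wiXn2l => //; rewrite invf_le1 ?ler1n.
pose h y := ind (0 < rho x y)%R * (epow (rho x y)%:E (- b) * f y).
have gh y : limn (g ^~ y) = h y.
  apply/cvg_lim => //; have [y0|y0] := ltP 0%R (rho x y); last first.
    rewrite /h ltNge y0 indF mul0e (_ : g ^~ y = cst 0); first exact: cvg_cst.
    apply/funext => i; rewrite /g leNgt (le_lt_trans y0) ?exprn_gt0//.
    by rewrite indF mul0e.
  have [i hi] := ex_dyadic_le y0.
  apply: cvg_near_cst; exists i => // j /= ij; apply/eqP.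
  rewrite /h y0 /g (le_trans _ hi)//.
  by apply: ler_wiXn2l => //; rewrite invf_le1 ?ler1n.
have potE : pot f x = \int[mu]_y (limn (g ^~ y)).
  under eq_integral do rewrite gh.
  apply: ge0_ae_eq_integral => //.
  - by apply: emeasurable_funM => //; exact: (measurable_kerx b reg).
  - apply: emeasurable_funM.
      apply: measurable_ind; apply: measurable_fun_ltr => //.
      exact: (measurable_rhol reg x).
    by apply: emeasurable_funM => //; exact: (measurable_kerx b reg).
  - by move=> y _; rewrite mule_ge0 ?ker_ge0.
  - by move=> y _; rewrite !mule_ge0 ?ind_ge0 ?ker_ge0.
  exists [set y | rho x y <= 0]%R; split.
  - exact: (measurable_ballset reg).
  - exact: fibre_null.
  - move=> y /= ny; rewrite leNgt; apply/negP => y0; apply: ny => _.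
    by rewrite /h y0 indT mul1e.
move: tpf; rewrite potE.
rewrite (monotone_convergence mu measurableT mg (fun n y _ => g0 n y)
  (fun y _ => @ndg y)).
have ndi : nondecreasing_seq (fun i => \int[mu]_y g i y).
  by move=> i j ij; apply: leI => // y; exact: ndg.
move=> tl; have [i ti] : exists i, t%:E < \int[mu]_y g i y.
  apply: contrapT => /forallNP nt; move: tl; apply/negP; rewrite -leNgt.
  apply: lime_le; first exact: ereal_nondecreasing_is_cvgn.
  by apply: nearW => i; rewrite leNgt; apply/negP/nt.
exists i; apply: (lt_le_trans ti); apply: leI => // y.
rewrite /g; have [iy|_] := leP _ (rho x y); last first.
  by rewrite indF mul0e mule_ge0 ?tker_ge0.
rewrite indT mul1e epow_EFin//.
by rewrite (lt_le_trans _ iy)// exprn_gt0.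
Qed.

(** Dominated convergence with the integrand at radius r as majorant. Its integrability forces f to
    be finite almost everywhere, which gives the pointwise limit 0. *)
Lemma tpot_large f x r (e : R) : measurable_fun setT f -> (forall x, 0 <= f x) ->
  (0 < r)%R -> (0 < e)%R -> tpot r f x < +oo ->
  exists i, tpot (2 ^+ i * r) f x < e%:E.
Proof.
move=> mf f0 r0 e0 fin.
pose g y := (Num.max r (rho x y) `^ (- b))%:E * f y.
pose g_ i y := (Num.max (2 ^+ i * r) (rho x y) `^ (- b))%:E * f y.
have r2 i : (0 < 2 ^+ i * r)%R by rewrite mulr_gt0// exprn_gt0.
have mg r' : measurable_fun setT (fun y => (Num.max r' (rho x y) `^ (- b))%:E * f y).
  by apply: emeasurable_funM => //; exact: (measurable_tkerx b reg).
have g0 y : 0 <= g y by rewrite mule_ge0 ?tker_ge0.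
have ffin : {ae mu, forall y, f y < +oo}.
  apply: filterS (int_lty_ae (mg r) g0 fin) => y gy.
  apply: contrapT; move/negP; rewrite -leNgt leye_eq => /eqP fy.
  move: gy; rewrite /g fy gt0_muley// lte_fin powR_gt0//.
  exact: max_gt0.
have ig : mu.-integrable setT g.
  apply/integrableP; split; first exact: mg.
  by under eq_integral => y _ do rewrite (gee0_abs (g0 y)).
have h : (fun i => \int[mu]_y g_ i y) @ \oo --> 0.
  rewrite -(integral0 mu setT).
  have [] // := @dominated_convergence _ T R mu setT measurableT g_ (cst 0) g
    (fun i => mg _) (measurable_cst _) _ ig.
  - apply: filterS ffin => y fy _.
    have fE : f y = (fine (f y))%:E by rewrite fineK// ge0_fin_numE.
    apply: (@squeeze_cvge _ _ _ _ (cst 0) _ (fun i =>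
      (r `^ (- b) * fine (f y) * (2 `^ (- b)) ^+ i)%:E)).
    + apply: nearW => i; apply/andP; split; first by rewrite mule_ge0 ?tker_ge0.
      rewrite /g_ {1}fE -EFinM lee_fin mulrAC.
      rewrite ler_wpM2r ?fine_ge0// -powRX//.
      rewrite -powRM ?(ltW r0) ?exprn_ge0// (mulrC r).
      by rewrite powR_leN ?oppr_le0 ?(ltW b_gt0)// le_max lexx.
    + exact: cvg_cst.
    + apply: cvg_EFin; first exact: nearW.
      apply: cvg_geometric; rewrite ger0_norm ?powR_ge0//.
      by rewrite powR2_lt1// oppr_lt0.
  - apply: aeW => y i _; rewrite gee0_abs; last by rewrite mule_ge0 ?tker_ge0.
    rewrite lee_wpmul2r// lee_fin powR_leN ?max_gt0// ?oppr_le0 ?(ltW b_gt0)//.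
    rewrite ge_max !le_max lexx orbT andbT; apply/orP; left.
    by rewrite ler_peMl ?(ltW r0)// exprn_ege1// ler1n.
apply: contrapT => /forallNP nlt.
suff : e%:E <= 0 by rewrite lee_fin leNgt e0.
rewrite -(cvg_lim _ h)//; apply: lime_ge; first by apply/cvg_ex; exists 0.
by apply: nearW => i; rewrite leNgt; apply/negP/nlt.
Qed.

(** Stands in for an intermediate value theorem in the radius: along r 2^j the truncated potential
    starts above t and ends below it, and the last radius before the crossing is kept. *)
Lemma tpot_stop f x (t : R) : measurable_fun setT f -> (forall x, 0 <= f x) ->
  (0 < t)%R -> t%:E < pot f x -> tpot 1 f x < +oo ->
  exists r, [/\ (0 < r)%R, t%:E < tpot r f x & tpot (2 * r) f x <= t%:E].
Proof.
move=> mf f0 t0 tp fin.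
have [r r0 ti] : exists2 r, (0 < r)%R & t%:E < tpot r f x.
  by have [i ti] := pot_small mf f0 tp; exists (2^-1 ^+ i)%R.
have finr : tpot r f x < +oo by exact: (tpot_fin_all reg b_gt0 mf f0 ltr01 fin).
have [j0 hj0] := tpot_large mf f0 r0 t0 finr.
have := ex_minnP (ex_intro (fun j => tpot (2 ^+ j * r) f x <= t%:E) j0 (ltW hj0)).
case=> -[|j] hj minj.
  have r1 : (2 ^+ 0 * r = r)%R by rewrite expr0 mul1r.
  have : tpot r f x <= t%:E by rewrite -{1}r1.
  by move/(lt_le_trans ti); rewrite ltxx.
exists (2 ^+ j * r)%R; split.
- by rewrite mulr_gt0// exprn_gt0.
- by rewrite ltNge; apply/negP => /minj; rewrite ltnn.
- by rewrite mulrA -exprS.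
Qed.

(** Young's inequality without sharp constants: either a <= e k^(1/(p - 1)) and the first term
    dominates, or the second does. The parameter e is left free for absorption arguments. *)
Lemma young_cut (p e k a : R) : (1 < p)%R -> (0 < e)%R -> (0 <= k)%R -> (0 <= a)%R ->
  (k * a <= e * k `^ (p / (p - 1)) + e `^ (1 - p) * a `^ p)%R.
Proof.
move=> p1 e0 k0 a0; have p10 : (0 < p - 1)%R by rewrite subr_gt0.
have [->|kn0] := eqVneq k 0%R.
  by rewrite mul0r addr_ge0 ?mulr_ge0 ?powR_ge0// ltW.
have kp : (0 < k)%R by rewrite lt_neqAle eq_sym kn0.
have [ha|ha] := leP a (e * k `^ (p - 1)^-1)%R.
  apply: (@le_trans _ _ (e * k `^ (p / (p - 1)))%R).
    apply: (le_trans (ler_wpM2l k0 ha)).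
    have -> : (p / (p - 1) = 1 + (p - 1)^-1)%R.
      by rewrite -{1}(subrK 1%R p) mulrDl mulfV ?gt_eqF// mul1r.
    by rewrite powRD0// powRr1// mulrCA.
  by rewrite lerDl mulr_ge0// powR_ge0.
apply: (@le_trans _ _ (e `^ (1 - p) * a `^ p)%R); last first.
  by rewrite lerDr mulr_ge0// ?powR_ge0// ltW.
have ap : (0 < a)%R by rewrite (le_lt_trans _ ha)// mulr_ge0 ?powR_ge0// ltW.
have -> : (a `^ p = a `^ (p - 1) * a)%R.
  by rewrite mulrC mulr_powRB1// (lt_trans ltr01).
rewrite mulrA ler_wpM2r//.
have -> : (1 - p = - (p - 1))%R by rewrite opprB.
have := powR_le (ltW p10) (mulr_ge0 (ltW e0) (powR_ge0 _ _)) (ltW ha).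
rewrite powRM ?powR_ge0 ?(ltW e0)// -powRrM mulVf ?gt_eqF// powRr1// => h.
by rewrite powRN mulrC ler_pdivlMr ?powR_gt0// mulrC.
Qed.

(** The condition N < b p / (p - 1) makes the conjugate power of the truncated kernel integrable. *)
Lemma tpot_Lp (p r e : R) x : (1 < p)%R -> (N < b * (p / (p - 1)))%R ->
  (0 < r)%R -> (0 < e)%R ->
  exists2 D : R, (0 < D)%R & forall f : T -> R, measurable_fun setT f ->
    (forall x, 0 <= f x)%R ->
    tpot r (EFin \o f) x <= e%:E + D%:E * \int[mu]_y (f y `^ p)%:E.
Proof.
move=> p1 Nb r0 e0.
have bp0 : (0 < b * (p / (p - 1)))%R.
  by rewrite mulr_gt0// divr_gt0 ?subr_gt0// (lt_trans ltr01).
have [K K0 /(_ _ (measurable_rhol reg x) (rho0 x) (ball_upp reg x) _ r0) hK] :=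
  @int_tail_power _ T R mu N _ C C0 bp0 Nb.
pose Q := (K * r `^ (N - b * (p / (p - 1))))%R.
have Q0 : (0 < Q)%R by rewrite mulr_gt0// powR_gt0.
(* Q bounds the integral of the conjugate power of the kernel, so Young's inequality with parameter
   e / Q leaves a first term of at most e. *)
exists ((e / Q) `^ (1 - p))%R; first by rewrite powR_gt0// divr_gt0.
move=> f mf f0.
have mfp : measurable_fun setT (fun y => (f y `^ p)%:E).
  apply/measurable_EFinP.
  by apply: (@measurableT_comp _ _ _ _ _ _ (@powR R ^~ p)%R).
have mk : measurable_fun setT
    (fun y => (Num.max r (rho x y) `^ (- (b * (p / (p - 1)))))%:E).
  exact: (measurable_tkerx _ reg).
apply: (@le_trans _ _ (\int[mu]_y ((e / Q)%:E *
    (Num.max r (rho x y) `^ (- (b * (p / (p - 1)))))%:E +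
    ((e / Q) `^ (1 - p))%:E * (f y `^ p)%:E))).
  apply: leI => y; first by rewrite mule_ge0 ?tker_ge0 ?lee_fin.
  rewrite /= -!EFinM -EFinD lee_fin -mulNr [X in (_ <= _ * X + _)%R]powRrM.
  by apply: young_cut; rewrite ?divr_gt0 ?powR_ge0.
rewrite ge0_integralD//; last 4 first.
- by move=> y _; rewrite -EFinM lee_fin mulr_ge0 ?powR_ge0// divr_ge0// ltW.
- by apply: measurable_funeM.
- by move=> y _; rewrite -EFinM lee_fin mulr_ge0 ?powR_ge0.
- by apply: measurable_funeM.
rewrite !ge0_integralZl_EFin//; last 4 first.
- by move=> y _; rewrite lee_fin powR_ge0.
- exact: powR_ge0.
- by move=> y _; rewrite lee_fin powR_ge0.
- by rewrite divr_ge0// ltW.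
rewrite leeD2r// (@le_trans _ _ ((e / Q)%:E * Q%:E))//.
  by rewrite lee_wpmul2l// lee_fin divr_ge0// ltW.
by rewrite -EFinM divfK// gt_eqF.
Qed.

End potential_limits.

(** * Dyadic averages and maximal functions *)

Section doob.
Context d {T : measurableType d} {R : realType}.
Variable mu : {sigma_finite_measure set T -> \bar R}.
Local Open Scope ereal_scope.

Section average.
Variables (Q : T -> T -> bool) (v : T -> \bar R).
Hypotheses (mQ : measurable_fun setT (fun p : T * T => Q p.1 p.2))
  (Qsym : forall x y, Q x y = Q y x)
  (Qtrans : forall x y z, Q x y -> Q y z -> Q x z)
  (mv : measurable_fun setT v) (v0 : forall x, 0 <= v x).

(** A partition into cells is encoded by the relation [Q] of lying in the same cell. This is the v
    dx-mass of the cell of x, and [avg] is the conditional expectation with respect to v dx. *)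
Definition wmass x := \int[mu]_y (ind (Q x y) * v y).

Hypothesis mass_gt0 : forall x, 0 < wmass x.
Hypothesis mass_lty : forall x, wmass x < +oo.

Definition avg (F : T -> R) x : R :=
  (fine (\int[mu]_y (ind (Q x y) * ((F y)%:E * v y))) / fine (wmass x))%R.

Let mQx x : measurable_fun setT (Q x).
Proof.
rewrite (_ : Q x = (fun p => Q p.1 p.2) \o (pair x))//.
exact: (measurableT_comp mQ).
Qed.

Let mK (w : T -> \bar R) : measurable_fun setT w ->
  measurable_fun setT (fun p : T * T => ind (Q p.1 p.2) * w p.2).
Proof.
move=> mw; apply: emeasurable_funM; first exact: measurable_ind.
exact: measurable_snd_comp.
Qed.

Let fm_gt0 x : (0 < fine (wmass x))%R.
Proof. by rewrite fine_gt0// mass_gt0 mass_lty. Qed.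

Let massE x : (fine (wmass x))%:E = wmass x.
Proof. by rewrite fineK// ge0_fin_numE// ltW. Qed.

Let Q_eq x y z : Q x y -> Q x z = Q y z.
Proof.
move=> xy; apply/idP/idP; last exact: Qtrans.
by apply: Qtrans; rewrite Qsym.
Qed.

Lemma mass_eq x y : Q x y -> wmass x = wmass y.
Proof. by move=> xy; apply: eq_integral => z _; rewrite (Q_eq _ xy). Qed.

Lemma avg_eq F x y : Q x y -> avg F x = avg F y.
Proof.
move=> xy; rewrite /avg (mass_eq xy); congr (fine _ / _)%R.
by apply: eq_integral => z _; rewrite (Q_eq _ xy).
Qed.

Lemma avg_ge0 F x : (forall x, 0 <= F x)%R -> (0 <= avg F x)%R.
Proof.
move=> F0; rewrite divr_ge0 ?(ltW (fm_gt0 _))// fine_ge0// int_ge0// => y.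
by rewrite !mule_ge0 ?ind_ge0 ?lee_fin.
Qed.

Let mFv (F : T -> R) : measurable_fun setT F ->
  measurable_fun setT (fun y => (F y)%:E * v y).
Proof. by move=> mF; apply: emeasurable_funM => //; exact/measurable_EFinP. Qed.

Lemma measurable_avg (F : T -> R) : measurable_fun setT F -> (forall x, 0 <= F x)%R ->
  measurable_fun setT (avg F).
Proof.
move=> mF F0; apply: measurable_funM.
  apply: (measurableT_comp (@fine_measurable R setT measurableT)).
  apply: measurable_int2; first exact: (mK (mFv mF)).
  by move=> x y; rewrite !mule_ge0 ?ind_ge0 ?lee_fin.
rewrite (_ : (fun _ => _) = (fun x => (fine (wmass x)) `^ (-1))%R); last first.
  by apply/funext => x; rewrite powR_inv1// ltW.
apply: (@measurableT_comp _ _ _ _ _ _ (@powR R ^~ (-1))%R).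
  exact: measurable_powR.
apply: (measurableT_comp (@fine_measurable R setT measurableT)).
apply: measurable_int2; first exact: mK.
by move=> x y; rewrite mule_ge0 ?ind_ge0.
Qed.

(* Integrating over [x] first, a function constant on the classes of [Q]
   comes out of the inner integral: no countable decomposition is needed. *)
Lemma int_avg (F G : T -> R) : measurable_fun setT F -> (forall x, 0 <= F x)%R ->
  measurable_fun setT G -> (forall x, 0 <= G x)%R ->
  (forall x y, Q x y -> G x = G y) ->
  (forall x, \int[mu]_y (ind (Q x y) * ((F y)%:E * v y)) < +oo) ->
  \int[mu]_x ((avg F x * G x)%:E * v x) = \int[mu]_x ((F x * G x)%:E * v x).
Proof.
move=> mF F0 mG G0 QG Ffin.
pose H x := (G x / fine (wmass x))%R.
have H0 x : (0 <= H x)%R by rewrite divr_ge0// ltW.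
have mH : measurable_fun setT H.
  apply: measurable_funM => //.
  rewrite (_ : (fun _ => _) = (fun x => (fine (wmass x)) `^ (-1))%R); last first.
    by apply/funext => x; rewrite powR_inv1// ltW.
  apply: (@measurableT_comp _ _ _ _ _ _ (@powR R ^~ (-1))%R).
    exact: measurable_powR.
  apply: (measurableT_comp (@fine_measurable R setT measurableT)).
  apply: measurable_int2; first exact: mK.
  by move=> x y; rewrite mule_ge0 ?ind_ge0.
pose L x y := ((H x)%:E * v x) * (ind (Q x y) * ((F y)%:E * v y)).
have L0 x y : 0 <= L x y by rewrite !mule_ge0 ?ind_ge0 ?lee_fin.
have mL : measurable_fun setT (fun p : T * T => L p.1 p.2).
  apply: emeasurable_funM; last exact: (mK (mFv mF)).
  exact: (measurable_fst_comp (mFv mH)).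
transitivity (\int[mu]_x \int[mu]_y L x y).
  apply: eq_integral => x _; rewrite ge0_integralZl//; last 3 first.
  - by apply: emeasurable_funM; [exact: measurable_ind|exact: mFv].
  - by move=> y _; rewrite !mule_ge0 ?ind_ge0 ?lee_fin.
  - by rewrite mule_ge0 ?lee_fin.
  rewrite /avg /H muleAC -[X in (_ * X) * _]fineK; last first.
    rewrite ge0_fin_numE// int_ge0// => y.
    by rewrite !mule_ge0 ?ind_ge0 ?lee_fin.
  by rewrite -EFinM; congr (_%:E * _); ring.
rewrite (tonelli mL L0); apply: eq_integral => y _.
rewrite (_ : \int[mu]_x L x y = \int[mu]_x (((H y * F y)%:E * v y) *
    (ind (Q y x) * v x))); last first.
  apply: eq_integral => x _; rewrite /L Qsym; have [yx|] := boolP (Q y x); last first.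
    by rewrite indF !(mul0e, mule0).
  have -> : H x = H y by rewrite /H -(mass_eq yx) (QG _ _ yx).
  rewrite indT !mul1e [(H y * F y)%:E]EFinM !muleA.
  by rewrite (muleAC (H y)%:E (v x)) muleAC.
rewrite ge0_integralZl//; last 3 first.
- by apply: emeasurable_funM => //; exact: measurable_ind.
- by move=> x _; rewrite mule_ge0 ?ind_ge0.
- by rewrite mule_ge0// lee_fin mulr_ge0.
rewrite -/(wmass y) -massE muleAC -EFinM; congr (_%:E * _).
by rewrite mulrAC divfK ?gt_eqF// mulrC.
Qed.

(** From F <= 1 + F^p and the finite mass of the cell. *)
Lemma int_lty (p : R) (F : T -> R) x : (1 < p)%R -> measurable_fun setT F ->
  (forall x, 0 <= F x)%R -> \int[mu]_x ((F x `^ p)%:E * v x) < +oo ->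
  \int[mu]_y (ind (Q x y) * ((F y)%:E * v y)) < +oo.
Proof.
move=> p1 mF F0 Fp.
have mFp : measurable_fun setT (fun y => (F y `^ p)%R).
  by apply: (@measurableT_comp _ _ _ _ _ _ (@powR R ^~ p)).
apply: (@le_lt_trans _ _ (\int[mu]_y (ind (Q x y) * v y + (F y `^ p)%:E * v y))).
  apply: leI => y; first by rewrite !mule_ge0 ?ind_ge0 ?lee_fin.
  case: (Q x y); last by rewrite indF !mul0e add0e mule_ge0 ?lee_fin ?powR_ge0.
  rewrite indT !mul1e -{2}[v y]mul1e -ge0_muleDl ?lee_fin ?powR_ge0//.
  rewrite -EFinD lee_wpmul2r// lee_fin; have [F1|F1] := leP (F y) 1%R.
    by rewrite (le_trans F1)// lerDl powR_ge0.
  by rewrite ler_wpDl// le1r_powR// ltW.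
rewrite ge0_integralD//; last 4 first.
- by move=> y _; rewrite mule_ge0 ?ind_ge0.
- by apply: emeasurable_funM => //; exact: measurable_ind.
- by move=> y _; rewrite mule_ge0 ?lee_fin ?powR_ge0.
- exact: mFv.
by rewrite lte_add_pinfty// mass_lty.
Qed.

(** Jensen's inequality up to a constant: averaging F <= t + t^(1 - p) F^p bounds the mean of F by t
    + t^(1 - p) S, and t = S^(1/p) balances the two terms. If S = 0, t tends to 0. *)
Lemma avg_pow (p : R) (F : T -> R) x : (1 < p)%R -> measurable_fun setT F ->
  (forall x, 0 <= F x)%R -> \int[mu]_x ((F x `^ p)%:E * v x) < +oo ->
  (avg F x `^ p <= 2 `^ p * avg (fun y => F y `^ p) x)%R.
Proof.
move=> p1 mF F0 Fp; have p0 : (0 < p)%R := lt_trans ltr01 p1.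
have mFp : measurable_fun setT (fun y => (F y `^ p)%R).
  by apply: (@measurableT_comp _ _ _ _ _ _ (@powR R ^~ p)).
pose S := avg (fun y => F y `^ p)%R x.
have S0 : (0 <= S)%R by apply: avg_ge0 => y; exact: powR_ge0.
have Fpx : \int[mu]_y (ind (Q x y) * ((F y `^ p)%:E * v y)) < +oo.
  apply: le_lt_trans Fp; apply: leI => y.
    by rewrite !mule_ge0 ?ind_ge0 ?lee_fin ?powR_ge0.
  case: (Q x y); first by rewrite indT mul1e.
  by rewrite indF mul0e mule_ge0 ?lee_fin ?powR_ge0.
have key (t : R) : (0 < t)%R -> (avg F x <= t + t `^ (1 - p) * S)%R.
  move=> t0.
  have : \int[mu]_y (ind (Q x y) * ((F y)%:E * v y)) <=
     t%:E * wmass x + (t `^ (1 - p))%:E *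
       \int[mu]_y (ind (Q x y) * ((F y `^ p)%:E * v y)).
    rewrite /wmass -!ge0_integralZl_EFin ?(ltW t0) ?powR_ge0//; last 4 first.
    - by move=> y _; rewrite !mule_ge0 ?ind_ge0 ?lee_fin ?powR_ge0.
    - by apply: emeasurable_funM; [exact: measurable_ind|exact: mFv].
    - by move=> y _; rewrite mule_ge0 ?ind_ge0.
    - by apply: emeasurable_funM => //; exact: measurable_ind.
    rewrite -ge0_integralD//; last 4 first.
    - by move=> y _; rewrite !mule_ge0 ?ind_ge0 ?lee_fin// ltW.
    - apply: measurable_funeM; apply: emeasurable_funM => //.
      exact: measurable_ind.
    - by move=> y _; rewrite !mule_ge0 ?ind_ge0 ?lee_fin ?powR_ge0.
    - apply: measurable_funeM; apply: emeasurable_funM; last exact: mFv.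
      exact: measurable_ind.
    apply: leI => y; first by rewrite !mule_ge0 ?ind_ge0 ?lee_fin.
    case: (Q x y); last by rewrite indF !(mul0e, mule0) adde0.
    rewrite indT !mul1e muleA -ge0_muleDl ?mule_ge0 ?lee_fin ?powR_ge0 ?(ltW t0)//.
    rewrite -EFinM -EFinD lee_wpmul2r// lee_fin.
    have := young_cut p1 t0 (@ler01 R) (F0 y).
    by rewrite mul1r powR1 mulr1.
  rewrite -massE -[X in X <= _]fineK; last first.
    rewrite ge0_fin_numE; first exact: int_lty p1 mF F0 Fp.
    by apply: int_ge0 => y; rewrite !mule_ge0 ?ind_ge0 ?lee_fin.
  rewrite -[X in _ + _ * X]fineK; last first.
    rewrite ge0_fin_numE//.
    by apply: int_ge0 => y; rewrite !mule_ge0 ?ind_ge0 ?lee_fin ?powR_ge0.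
  rewrite -!EFinM -EFinD lee_fin => h.
  by rewrite /avg ler_pdivrMr// mulrDl /S /avg mulrA divfK ?gt_eqF.
have [Sp|Sp] := ltP 0%R S; last first.
  have SE : S = 0%R by apply/eqP; rewrite eq_le Sp S0.
  have -> : avg F x = 0%R.
    apply/eqP; rewrite eq_le avg_ge0// andbT; apply/ler_addgt0Pr => e e0.
    by have := key _ e0; rewrite SE mulr0 addr0 add0r.
  by rewrite powR0 ?gt_eqF// mulr_ge0// powR_ge0.
have := key (S `^ p^-1)%R; rewrite powR_gt0// => /(_ isT).
rewrite -powRrM mulrBr mulr1 mulVf ?gt_eqF// powRD0// powRN powRr1//.
rewrite divfK ?gt_eqF// => h.
have {h} : (avg F x <= 2 * S `^ p^-1)%R by rewrite (le_trans h)// mulr_natl mulr2n.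
move/(powR_le (ltW p0) (avg_ge0 x F0)).
by rewrite powRM ?powR_ge0// -[in X in X -> _]powRrM mulVf ?gt_eqF// powRr1.
Qed.

End average.

(** * Doob's maximal inequality for nested partitions *)

Section filtration.
Variables (Q : nat -> T -> T -> bool) (v : T -> \bar R).
Hypotheses (mQ : forall i, measurable_fun setT (fun p : T * T => Q i p.1 p.2))
  (Qsym : forall i x y, Q i x y = Q i y x)
  (Qtrans : forall i x y z, Q i x y -> Q i y z -> Q i x z)
  (Qnest : forall i x y, Q i.+1 x y -> Q i x y)
  (mv : measurable_fun setT v) (v0 : forall x, 0 <= v x)
  (mass_gt0 : forall i x, 0 < wmass (Q i) v x)
  (mass_lty : forall i x, wmass (Q i) v x < +oo).
Variables p q : R.
Hypotheses (p1 : (1 < p)%R) (qE : q = (p / (p - 1))%R).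

Fixpoint maxavg (F : T -> R) (N : nat) (x : T) : R :=
  if N is N'.+1 then Num.max (maxavg F N' x) (avg (Q N) v F x)
  else avg (Q 0) v F x.

Lemma avg_le_maxavg F N i x : (i <= N)%N -> (avg (Q i) v F x <= maxavg F N x)%R.
Proof.
elim: N => [|N IH]; first by rewrite leqn0 => /eqP->.
rewrite leq_eqVlt => /predU1P[->|] /=; first by rewrite le_max lexx orbT.
by rewrite ltnS => /IH h; rewrite le_max h.
Qed.

Variable F : T -> R.
Hypotheses (mF : measurable_fun setT F) (F0 : forall x, (0 <= F x)%R).
Hypothesis Fp : \int[mu]_x ((F x `^ p)%:E * v x) < +oo.

Let p0 : (0 < p)%R := lt_trans ltr01 p1.
Let p10 : (0 < p - 1)%R. Proof. by rewrite subr_gt0. Qed.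
Let q0 : (0 < q)%R. Proof. by rewrite qE divr_gt0. Qed.

Let a0 i x : (0 <= avg (Q i) v F x)%R.
Proof. exact: (avg_ge0 v0 (mass_gt0 i) (mass_lty i)). Qed.

Let m0 N x : (0 <= maxavg F N x)%R.
Proof. exact: le_trans (a0 0 x) (avg_le_maxavg _ _ _). Qed.

Let ma i : measurable_fun setT (avg (Q i) v F).
Proof. exact: (measurable_avg (mQ i) mv v0 (mass_gt0 i) (mass_lty i)). Qed.

Lemma measurable_maxavg N : measurable_fun setT (maxavg F N).
Proof. by elim: N => [|N IH]; [exact: ma|exact: measurable_maxr]. Qed.

Let mpow (G : T -> R) r : measurable_fun setT G ->
  measurable_fun setT (fun x => (G x `^ r)%R).
Proof. by move=> mG; apply: (@measurableT_comp _ _ _ _ _ _ (@powR R ^~ r)). Qed.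

Let mw (G : T -> R) : measurable_fun setT G ->
  measurable_fun setT (fun x => (G x)%:E * v x).
Proof. by move=> mG; apply: emeasurable_funM => //; exact/measurable_EFinP. Qed.


Let Qnests i j x y : (i <= j)%N -> Q j x y -> Q i x y.
Proof.
elim: j => [|j IH]; first by rewrite leqn0 => /eqP->.
rewrite leq_eqVlt => /predU1P[->//|]; rewrite ltnS => ij /Qnest.
exact: IH.
Qed.

Let maxavg_eq N j x y : (N <= j)%N -> Q j x y -> maxavg F N x = maxavg F N y.
Proof.
elim: N => [|N IH] Nj xy /=.
  by apply: avg_eq; [exact: Qsym|exact: Qtrans|exact: Qnests xy].
rewrite (IH (ltnW Nj))//; congr Num.max.
by apply: avg_eq; [exact: Qsym|exact: Qtrans|exact: Qnests xy].
Qed.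

(** [avg_pow] bounds the integrand by the mean of F^p, and [int_avg] with G = 1 removes the mean.
    This a priori finiteness is what permits absorption in [doob_maximal]. *)
Let avg_p_int i : \int[mu]_x ((avg (Q i) v F x `^ p)%:E * v x) < +oo.
Proof.
have mFp := mpow p mF.
have h := @int_avg (Q i) v (mQ i) (@Qsym i) (@Qtrans i) mv v0 (mass_gt0 i)
  (mass_lty i) (fun y => (F y `^ p)%R) (cst 1%R) mFp (fun _ => powR_ge0 _ _)
  (measurable_cst _) (fun _ => ler01) (fun _ _ _ => erefl) _.
apply: (@le_lt_trans _ _ (\int[mu]_x ((2 `^ p)%:E * ((avg (Q i) v (fun y => F y `^ p)%R x * 1)%:E * v x)))).
  apply: leI => x; first by rewrite mule_ge0 ?lee_fin ?powR_ge0.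
  rewrite muleA -EFinM lee_wpmul2r// lee_fin mulr1.
  exact: (avg_pow (mQ i) mv v0 (mass_gt0 i) (mass_lty i)).
rewrite ge0_integralZl_EFin ?powR_ge0//; last 2 first.
- move=> x _; rewrite mule_ge0// lee_fin mulr1.
  apply: (avg_ge0 v0 (mass_gt0 i) (mass_lty i)) => z.
  exact: powR_ge0.
- apply: (mw (G := fun x => (avg (Q i) v (fun y => F y `^ p)%R x * 1)%R)).
  apply: measurable_funM => //.
  apply: (measurable_avg (mQ i) mv v0 (mass_gt0 i) (mass_lty i)) => // z.
  exact: powR_ge0.
apply: lty_mulEFin; first exact: powR_ge0.
rewrite h//; last first.
  move=> x; apply: le_lt_trans Fp; apply: leI => y.
    by rewrite !mule_ge0 ?ind_ge0 ?lee_fin ?powR_ge0.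
  case: (Q i x y); first by rewrite indT mul1e.
  by rewrite indF mul0e mule_ge0 ?lee_fin ?powR_ge0.
by under eq_integral do rewrite mulr1.
Qed.

Let maxavg_p_int N : \int[mu]_x ((maxavg F N x `^ p)%:E * v x) < +oo.
Proof.
elim: N => [|N IH]; first exact: avg_p_int.
apply: (@le_lt_trans _ _ (\int[mu]_x ((maxavg F N x `^ p)%:E * v x +
    (avg (Q N.+1) v F x `^ p)%:E * v x))).
  apply: leI => x; first by rewrite mule_ge0 ?lee_fin ?powR_ge0.
  rewrite -ge0_muleDl ?lee_fin ?powR_ge0// lee_wpmul2r// -EFinD lee_fin /=.
  by case: (leP (maxavg F N x)) => _; rewrite ?lerDl ?lerDr powR_ge0.
rewrite ge0_integralD//; last 4 first.
- by move=> x _; rewrite mule_ge0 ?lee_fin ?powR_ge0.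
- exact: (mw (mpow p (measurable_maxavg N))).
- by move=> x _; rewrite mule_ge0 ?lee_fin ?powR_ge0.
- exact: (mw (mpow p (ma N.+1))).
exact: (lte_add_pinfty IH (avg_p_int _)).
Qed.

(* [d (x ^ p) = q x d (x ^ (p - 1))], integrated from [a] to [b] *)
Let pow_step (a b : R) : (0 <= a)%R -> (a <= b)%R ->
  (b `^ p <= a `^ p + q * (b * (b `^ (p - 1) - a `^ (p - 1))))%R.
Proof.
move=> aa ab; have bb : (0 <= b)%R := le_trans aa ab.
have hy := conjugate_powR bb (powR_ge0 a (p - 1)) p0 q0.
have pq : (p^-1 + q^-1 = 1)%R.
  by rewrite qE invf_div -[X in (X + _)%R]mul1r -mulrDl addrC subrK divff// gt_eqF.
have {hy} := hy pq; rewrite -powRrM.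
have -> : ((p - 1) * q = p)%R by rewrite qE mulrC divfK// gt_eqF.
move=> hy; rewrite mulrBr mulr_powRB1//.
have hq : (q * (b * a `^ (p - 1)) <= q / p * b `^ p + a `^ p)%R.
  apply: (le_trans (ler_wpM2l (ltW q0) hy)).
  rewrite le_eqVlt; apply/orP; left; apply/eqP.
  by field; rewrite ?gt_eqF.
(* q - q / p = 1 for conjugate exponents. *)
have hb : (b `^ p = q * b `^ p - q / p * b `^ p)%R.
  by rewrite qE; field; rewrite ?gt_eqF.
by rewrite mulrBr; lra.
Qed.

(** Induction on N. By [pow_step], passing to level N + 1 adds to the p-th power at most q times the
    new average times G, where G is the increment of the power p - 1 of the maximal function. G
    vanishes unless the new average is the maximum, and it is constant on the cells of level N + 1,
    so [int_avg] replaces the average by F. The increments G telescope. *)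
Let step N : \int[mu]_x ((maxavg F N x `^ p)%:E * v x) <=
  q%:E * \int[mu]_x ((F x * maxavg F N x `^ (p - 1))%:E * v x).
Proof.
have int_avgN i (G : T -> R) : measurable_fun setT G -> (forall x, 0 <= G x)%R ->
    (forall x y, Q i x y -> G x = G y) ->
    \int[mu]_x ((avg (Q i) v F x * G x)%:E * v x) =
    \int[mu]_x ((F x * G x)%:E * v x).
  move=> mG G0 QG.
  apply: (int_avg (mQ i) (@Qsym i) (@Qtrans i) mv v0 (mass_gt0 i) (mass_lty i)) => //.
  by move=> x; apply: (int_lty (mQ i) mv v0 (mass_lty i) x p1).
have mFG (G : T -> R) : measurable_fun setT G ->
    measurable_fun setT (fun x => (F x * G x)%:E * v x).
  by move=> mG; apply: (mw (G := fun x => (F x * G x)%R)); exact: measurable_funM.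
elim: N => [|N IH] /=.
  have <- := int_avgN 0%N (fun x => avg (Q 0) v F x `^ (p - 1))%R
    (mpow (p - 1) (ma 0)) (fun x => powR_ge0 _ _); last first.
    move=> x y xy; congr (_ `^ _)%R.
    by apply: avg_eq; [exact: Qsym|exact: Qtrans|].
  rewrite -ge0_integralZl_EFin ?(ltW q0)//; last 2 first.
  - by move=> x _; rewrite mule_ge0 ?lee_fin// mulr_ge0// powR_ge0.
  - apply: (mw (G := fun x => (avg (Q 0) v F x * avg (Q 0) v F x `^ (p - 1))%R)).
    by apply: measurable_funM => //; exact: mpow.
  apply: leI => x; first by rewrite mule_ge0 ?lee_fin ?powR_ge0.
  rewrite muleA -EFinM lee_wpmul2r// lee_fin mulr_powRB1// ler_peMl ?powR_ge0//.
  by rewrite qE ler_pdivlMr// mul1r gerBl.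
have mm := measurable_maxavg N; have mm0 := m0 N.
have mQe x y := @maxavg_eq N N.+1 x y (leqnSn N).
move: (maxavg F N) IH mm mm0 mQe => m IH mm mm0 mQe.
have ma' : measurable_fun setT (fun x => Num.max (m x) (avg (Q N.+1) v F x)).
  exact: measurable_maxr.
pose G x := (Num.max (m x) (avg (Q N.+1) v F x) `^ (p - 1) - m x `^ (p - 1))%R.
have G0 x : (0 <= G x)%R.
  by rewrite subr_ge0 powR_le ?(ltW p10)//= le_max lexx.
have mG : measurable_fun setT G.
  by apply: measurable_funB; apply: mpow.
have QG x y : Q N.+1 x y -> G x = G y.
  move=> xy; have axy : avg (Q N.+1) v F x = avg (Q N.+1) v F y.
    by apply: avg_eq; [exact: Qsym|exact: Qtrans|].
  by rewrite /G (mQe _ _ xy) axy.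
apply: (@le_trans _ _ (\int[mu]_x ((m x `^ p)%:E * v x +
    q%:E * ((avg (Q N.+1) v F x * G x)%:E * v x)))).
  apply: leI => x; first by rewrite mule_ge0 ?lee_fin ?powR_ge0.
  rewrite muleA -EFinM -ge0_muleDl; first last.
  - by rewrite lee_fin; apply: mulr_ge0; [exact: ltW|exact: mulr_ge0].
  - by rewrite lee_fin powR_ge0.
  rewrite lee_wpmul2r// -EFinD lee_fin /G /=.
  case: (leP (m x)) => h; first exact: pow_step.
  by rewrite subrr !mulr0 addr0.
have aG0 x : (0 <= avg (Q N.+1) v F x * G x)%R by exact: mulr_ge0.
have mag : measurable_fun setT (fun x => (avg (Q N.+1) v F x * G x)%:E * v x).
  apply: (mw (G := fun x => (avg (Q N.+1) v F x * G x)%R)).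
  exact: measurable_funM.
have ag0 x : 0 <= (avg (Q N.+1) v F x * G x)%:E * v x.
  by rewrite mule_ge0// lee_fin.
have qag0 x : 0 <= q%:E * ((avg (Q N.+1) v F x * G x)%:E * v x).
  by rewrite mule_ge0// lee_fin ltW.
have mv0 x : 0 <= (m x `^ p)%:E * v x by rewrite mule_ge0// lee_fin powR_ge0.
have FG0 x : 0 <= (F x * G x)%:E * v x by rewrite mule_ge0// lee_fin mulr_ge0.
have Fm0 x : 0 <= (F x * m x `^ (p - 1))%:E * v x.
  by rewrite mule_ge0// lee_fin mulr_ge0// powR_ge0.
rewrite (intD mu (mw (mpow p mm)) (measurable_funeM _ mag) mv0 qag0).
rewrite (intZ mu (ltW q0) mag ag0) (int_avgN _ _ mG G0 QG).
apply: (le_trans (leeD2r _ IH)).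
rewrite -(ge0_muleDr _ (int_ge0 mu Fm0) (int_ge0 mu FG0)).
rewrite -(intD mu (mFG _ (mpow _ mm)) (mFG _ mG) Fm0 FG0).
apply: lee_wpmul2l; first by rewrite lee_fin ltW.
apply: leI => x; first exact: adde_ge0.
rewrite -ge0_muleDl; first last.
- by rewrite lee_fin mulr_ge0.
- by rewrite lee_fin mulr_ge0// powR_ge0.
by rewrite lee_wpmul2r// -EFinD -mulrDr addrC subrK.
Qed.

(** Young's inequality with e = 1 / (2q) turns the bound of [step] into half of the left-hand side
    plus a multiple of the integral of F^p. The left-hand side is finite, so the half is absorbed.
    The constant depends neither on N nor on v. *)
Lemma doob_maximal N : \int[mu]_x ((maxavg F N x `^ p)%:E * v x) <=
  (2 * q * (2 * q)^-1 `^ (1 - p))%:E * \int[mu]_x ((F x `^ p)%:E * v x).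
Proof.
move eE : ((2 * q)^-1)%R => e.
have e0 : (0 < e)%R by rewrite -eE invr_gt0 mulr_gt0.
have qe : (q * e = 2^-1)%R by rewrite -eE invfM mulrCA mulfV ?mulr1// gt_eqF.
have absorb E m j : (m <= q * (e * m + E * j) -> m <= 2 * q * E * j)%R.
  have -> : (q * (e * m + E * j) = q * e * m + q * E * j)%R by ring.
  by rewrite qe => h; lra.
set M := \int[mu]_x (_ * _); set J := \int[mu]_x _.
have M0 : 0 <= M by apply: int_ge0 => x; rewrite mule_ge0 ?lee_fin ?powR_ge0.
have J0 : 0 <= J by apply: int_ge0 => x; rewrite mule_ge0 ?lee_fin ?powR_ge0.
have Mfin : M < +oo := maxavg_p_int N.
have h : M <= q%:E * (e%:E * M + (e `^ (1 - p))%:E * J).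
  apply: (le_trans (step N)); rewrite lee_wpmul2l ?lee_fin ?(ltW q0)//.
  rewrite /M /J -!ge0_integralZl_EFin ?powR_ge0 ?(ltW e0)//; last 4 first.
  - by move=> x _; rewrite mule_ge0 ?lee_fin ?powR_ge0.
  - exact: (mw (mpow p mF)).
  - by move=> x _; rewrite mule_ge0 ?lee_fin ?powR_ge0.
  - exact: (mw (mpow p (measurable_maxavg N))).
  rewrite -ge0_integralD//; last 4 first.
  - by move=> x _; rewrite !mule_ge0 ?lee_fin ?powR_ge0 ?(ltW e0).
  - by apply: measurable_funeM; exact: (mw (mpow p (measurable_maxavg N))).
  - by move=> x _; rewrite !mule_ge0 ?lee_fin ?powR_ge0.
  - by apply: measurable_funeM; exact: (mw (mpow p mF)).
  apply: leI => x; first by rewrite mule_ge0 ?lee_fin ?mulr_ge0 ?powR_ge0.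
  rewrite !muleA -!EFinM -ge0_muleDl ?lee_fin ?mulr_ge0 ?powR_ge0 ?(ltW e0)//.
  rewrite lee_wpmul2r// -EFinD lee_fin mulrC.
  have := young_cut p1 e0 (powR_ge0 (maxavg F N x) (p - 1)) (F0 x).
  by rewrite -powRrM -qE (_ : (p - 1) * q = p)%R// qE mulrC divfK// gt_eqF.
move: h; rewrite -(fineK (_ : M \is a fin_num)); last first.
  by rewrite (ge0_fin_numE M0); exact: Mfin.
rewrite -(fineK (_ : J \is a fin_num)); last first.
  by rewrite (ge0_fin_numE J0); exact: Fp.
have -> : q%:E * (e%:E * (fine M)%:E + (e `^ (1 - p))%:E * (fine J)%:E) =
    (q * (e * fine M + e `^ (1 - p) * fine J))%:E by [].
rewrite -EFinM !lee_fin; exact: absorb.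
Qed.

End filtration.
End doob.

(** * The weighted maximal inequality *)

(* Finitely many nested families of cells such that every ball lies in a cell
   of comparable size of one of the families. *)
Record dyadic_system {d} {T : measurableType d} {R : realType}
    (mu : set T -> \bar R) (rho : T -> T -> R) (I : finType)
    (Q : I -> int -> T -> T -> bool) (sc : int -> R) (k : R) : Prop := {
  cell_meas : forall a i, measurable_fun setT (fun p : T * T => Q a i p.1 p.2);
  cell_sym : forall a i x y, Q a i x y = Q a i y x;
  cell_trans : forall a i x y z, Q a i x y -> Q a i y z -> Q a i x z;
  cell_nest : forall a i x y, Q a i x y -> Q a (i + 1) x y;
  scale_gt0 : forall i, 0 < sc i;
  const_gt0 : 0 < k;
  cell_pos : forall a i x, (0 < mu [set y | Q a i x y])%E;
  cell_ball : forall a i x y, Q a i x y -> rho x y <= sc i;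
  ball_cell : forall x r, 0 < r -> exists a i,
    sc i <= k * r /\ forall y, rho x y <= r -> Q a i x y
}.

Section muckenhoupt.
Context d {T : measurableType d} {R : realType}.
Variable mu : {sigma_finite_measure set T -> \bar R}.
Variables (rho : T -> T -> R) (N c C b : R).
Hypothesis reg : regular_space mu rho N c C.
Hypotheses (b_gt0 : 0 < b) (b_ltN : b < N).
Local Open Scope ereal_scope.
Local Notation pot := (pot mu rho b).
Local Notation tpot := (tpot mu rho b).

Let rho0 := rho_ge0 reg.
Let C0 : (0 <= C)%R := ltW (upp_gt0 reg).

Lemma pot_gt0 (f : T -> \bar R) x : measurable_fun setT f -> (forall x, 0 <= f x) ->
  0 < \int[mu]_x f x -> 0 < pot f x.
Proof.
move=> mf f0 If; rewrite lt_neqAle pot_ge0// andbT; apply/eqP => p0.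
have mkf : measurable_fun setT (fun y => epow (rho x y)%:E (- b) * f y).
  by apply: emeasurable_funM => //; exact: (measurable_kerx b reg).
have k0 y : 0 <= epow (rho x y)%:E (- b) * f y by rewrite mule_ge0 ?ker_ge0.
have kp y : 0 < epow (rho x y)%:E (- b).
  have := rho0 x y; rewrite le_eqVlt => /predU1P[<-|xy].
    by rewrite epow0 ?lt0y// oppr_lt0.
  by rewrite epow_EFin// lte_fin powR_gt0.
have ae0 := int0_ae mkf k0 (esym p0).
suff i0 : \int[mu]_x f x = 0 by rewrite i0 ltxx in If.
rewrite -(integral0 mu setT).
apply: ge0_ae_eq_integral => //.
apply: filterS ae0 => y + _ /=; move/eqP; rewrite mule_eq0 gt_eqF//=.
by move/eqP.
Qed.

Lemma tpot_gt0 (f : T -> \bar R) r x : measurable_fun setT f ->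
  (forall x, 0 <= f x) -> (0 < r)%R ->
  0 < \int[mu]_x f x -> 0 < tpot r f x.
Proof.
move=> mf f0 r0 If; rewrite lt_neqAle tpot_ge0// andbT; apply/eqP => p0.
have mkf : measurable_fun setT (fun y => (Num.max r (rho x y) `^ (- b))%:E * f y).
  by apply: emeasurable_funM => //; exact: (measurable_tkerx b reg).
have k0 y : 0 <= (Num.max r (rho x y) `^ (- b))%:E * f y.
  by rewrite mule_ge0 ?tker_ge0.
have ae0 := int0_ae mkf k0 (esym p0).
suff i0 : \int[mu]_x f x = 0 by rewrite i0 ltxx in If.
rewrite -(integral0 mu setT).
apply: ge0_ae_eq_integral => //.
apply: filterS ae0 => y + _ /=; move/eqP; rewrite mule_eq0 gt_eqF//=.
  by move/eqP.
by rewrite lte_fin powR_gt0// max_gt0.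
Qed.

(** Replaces Jensen's inequality for the concave power t: below height A the first term dominates,
    above it the second. *)
Lemma poweR_cut (t A : R) (u : \bar R) : (0 < t)%R -> (t <= 1)%R -> (0 < A)%R ->
  0 <= u -> u `^ t <= (A `^ t)%:E + (A `^ (t - 1))%:E * u.
Proof.
move=> t0 t1 A0; case: u => [u| |]//.
  rewrite lee_fin => u0; rewrite poweR_EFin -EFinM -EFinD lee_fin.
  have [uA|Au] := leP u A.
    apply: (@le_trans _ _ (A `^ t)%R); first by rewrite powR_le// ltW.
    by rewrite lerDl mulr_ge0// powR_ge0.
  apply: (@le_trans _ _ (A `^ (t - 1) * u)%R); last first.
    by rewrite lerDr powR_ge0.
  rewrite -mulr_powRB1// mulrC ler_wpM2r// powR_leN ?subr_le0//.
  exact: ltW.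
by move=> _; rewrite gt0_muley ?lte_fin ?powR_gt0// addey// leey.
Qed.

(* The A_1 condition for the weight [pot f ^ t]. *)
Lemma pot_pow_ball (t : R) : (0 < t)%R -> (t <= 1)%R ->
  exists2 K : R, (0 < K)%R & forall f x r,
  measurable_fun setT f -> (forall x, 0 <= f x) -> (0 < r)%R ->
  0 < tpot r f x -> tpot r f x < +oo ->
  \int[mu]_y (ind (rho x y <= r)%R * pot f y `^ t) <=
    (K * r `^ N)%:E * tpot r f x `^ t.
Proof.
move=> t0 t1; have [K K0 hK] := pot_ball_int reg b_gt0 b_ltN.
exists (C + K)%R; first by rewrite ltr_wpDl.
move=> f x r mf f0 r0 Ap Ay.
pose A := fine (tpot r f x).
have AE : tpot r f x = A%:E by rewrite /A fineK// ge0_fin_numE// ltW.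
have A0 : (0 < A)%R by rewrite /A fine_gt0// Ap Ay.
have mi : measurable_fun setT (fun y => ind (rho x y <= r)%R : \bar R).
  by apply: measurable_ind; exact: (measurable_ball reg).
have mpf := measurable_pot b reg mf f0.
have mip : measurable_fun setT (fun y => ind (rho x y <= r)%R * pot f y).
  exact: emeasurable_funM.
have ip0 y : 0 <= ind (rho x y <= r)%R * pot f y.
  by rewrite mule_ge0 ?ind_ge0 ?pot_ge0.
apply: (@le_trans _ _ (\int[mu]_y ((A `^ t)%:E * ind (rho x y <= r)%R +
    (A `^ (t - 1))%:E * (ind (rho x y <= r)%R * pot f y)))).
  apply: leI => y; first by rewrite mule_ge0 ?ind_ge0 ?poweR_ge0.
  case: (rho x y <= r)%R; last by rewrite indF !(mul0e, mule0) adde0.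
  by rewrite indT !mul1e mule1 poweR_cut ?pot_ge0.
rewrite (intD mu); first last.
- by move=> y; rewrite mule_ge0 ?lee_fin ?powR_ge0.
- by move=> y; rewrite mule_ge0 ?ind_ge0 ?lee_fin ?powR_ge0.
- exact: measurable_funeM.
- exact: measurable_funeM.
rewrite (intZ mu (powR_ge0 _ _) mip ip0) (intZ mu (powR_ge0 _ _) mi (fun=> ind_ge0 _)).
rewrite int_indE; last exact: (measurable_ball reg).
apply: (@le_trans _ _ ((A `^ t)%:E * (C * r `^ N)%:E +
   (A `^ (t - 1))%:E * ((K * r `^ N)%:E * A%:E))).
  apply: leeD; apply: lee_wpmul2l; rewrite ?lee_fin ?powR_ge0//.
    exact: (ball_upp reg _ r0).
  by rewrite -AE; exact: hK.
rewrite AE poweR_EFin -!EFinM -EFinD lee_fin le_eqVlt; apply/orP; left; apply/eqP.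
have -> : (A `^ t = A * A `^ (t - 1))%R by rewrite mulr_powRB1// ltW.
by ring.
Qed.

(** [pot_ball_int] makes the potential integrable on balls of integer radius, and these exhaust the
    space. *)
Lemma pot_lty_ae (f : T -> \bar R) : measurable_fun setT f ->
  (forall x, 0 <= f x) -> (forall x r, (0 < r)%R -> tpot r f x < +oo) ->
  {ae mu, forall x, pot f x < +oo}.
Proof.
move=> mf f0 fin; have x0 : T by exact: point.
have [K K0 hK] := pot_ball_int reg b_gt0 b_ltN.
have mpf := measurable_pot b reg mf f0.
have h i : {ae mu, forall y, ind (rho x0 y <= i.+1%:R)%R * pot f y < +oo}.
  apply: int_lty_ae.
  - apply: emeasurable_funM => //; apply: measurable_ind.
    exact: (measurable_ball reg).
  - by move=> y; rewrite mule_ge0 ?ind_ge0 ?pot_ge0.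
  - apply: (le_lt_trans (hK f x0 i.+1%:R mf f0 _)) => //.
    apply: lty_mulEFin; last exact: fin.
    by rewrite mulr_ge0 ?powR_ge0// ltW.
have := ae_foralln h; apply: filterS => y /(_ (Num.truncn (rho x0 y))).
by rewrite ltW ?truncnS_gt// indT mul1e.
Qed.

End muckenhoupt.

(** * The maximal function over all scales and all grids *)

Section maximal_function.
Context d {T : measurableType d} {R : realType}.
Variable mu : {sigma_finite_measure set T -> \bar R}.
Variables (rho : T -> T -> R) (N c C b : R).
Hypothesis reg : regular_space mu rho N c C.
Hypotheses (b_gt0 : 0 < b) (b_ltN : b < N).
Variables (I : finType) (Q : I -> int -> T -> T -> bool) (sc : int -> R) (k : R).
Hypothesis dya : dyadic_system mu rho Q sc k.
Variables (s q : R).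
Hypotheses (q1 : 1 <= q) (qs : q < s).
Local Open Scope ereal_scope.
Local Notation pot := (pot mu rho b).
Local Notation tpot := (tpot mu rho b).

Let s1 : (1 < s)%R := le_lt_trans q1 qs.
Let s0 : (0 < s)%R := lt_trans ltr01 s1.
Let s10 : (0 < s - 1)%R. Proof. by rewrite subr_gt0. Qed.

Section weighted.
Variable v : T -> \bar R.
Hypotheses (mv : measurable_fun setT v) (v0 : forall x, 0 < v x)
  (vy : forall x, v x < +oo)
  (mass_lty : forall a i x, wmass mu (Q a i) v x < +oo).

Let v00 x : 0 <= v x := ltW (v0 x).

Let mQx a i x : measurable_fun setT (Q a i x).
Proof.
rewrite (_ : Q a i x = (fun p => Q a i p.1 p.2) \o (pair x))//.
exact: (measurableT_comp (cell_meas dya a i)).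
Qed.

Lemma cell_mass_gt0 a i x : 0 < wmass mu (Q a i) v x.
Proof.
have h0 y : 0 <= ind (Q a i x y) * v y by rewrite mule_ge0 ?ind_ge0.
have mh : measurable_fun setT (fun y => ind (Q a i x y) * v y).
  by apply: emeasurable_funM => //; exact: measurable_ind.
rewrite lt_neqAle int_ge0// andbT; apply/eqP => p0.
have ae0 := int0_ae mh h0 (esym p0).
suff i0 : mu [set y | Q a i x y] = 0 by have := cell_pos dya a i x; rewrite i0 ltxx.
rewrite -int_indE// -(integral0 mu setT).
apply: ge0_ae_eq_integral => //; first exact: measurable_ind.
  by move=> y _; exact: ind_ge0.
apply: filterS ae0 => y + _ /=; move/eqP; rewrite mule_eq0 (gt_eqF (v0 y)) orbF.
by move/eqP.
Qed.

(** Cells grow with their integer index, whereas [maxavg] expects partitions that become finer. The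
    window of scales from -m to m is therefore numbered as m - i with i from 0 to 2m. *)
Definition gridmax a (F : T -> R) (m : nat) : T -> R :=
  maxavg mu (fun i => Q a (m%:Z - i%:Z)) v F (m + m).

Lemma maxavg_le (P : nat -> T -> T -> bool) (F : T -> R) M x B :
  (forall i, (i <= M)%N -> (avg mu (P i) v F x <= B)%R) ->
  (maxavg mu P v F M x <= B)%R.
Proof.
elim: M => [|M IH] h /=; first exact: h.
by rewrite ge_max IH ?h// => i iM; rewrite h// (leq_trans iM).
Qed.

Lemma avg_le_gridmax a F (i : int) m x : (`|i| <= m)%N ->
  (avg mu (Q a i) v F x <= gridmax a F m x)%R.
Proof.
move=> im; have ii : i = (m%:Z - (`|m%:Z - i|)%:Z)%R.
  by rewrite gez0_abs ?subr_ge0; lia.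
rewrite {1}ii.
apply: (@avg_le_maxavg _ _ _ mu (fun i => Q a (m%:Z - i%:Z)%R) v F (m + m)).
by lia.
Qed.

Lemma gridmax_nd a F m n x : (m <= n)%N -> (gridmax a F m x <= gridmax a F n x)%R.
Proof.
move=> mn; apply: maxavg_le => i im.
by apply: avg_le_gridmax; lia.
Qed.

Let mg a (F : T -> R) : measurable_fun setT F -> (forall x, 0 <= F x)%R ->
  forall m, measurable_fun setT (gridmax a F m).
Proof.
move=> mF F0 m; apply: measurable_maxavg => //.
- by move=> i; exact: cell_meas dya _ _.
- by move=> i x; exact: cell_mass_gt0.
Qed.

Let gridmax_ge0 a (F : T -> R) m x : (forall x, 0 <= F x)%R -> (0 <= gridmax a F m x)%R.
Proof.
move=> F0; apply: le_trans (avg_le_gridmax a F x (leq0n _ : `|0%Z| <= m)%N).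
exact: (avg_ge0 v00 (cell_mass_gt0 a _) (mass_lty a _) x F0).
Qed.

Lemma gridmax_int a (F : T -> R) m : measurable_fun setT F -> (forall x, 0 <= F x)%R ->
  \int[mu]_x ((F x `^ s)%:E * v x) < +oo ->
  \int[mu]_x ((gridmax a F m x `^ s)%:E * v x) <= (2 * (s / (s - 1)) *
     (2 * (s / (s - 1)))^-1 `^ (1 - s))%:E * \int[mu]_x ((F x `^ s)%:E * v x).
Proof.
move=> mF F0 J.
apply: (@doob_maximal _ _ _ mu (fun i => Q a (m%:Z - i%:Z)%R)) => //.
- by move=> i; exact: cell_meas dya _ _.
- by move=> i x y; exact: cell_sym dya _ _ _ _.
- by move=> i x y z; exact: (cell_trans dya).
- move=> i x y /(cell_nest dya); congr (is_true (Q a _ x y)).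
  by lia.
- by move=> i x; exact: cell_mass_gt0.
Qed.

(** W is the sum over the grids of the limits in m of [gridmax] to the power s. Monotone convergence
    applies because the constant of [gridmax_int] does not depend on m; summing over the grids
    produces the factor #|I|. *)
Lemma gridmax_bound (F : T -> R) : measurable_fun setT F -> (forall x, 0 <= F x)%R ->
  exists W : T -> \bar R, [/\ measurable_fun setT W, (forall x, 0 <= W x),
   (forall a i x, (avg mu (Q a i) v F x `^ s)%:E <= W x) &
   \int[mu]_x (W x * v x) <= (#|I|%:R * (2 * (s / (s - 1)) *
     (2 * (s / (s - 1)))^-1 `^ (1 - s)))%:E * \int[mu]_x ((F x `^ s)%:E * v x)].
Proof.
move=> mF F0.
pose K := (2 * (s / (s - 1)) * (2 * (s / (s - 1)))^-1 `^ (1 - s))%R.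
rewrite -/K; pose J := \int[mu]_x ((F x `^ s)%:E * v x).
have J0 : 0 <= J by apply: int_ge0 => x; rewrite mule_ge0 ?lee_fin ?powR_ge0.
have K0 : (0 < K)%R.
  have h : (0 < 2 * (s / (s - 1)))%R by rewrite mulr_gt0// divr_gt0.
  by rewrite mulr_gt0// powR_gt0// invr_gt0.
pose g a m x := (gridmax a F m x `^ s)%:E.
have g0 a m x : 0 <= g a m x by rewrite lee_fin powR_ge0.
have mgg a m : measurable_fun setT (g a m).
  apply/measurable_EFinP; apply: (@measurableT_comp _ _ _ _ _ _ (@powR R ^~ s)%R).
    exact: measurable_powR.
  exact: mg.
have ndg a x : nondecreasing_seq (g a ^~ x).
  move=> m n mn; rewrite lee_fin powR_le ?(ltW s0)//.
    exact: gridmax_ge0.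
  exact: gridmax_nd.
have cvg_g a x : cvgn (g a ^~ x) by exact: ereal_nondecreasing_is_cvgn.
pose L a x := limn (g a ^~ x).
have L0 a x : 0 <= L a x by apply: lime_ge => //; exact: nearW.
have gL a m x : g a m x <= L a x.
  apply: lime_ge => //; near=> n; apply: ndg.
  by near: n; exact: nbhs_infty_ge.
have mL a : measurable_fun setT (L a).
  apply: (@emeasurable_fun_cvg _ _ _ setT (g a)) => //.
(* For J = +oo the right-hand side is +oo, provided that there is at least one grid; [ball_cell]
   supplies one. *)
have [Jy|Jy] := ltP J +oo; last first.
  have I0 : (0 < #|I|)%N.
    have x0 : T by exact: point.
    have [a _] := ball_cell dya x0 ltr01.
    by apply/card_gt0P; exists a.
  exists (fun x => \sum_(a : I) L a x); split.
  - exact: emeasurable_sum.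
  - by move=> x; apply: sume_ge0 => a _; exact: L0.
  - move=> a i x; apply: (@le_trans _ _ (L a x)).
      apply: le_trans (gL a `|i|%N x).
      rewrite lee_fin powR_le ?(ltW s0)//; last exact: avg_le_gridmax.
      exact: (avg_ge0 v00 (cell_mass_gt0 a _) (mass_lty a _) x F0).
    by rewrite (bigD1 a)//= leeDl// sume_ge0.
  - move: Jy; rewrite leye_eq /J => /eqP ->.
    by rewrite gt0_muley ?leey// lte_fin mulr_gt0// ltr0n.
have LJ a : \int[mu]_x (L a x * v x) <= K%:E * J.
  have -> : \int[mu]_x (L a x * v x) = \int[mu]_x (limn (fun m => g a m x * v x)).
    apply: eq_integral => x _; rewrite limeMr// ge0_fin_numE//.
  rewrite (monotone_convergence mu measurableT); first last.
  - move=> x _ m n mn; apply: lee_wpmul2r => //; exact: ndg.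
  - by move=> m x _; exact: mule_ge0.
  - by move=> m; exact: emeasurable_funM.
  apply: lime_le.
    apply: ereal_nondecreasing_is_cvgn => m n mn; apply: leI => x.
      exact: mule_ge0.
    by apply: lee_wpmul2r => //; exact: ndg.
  apply: nearW => m; exact: gridmax_int.
exists (fun x => \sum_(a : I) L a x); split.
- exact: emeasurable_sum.
- by move=> x; apply: sume_ge0 => a _; exact: L0.
- move=> a i x; apply: (@le_trans _ _ (L a x)).
    apply: le_trans (gL a `|i|%N x).
    rewrite lee_fin powR_le ?(ltW s0)//; last exact: avg_le_gridmax.
    exact: (avg_ge0 v00 (cell_mass_gt0 a _) (mass_lty a _) x F0).
  by rewrite (bigD1 a)//= leeDl// sume_ge0.
- rewrite -/J (_ : \int[mu]_x _ = \sum_(a : I) \int[mu]_x (L a x * v x)).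
    apply: (@le_trans _ _ (\sum_(a : I) K%:E * J)).
      by apply: lee_sum => a _; exact: LJ.
    have JE : J = (fine J)%:E by rewrite fineK// ge0_fin_numE.
    rewrite JE -!EFinM sumEFin lee_fin sumr_const -[leRHS]mulrA mulr_natl.
    exact: lexx.
  rewrite -ge0_integral_sum//; last 2 first.
  - by move=> a; exact: emeasurable_funM.
  - by move=> a x _; exact: mule_ge0.
  by apply: eq_integral => x _; rewrite ge0_sume_distrl.
Unshelve. all: by end_near. Qed.

End weighted.

(* With [u = pot h] and [th = (s - q) / (s - 1)], [v = u ^ th] is an A_1
   weight, and [u ^ (q - s) = v ^ (1 - s)]; hence the means of [h] are controlled
   by [v] times the maximal function of [h / v] with respect to [v dx]. The
   condition [1 <= q] enters through [th <= 1]. *)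
Lemma muckenhoupt : exists2 K : R, (0 < K)%R & forall h : T -> R,
  measurable_fun setT h -> (forall x, 0 <= h x)%R ->
  0 < \int[mu]_x (h x)%:E -> (forall x r, (0 < r)%R -> tpot r (EFin \o h) x < +oo) ->
  \int[mu]_x ((h x `^ s)%:E * epow (pot (EFin \o h) x) (q - s)) < +oo ->
  exists H : T -> R, [/\ measurable_fun setT H, (forall x, 0 <= H x)%R,
    {ae mu, forall y, forall r, (0 < r)%R ->
      \int[mu]_z (ind (rho y z <= r)%R * (h z)%:E) <= (r `^ N * H y)%:E} &
    \int[mu]_x ((H x `^ s)%:E * epow (pot (EFin \o h) x) (q - s)) <=
      K%:E * \int[mu]_x ((h x `^ s)%:E * epow (pot (EFin \o h) x) (q - s))].
Proof.
pose th := ((s - q) / (s - 1))%R.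
have th0 : (0 < th)%R by rewrite divr_gt0// subr_gt0.
have th1 : (th <= 1)%R by rewrite ler_pdivrMr// mul1r lerB.
have [K1 K10 hK1] := pot_pow_ball reg b_gt0 b_ltN th0 th1.
have qs0 : (q - s < 0)%R by rewrite subr_lt0.
pose Kd := (#|I|%:R * (2 * (s / (s - 1)) *
     (2 * (s / (s - 1)))^-1 `^ (1 - s)))%R.
have Kd0 : (0 <= Kd)%R.
  rewrite /Kd mulr_ge0// mulr_ge0 ?powR_ge0// mulr_ge0// divr_ge0//.
    exact: ltW s0.
  exact: ltW.
pose K2 := (K1 * k `^ N)%R.
have K20 : (0 < K2)%R by rewrite mulr_gt0// powR_gt0// (const_gt0 dya).
exists (K2 `^ s * Kd + 1)%R; first by rewrite ltr_wpDl// mulr_ge0// powR_ge0.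
move=> h mh h0 hp finA Jy.
pose eh := EFin \o h; have meh : measurable_fun setT eh by exact/measurable_EFinP.
have eh0 x : 0 <= eh x by rewrite lee_fin.
pose u := pot eh; have mu_ : measurable_fun setT u by exact: (measurable_pot b reg).
have up x : 0 < u x by exact: (pot_gt0 reg b_gt0).
have Ap r x : (0 < r)%R -> 0 < tpot r eh x by move=> r0; exact: (tpot_gt0 b reg).
have uae : {ae mu, forall x, u x < +oo} by exact: (pot_lty_ae reg b_gt0 b_ltN).
(* u is infinite only on a null set; the value 1 there keeps v finite and positive everywhere. *)
pose v x := if u x < +oo then u x `^ th else 1.
have mv : measurable_fun setT v.
  apply: measurable_fun_ifT => //; first exact: measurable_fun_lte.
  exact: (measurableT_comp (measurable_poweR th) mu_).
have v0 x : 0 < v x by rewrite /v; case: ifP => // _; rewrite poweR_gt0.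
have vy x : v x < +oo.
  by rewrite /v; case: ifPn => [uy|_]; [exact: poweR_lty|exact: ltry].
have v00 x : 0 <= v x := ltW (v0 x).
have vu : {ae mu, forall x, v x = u x `^ th}.
  by apply: filterS uae => x uy; rewrite /v uy.
have uth0 x : 0 <= u x `^ th by exact: poweR_ge0.
have muth : measurable_fun setT (fun x => u x `^ th).
  exact: (measurableT_comp (measurable_poweR th) mu_).
have mQx a i x : measurable_fun setT (Q a i x).
  rewrite (_ : Q a i x = (fun p => Q a i p.1 p.2) \o (pair x))//.
  exact: (measurableT_comp (cell_meas dya a i)).
(* The cell of x lies in the ball of radius [sc i] about x, where [pot_pow_ball] applies. *)
have mass_le a i x : wmass mu (Q a i) v x <=
    (K1 * sc i `^ N)%:E * tpot (sc i) eh x `^ th.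
  have sc0 := scale_gt0 dya i.
  apply: le_trans (hK1 eh x (sc i) meh eh0 sc0 (Ap _ _ sc0) (finA _ _ sc0)).
  rewrite /wmass (_ : \int[mu]_y _ = \int[mu]_y (ind (Q a i x y) * u y `^ th)).
    apply: leI => y; first by rewrite mule_ge0 ?ind_ge0.
    apply: lee_wpmul2r => //; rewrite lee_fin ler_nat.
    by case: (boolP (Q a i x y)) => // /(cell_ball dya) ->.
  apply: ge0_ae_eq_integral => //.
  - by apply: emeasurable_funM => //; exact: measurable_ind.
  - by apply: emeasurable_funM => //; exact: measurable_ind.
  - by move=> y _; rewrite mule_ge0 ?ind_ge0.
  - by move=> y _; rewrite mule_ge0 ?ind_ge0.
  - by apply: filterS vu => y /= ->.
have mass_lty a i x : wmass mu (Q a i) v x < +oo.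
  apply: (le_lt_trans (mass_le a i x)); apply: lty_mulEFin.
    by rewrite mulr_ge0 ?powR_ge0// ltW.
  by apply: poweR_lty; apply: finA; exact: scale_gt0 dya _.
pose F x := (h x / fine (v x))%R.
have fv0 x : (0 < fine (v x))%R by rewrite fine_gt0// v0 vy.
have vE x : v x = (fine (v x))%:E by rewrite fineK// ge0_fin_numE.
have F0 x : (0 <= F x)%R by rewrite divr_ge0// ltW.
have mF : measurable_fun setT F.
  apply: measurable_funM => //.
  rewrite (_ : (fun _ => _) = (fun x => (fine (v x)) `^ (-1))%R); last first.
    by apply/funext => x; rewrite powR_inv1// ltW.
  apply: (@measurableT_comp _ _ _ _ _ _ (@powR R ^~ (-1))%R).
    exact: measurable_powR.
  exact: (measurableT_comp (@fine_measurable R setT measurableT)).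
have FvE x : (F x)%:E * v x = (h x)%:E.
  by rewrite vE -EFinM divfK// gt_eqF.
have [W [mW W0 hW intW]] := gridmax_bound mv v0 vy mass_lty mF F0.
pose W' x := fine (W x); have W'0 x : (0 <= W' x)%R by exact: fine_ge0.
(* The integral of h over a cell is the mean of h / v with respect to v dx, at most W^(1/s), times
   the v-mass of the cell, at most K2 r^N v(y). *)
pose H y := (K2 * fine (v y) * W' y `^ s^-1)%R.
have H0 y : (0 <= H y)%R by rewrite !mulr_ge0 ?powR_ge0// ltW.
have mfv : measurable_fun setT (fun y => fine (v y)).
  exact: (measurableT_comp (@fine_measurable R setT measurableT)).
have mH : measurable_fun setT H.
  apply: measurable_funM; first exact: measurable_funM.
  apply: (@measurableT_comp _ _ _ _ _ _ (@powR R ^~ s^-1)%R).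
    exact: measurable_powR.
  exact: (measurableT_comp (@fine_measurable R setT measurableT)).
have mpow (G : T -> R) : measurable_fun setT G ->
    measurable_fun setT (fun x => (G x `^ s)%:E).
  move=> mG; apply/measurable_EFinP.
  by apply: (@measurableT_comp _ _ _ _ _ _ (@powR R ^~ s)%R).
have mepow : measurable_fun setT (fun x => epow (u x) (q - s)).
  exact: (measurableT_comp (measurable_epow (q - s)) mu_).
have vfine x (a : R) : u x = a%:E -> fine (v x) = (a `^ th)%R.
  by move=> ua; rewrite /v ua ltry poweR_EFin.
have ufine x : u x < +oo -> exists2 a : R, (0 < a)%R & u x = a%:E.
  move=> uy; exists (fine (u x)); first by rewrite fine_gt0// up.
  by rewrite fineK// ge0_fin_numE// ltW.
(* With v = u^th both integrands are h^s u^(q - s), since th (1 - s) = q - s. *)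
have JE : \int[mu]_x ((F x `^ s)%:E * v x) =
    \int[mu]_x ((h x `^ s)%:E * epow (u x) (q - s)).
  apply: ge0_ae_eq_integral => //.
  - by apply: emeasurable_funM => //; exact: mpow.
  - by apply: emeasurable_funM => //; exact: mpow.
  - by move=> x _; rewrite mule_ge0 ?lee_fin ?powR_ge0.
  - by move=> x _; rewrite mule_ge0 ?lee_fin ?powR_ge0 ?epow_ge0.
  apply: filterS uae => x /ufine[a a0 ua] _ /=.
  rewrite vE /F (vfine x a ua) ua epow_EFin// -!EFinM; congr EFin.
  rewrite powRM ?invr_ge0 ?powR_ge0//.
  rewrite -(powR_inv1 (powR_ge0 a th)) -!powRrM -mulrA -powRD0//.
  congr (_ * _ `^ _)%R; rewrite /th; field.
  by rewrite gt_eqF.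
have intWv : \int[mu]_x (W x * v x) < +oo.
  apply: (le_lt_trans intW); rewrite JE; exact: lty_mulEFin.
have Wae : {ae mu, forall y, W y < +oo}.
  have : {ae mu, forall y, W y * v y < +oo}.
    apply: int_lty_ae => //; first exact: emeasurable_funM.
    by move=> x; exact: mule_ge0.
  apply: filterS => y; apply: contraTT; rewrite -!leNgt !leye_eq => /eqP->.
  by rewrite gt0_mulye.
exists H; split => //.
- apply: filterS2 uae Wae => y /ufine[a a0 ua] Wy r r0.
  have [ga [i [sci sub]]] := ball_cell dya y r0.
  have sc0 := scale_gt0 dya i.
  have Qfin : \int[mu]_z (ind (Q ga i y z) * ((F z)%:E * v z)) < +oo.
    apply: (int_lty (cell_meas dya ga i) mv v00 (mass_lty ga i) y s1 mF F0).
    by rewrite JE.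
  have Qf0 : 0 <= \int[mu]_z (ind (Q ga i y z) * ((F z)%:E * v z)).
    by apply: int_ge0 => z; rewrite !mule_ge0 ?ind_ge0 ?lee_fin.
  apply: (@le_trans _ _ (\int[mu]_z (ind (Q ga i y z) * ((F z)%:E * v z)))).
    apply: leI => z; first by rewrite mule_ge0 ?ind_ge0 ?lee_fin.
    rewrite FvE; apply: lee_wpmul2r; first by rewrite lee_fin.
    rewrite lee_fin ler_nat; case: (boolP (rho y z <= r)%R) => // /sub ->//.
  have mfin : (0 < fine (wmass mu (Q ga i) v y))%R.
    by rewrite fine_gt0// mass_lty andbT; exact: (cell_mass_gt0 mv v0).
  rewrite -(fineK (_ : \int[mu]_z _ \is a fin_num)); last by rewrite ge0_fin_numE.
  have -> : fine (\int[mu]_z (ind (Q ga i y z) * ((F z)%:E * v z))) =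
      (avg mu (Q ga i) v F y * fine (wmass mu (Q ga i) v y))%R.
    by rewrite /avg divfK// gt_eqF.
  rewrite lee_fin.
  have avg0 : (0 <= avg mu (Q ga i) v F y)%R.
    exact: (avg_ge0 v00 (cell_mass_gt0 mv v0 ga i) (mass_lty ga i) y F0).
  have hav : (avg mu (Q ga i) v F y <= W' y `^ s^-1)%R.
    have : (avg mu (Q ga i) v F y `^ s <= W' y)%R.
      by rewrite -lee_fin fineK ?hW// ge0_fin_numE.
    move/(powR_le (_ : 0 <= s^-1)%R (powR_ge0 _ _)).
    rewrite invr_ge0 (ltW s0) => /(_ isT).
    by rewrite -powRrM mulfV ?gt_eqF// powRr1.
  have hma : (fine (wmass mu (Q ga i) v y) <= K2 * r `^ N * fine (v y))%R.
    rewrite -lee_fin fineK; last first.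
      rewrite ge0_fin_numE ?mass_lty//.
      by apply: ltW; exact: (cell_mass_gt0 mv v0).
    apply: (le_trans (mass_le ga i y)).
    (* The A_1 step: the truncated potential, which bounds the mean of v over the cell, is at most
       the potential at y itself. *)
    apply: (@le_trans _ _ ((K1 * (k * r) `^ N)%:E * u y `^ th)).
      apply: lee_pmul.
      - by rewrite lee_fin mulr_ge0 ?powR_ge0// ltW.
      - exact: poweR_ge0.
      - rewrite lee_fin ler_wpM2l ?(ltW K10)// powR_le ?(ltW sc0)//.
        exact: ltW (dim_gt0 reg).
      - apply: gt0_ler_poweR; rewrite ?(ltW th0)// ?in_itv/= ?leey ?andbT ?tpot_ge0 ?(ltW (up y))//.
        exact: (tpot_le_pot reg b_gt0).
    rewrite ua poweR_EFin -EFinM lee_fin (vfine y a ua).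
    by rewrite powRM ?(ltW (const_gt0 dya)) ?(ltW r0)// /K2 !mulrA.
  apply: (le_trans (ler_pM avg0 (ltW mfin) hav hma)).
  by rewrite /H le_eqVlt; apply/orP; left; apply/eqP; ring.
- have -> : \int[mu]_x ((H x `^ s)%:E * epow (u x) (q - s)) =
      \int[mu]_x ((K2 `^ s)%:E * (W x * v x)).
    apply: ge0_ae_eq_integral => //.
    + by apply: emeasurable_funM => //; exact: mpow.
    + by apply: measurable_funeM; exact: emeasurable_funM.
    + by move=> x _; rewrite mule_ge0 ?lee_fin ?powR_ge0 ?epow_ge0.
    + by move=> x _; rewrite !mule_ge0 ?lee_fin ?powR_ge0.
    apply: filterS2 uae Wae => x /ufine[a a0 ua] Wx _ /=.
    have WE : W x = (W' x)%:E by rewrite /W' fineK// ge0_fin_numE.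
    rewrite WE vE /H (vfine x a ua) ua epow_EFin// -!EFinM; congr EFin.
    rewrite !powRM ?mulr_ge0 ?powR_ge0 ?(ltW K20) ?(ltW K10)//.
    rewrite -!powRrM mulVf ?gt_eqF// powRr1//.
    have -> : (a `^ th = a `^ (th * s) * a `^ (q - s))%R.
      by rewrite -powRD0//; congr (_ `^ _)%R; rewrite /th; field; rewrite gt_eqF.
    by ring.
  rewrite (intZ mu (powR_ge0 _ _)); first last.
  + by move=> x; exact: mule_ge0.
  + exact: emeasurable_funM.
  apply: (@le_trans _ _ ((K2 `^ s)%:E * (Kd%:E *
      \int[mu]_x ((h x `^ s)%:E * epow (u x) (q - s))))).
    by apply: lee_wpmul2l; rewrite ?lee_fin ?powR_ge0// -JE.
  rewrite muleA -EFinM; apply: lee_wpmul2r; last by rewrite lee_fin lerDl.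
  by apply: int_ge0 => x; rewrite mule_ge0 ?lee_fin ?powR_ge0 ?epow_ge0.
Qed.

End maximal_function.

(** * Capacities and the strong type inequality *)

Section test_functions.
Context d {T : measurableType d} {R : realType}.
Variable mu : {sigma_finite_measure set T -> \bar R}.
Variables (rho : T -> T -> R) (N c C b : R).
Hypothesis reg : regular_space mu rho N c C.
Hypotheses (b_gt0 : 0 < b) (b_ltN : b < N).
Local Open Scope ereal_scope.
Local Notation pot := (pot mu rho b).
Local Notation tpot := (tpot mu rho b).

Let rho0 := rho_ge0 reg.

(** A layer decomposition from below. Raising the truncation from 2^i r to 2^(i + 1) r lowers the
    kernel by exactly (1 - 2^(-b)) (2^i r)^(-b) when t <= 2^i r, and does not raise it otherwise. *)
Lemma tker_telescope (r t : R) n : (0 < r)%R -> (0 <= t)%R ->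
  (\sum_(i < n) (1 - 2 `^ (- b)) * (2 ^+ i * r) `^ (- b) * (t <= 2 ^+ i * r)%R%:R
     + Num.max (2 ^+ n * r) t `^ (- b) <= Num.max r t `^ (- b))%R.
Proof.
move=> r0 t0; elim: n => [|n IH]; first by rewrite big_ord0 add0r expr0 mul1r.
apply: le_trans IH; rewrite big_ord_recr/= -addrA lerD2l.
set z := (2 ^+ n * r)%R; have z0 : (0 < z)%R by rewrite mulr_gt0// exprn_gt0.
have -> : (2 ^+ n.+1 * r = 2 * z)%R by rewrite exprS mulrA.
have [tz|zt] := leP t z.
  have -> : Num.max (2 * z)%R t = (2 * z)%R.
    by apply/max_idPl; rewrite (le_trans tz)// ler_peMl ?ler1n// ltW.
  rewrite mulr1 (powRM _ _ (ltW z0))// mulrBl mul1r subrK.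
  exact: lexx.
rewrite mulr0 add0r powR_leN ?oppr_le0 ?(ltW b_gt0)//; first exact: lt_trans zt.
by rewrite le_max lexx orbT.
Qed.

(** The kernels truncated at r and 2r agree outside the ball of radius 2r, and inside it the larger
    one is at most r^(-b). *)
Lemma tpot_step (f : T -> \bar R) x (r : R) : measurable_fun setT f ->
  (forall x, 0 <= f x) -> (0 < r)%R ->
  tpot r f x <= tpot (2 * r) f x +
    (r `^ (- b))%:E * \int[mu]_y (ind (rho x y <= 2 * r)%R * f y).
Proof.
move=> mf f0 r0.
have mi : measurable_fun setT (fun y => ind (rho x y <= 2 * r)%R * f y).
  by apply: emeasurable_funM => //; apply: measurable_ind; exact: (measurable_ball reg).
have i0 y : 0 <= ind (rho x y <= 2 * r)%R * f y by rewrite mule_ge0 ?ind_ge0.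
rewrite -(intZ mu (powR_ge0 _ _) mi i0) -(intD mu); first last.
- by move=> y; rewrite mule_ge0 ?lee_fin ?powR_ge0.
- by move=> y; rewrite mule_ge0 ?lee_fin ?powR_ge0.
- exact: measurable_funeM.
- by apply: emeasurable_funM => //; exact: (measurable_tkerx b reg).
apply: leI => y; first by rewrite mule_ge0 ?lee_fin ?powR_ge0.
have [xy|xy] := leP (rho x y) (2 * r)%R.
  rewrite indT mul1e; apply: (@le_trans _ _ ((r `^ (- b))%:E * f y)).
    by apply: lee_wpmul2r => //; rewrite lee_fin; exact: tker_le_r.
  by rewrite leeDr// mule_ge0 ?lee_fin ?powR_ge0.
rewrite indF mul0e mule0 adde0; apply: lee_wpmul2r => //.
have rxy : (r <= rho x y)%R.
  by rewrite (le_trans _ (ltW xy))// ler_peMl ?ler1n// ltW.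
by have /max_idPr -> := rxy.
Qed.

Lemma ball_int_lty (f : T -> \bar R) x (r : R) : measurable_fun setT f ->
  (forall x, 0 <= f x) -> (0 < r)%R -> tpot r f x < +oo ->
  \int[mu]_y (ind (rho x y <= r)%R * f y) < +oo.
Proof.
move=> mf f0 r0 fin.
apply: (@le_lt_trans _ _ ((r `^ b)%:E * tpot r f x)); last first.
  by apply: lty_mulEFin => //; exact: powR_ge0.
rewrite -(intZ mu (powR_ge0 r b)); first last.
- by move=> y; rewrite mule_ge0 ?lee_fin ?powR_ge0.
- by apply: emeasurable_funM => //; exact: (measurable_tkerx b reg).
apply: leI => y; first by rewrite mule_ge0 ?ind_ge0.
rewrite muleA; apply: lee_wpmul2r => //; have [xy|_] := leP (rho x y) r; last first.
  by rewrite indF -EFinM lee_fin mulr_ge0 ?powR_ge0.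
by rewrite indT -EFinM lee_fin -powRD0// subrr powRr0.
Qed.

(* At least half of every ball consists of points where [pot f] is at most a
   constant times its mean. *)
Lemma half_ball : exists2 K : R, (0 < K)%R & forall (f : T -> \bar R) x r,
  measurable_fun setT f -> (forall x, 0 <= f x) -> (0 < r)%R ->
  0 < tpot r f x -> tpot r f x < +oo ->
  (c / 2 * r `^ N)%:E <=
    \int[mu]_y ind ((rho x y <= r)%R && (pot f y <= K%:E * tpot r f x)).
Proof.
have [K K0 hK] := pot_ball_int reg b_gt0 b_ltN.
have c0 := low_gt0 reg.
(* By Chebyshev's inequality the part of the ball where the potential exceeds K' times its mean has
   measure at most (c / 2) r^N, half of the lower bound for the ball. *)
pose K' := (2 * K / c)%R; have K'0 : (0 < K')%R by rewrite divr_gt0// mulr_gt0.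
exists K' => // f x r mf f0 r0 Ap Ay.
pose A := fine (tpot r f x).
have AE : tpot r f x = A%:E by rewrite /A fineK// ge0_fin_numE// ltW.
have A0 : (0 < A)%R by rewrite /A fine_gt0// Ap Ay.
have mp := measurable_pot b reg mf f0.
have mb : measurable_fun setT (fun y => rho x y <= r)%R by exact: (measurable_ball reg).
have mbs : measurable_fun setT (fun y => (rho x y <= r)%R && (pot f y <= K'%:E * tpot r f x)).
  by apply: measurable_and => //; exact: measurable_fun_lee.
pose X := \int[mu]_y ind ((rho x y <= r)%R && (pot f y <= K'%:E * tpot r f x)).
rewrite -/X.
have hball : (c * r `^ N)%:E <= X + (c / 2 * r `^ N)%:E.
  apply: (le_trans (ball_low reg x r0)); rewrite -int_indE//.
  apply: (@le_trans _ _ (\int[mu]_y (ind ((rho x y <= r)%R && (pot f y <= K'%:E * tpot r f x))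
     + ((K' * A)^-1)%:E * (ind (rho x y <= r)%R * pot f y)))).
    apply: leI => y; first exact: ind_ge0.
    have [xy|_] := leP (rho x y) r; last first.
      by rewrite /= indF mul0e mule0 adde0.
    rewrite /= indT mul1e; have [uy|uy] := leP (pot f y) (K'%:E * tpot r f x).
      rewrite indT leeDl// mule_ge0 ?pot_ge0//.
      by rewrite lee_fin invr_ge0 mulr_ge0// ltW.
    rewrite indF add0e -[leLHS](_ : ((K' * A)^-1)%:E * (K' * A)%:E = 1).
      apply: lee_wpmul2l; first by rewrite lee_fin invr_ge0 mulr_ge0// ltW.
      by rewrite EFinM -AE ltW.
    by rewrite -EFinM mulVf// gt_eqF// mulr_gt0.
  have mip : measurable_fun setT (fun y => ind (rho x y <= r)%R * pot f y).
    by apply: emeasurable_funM => //; exact: measurable_ind.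
  have ip0 y : 0 <= ind (rho x y <= r)%R * pot f y.
    by rewrite mule_ge0 ?ind_ge0 ?pot_ge0.
  have iK0 : (0 <= (K' * A)^-1)%R by rewrite invr_ge0 mulr_ge0// ltW.
  rewrite (intD mu); first last.
  - by move=> y; rewrite mule_ge0.
  - by move=> y; exact: ind_ge0.
  - exact: measurable_funeM.
  - exact: measurable_ind.
  rewrite (intZ mu iK0 mip ip0); apply: leeD => //.
  apply: (@le_trans _ _ (((K' * A)^-1)%:E * ((K * r `^ N)%:E * A%:E))).
    by apply: lee_wpmul2l => //; rewrite -AE; exact: hK.
  rewrite -!EFinM lee_fin le_eqVlt; apply/orP; left; apply/eqP.
  by rewrite /K'; field; rewrite !gt_eqF.
rewrite -(leeD2rE _ _ (_ : (c / 2 * r `^ N)%:E \is a fin_num))//.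
apply: le_trans hball; rewrite -EFinD lee_fin.
by rewrite le_eqVlt; apply/orP; left; apply/eqP; field.
Qed.

Definition level_fun (k c1 C1 : R) (u : T -> \bar R) (H : T -> R) (t : R) (y : T) : R :=
  (k / t * H y * (((c1 * t)%:E < u y)%E && (u y <= (C1 * t)%:E)%E)%:R)%R.

(** Start at the stopping radius r for the height t and double it until the truncated potential of h
    falls to t / 2. Over this range of scales the balls about x carry enough mass of h to account
    for t / 2, while u is comparable to t on half of each ball. There H dominates the mean of h, so
    the cut function recovers that mass scale by scale, and [tker_telescope] reassembles its
    potential. *)
Lemma level_test : exists k c1 C1 : R, [/\ (0 < k)%R, (0 < c1)%R, (0 < C1)%R &
  forall (h H : T -> R) (t : R) x,
  measurable_fun setT h -> (forall x, 0 <= h x)%R ->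
  measurable_fun setT H -> (forall x, 0 <= H x)%R ->
  (forall x r, (0 < r)%R -> tpot r (EFin \o h) x < +oo) ->
  {ae mu, forall y, forall r, (0 < r)%R ->
      \int[mu]_z (ind (rho y z <= r)%R * (h z)%:E) <= (r `^ N * H y)%:E} ->
  (0 < t)%R -> t%:E < pot (EFin \o h) x ->
  1 <= pot (EFin \o level_fun k c1 C1 (pot (EFin \o h)) H t) x].
Proof.
have [K K0 hK] := half_ball.
have c0 := low_gt0 reg.
pose e := (1 - 2 `^ (- b) : R)%R.
have e0 : (0 < e)%R by rewrite subr_gt0 powR2_lt1// oppr_lt0.
(* The value of k for which the lower bound at the end equals 1. *)
have [k k0 kE] : exists2 k : R, (0 < k)%R & k = (4 * 8 `^ N / (c * e))%R.
  eexists; last reflexivity.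
  apply: divr_gt0; last exact: mulr_gt0.
  by apply: mulr_gt0 => //; exact: powR_gt0.
(* The truncated potential exceeds t / 2 at the scales used, and [pot_low] loses 4^(-b). *)
have [c1 c10 c1E] : exists2 c1 : R, (0 < c1)%R & c1 = (4 `^ (- b) / 2)%R.
  by eexists; last reflexivity; rewrite divr_gt0// powR_gt0.
(* K comes from [half_ball]; the truncated potential at the stopping radius is at most 2^b t because
   it is at most t at twice that radius. *)
have [C1 C10 C1E] : exists2 C1 : R, (0 < C1)%R & C1 = (K * 2 `^ b)%R.
  by eexists; last reflexivity; rewrite mulr_gt0// powR_gt0.
exists k, c1, C1; split => // h H t x mh h0 mH H0 finA HM t0 tx.
pose eh := EFin \o h; have meh : measurable_fun setT eh by exact/measurable_EFinP.
have eh0 y : 0 <= eh y by rewrite lee_fin.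
set u := pot eh; have mu_ : measurable_fun setT u by exact: (measurable_pot b reg).
pose g := level_fun k c1 C1 u H t; rewrite -/eh -/u -/g.
have g0 y : (0 <= g y)%R by rewrite /g /level_fun !mulr_ge0// ?invr_ge0 ltW.
have mg : measurable_fun setT g.
  apply: measurable_funM; first by apply: measurable_funM => //; exact: measurable_cst.
  apply: (@measurableT_comp _ _ _ _ _ _ (fun b : bool => b%:R : R)) => //.
  by apply: measurable_and; [exact: measurable_fun_lte|exact: measurable_fun_lee].
have meg : measurable_fun setT (EFin \o g) by exact/measurable_EFinP.
have [r [r0 tr rt]] := tpot_stop reg b_gt0 meh eh0 t0 tx (finA x 1%R ltr01).
have r20 i : (0 < 2 ^+ i * r)%R by rewrite mulr_gt0// exprn_gt0.
have [B BE] : exists B : nat -> R, forall i, tpot (2 ^+ i * r) eh x = (B i)%:E.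
  exists (fun i => fine (tpot (2 ^+ i * r) eh x)) => i.
  rewrite fineK; first reflexivity.
  rewrite ge0_fin_numE; first exact: (finA x _ (r20 i)).
  exact: tpot_ge0.
have B0E : tpot r eh x = (B 0)%:E by rewrite -BE expr0 mul1r.
have B1E : tpot (2 * r) eh x = (B 1)%:E by rewrite -BE expr1.
have Bnd i j : (i <= j)%N -> (B j <= B i)%R.
  move=> ij; rewrite -lee_fin -!BE; apply: tpot_anti => //.
  by rewrite ler_pM2r// ler_weXn2l// ler1n.
have B0t : (t < B 0)%R by rewrite -lte_fin -B0E.
have B0T : (B 0 <= 2 `^ b * t)%R.
  have := tpot_scale reg b_gt0 x meh eh0 r0 (ler1n R 2).
  rewrite B0E B1E -EFinM lee_fin => /le_trans; apply.
  by rewrite ler_wpM2l ?powR_ge0// -lee_fin -B1E.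
have t20 : (0 < t / 2)%R by rewrite divr_gt0.
have [n0 hn0] := tpot_large reg b_gt0 meh eh0 r0 t20 (finA x r r0).
have hn0' : (B n0 <= t / 2)%R by rewrite -lee_fin -BE ltW.
have := ex_minnP (ex_intro (fun j => B j <= t / 2)%R n0 hn0').
case=> n Bn minn {n0 hn0 hn0'}.
have Bi i : (i < n)%N -> (t / 2 < B i)%R.
  by move=> iltn; rewrite ltNge; apply/negP => /minn; rewrite leqNgt iltn.
have [m mE] : exists m : nat -> R, forall i,
    \int[mu]_y (ind (rho x y <= 2 * (2 ^+ i * r))%R * eh y) = (m i)%:E.
  exists (fun i => fine (\int[mu]_y (ind (rho x y <= 2 * (2 ^+ i * r))%R * eh y))) => i.
  rewrite fineK; first reflexivity.
  rewrite ge0_fin_numE; last first.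
    by apply: int_ge0 => y; apply: mule_ge0 => //; exact: ind_ge0.
  have z0 : (0 < 2 * (2 ^+ i * r))%R by rewrite mulr_gt0.
  exact: (ball_int_lty meh eh0 z0 (finA x _ z0)).
have m0 i : (0 <= m i)%R.
  rewrite -lee_fin -mE; apply: int_ge0 => y; apply: mule_ge0 => //.
  exact: ind_ge0.
have Bstep i : (B i <= B i.+1 + (2 ^+ i * r) `^ (- b) * m i)%R.
  have := tpot_step x meh eh0 (r20 i); rewrite mE BE mulrA -exprS BE.
  by rewrite -EFinM -EFinD lee_fin.
(* [tpot_step] telescopes from a value above t at radius r to a value of at most t / 2 at radius 2^n
   r. *)
have Bsum : (t / 2 <= \sum_(i < n) (2 ^+ i * r) `^ (- b) * m i)%R.
  have h1 : (B 0 <= B n + \sum_(i < n) (2 ^+ i * r) `^ (- b) * m i)%R.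
    elim: (n) => [|j IH]; first by rewrite big_ord0 addr0.
    rewrite big_ord_recr/= addrCA; apply: (le_trans IH).
    by rewrite [leLHS]addrC lerD2l.
  by move: (le_lt_trans Bn (ltac:(lra) : t / 2 < t)%R); lra.
(* On the half of the ball given by [half_ball] the value of u lies between c1 t and C1 t, so g
   equals k H / t there, and H is at least m i / (8 z)^N. *)
have gball i : (i < n)%N ->
    (c / 2 * (k / t) * (8 `^ N)^-1 * m i)%:E <=
    \int[mu]_y (ind (rho x y <= 2 ^+ i * r)%R * (g y)%:E).
  move=> iltn; set z := (2 ^+ i * r)%R; have z0 : (0 < z)%R := r20 i.
  have zN0 : (0 < z `^ N)%R by rewrite powR_gt0.
  pose P y := (rho x y <= z)%R && (u y <= K%:E * tpot z eh x).
  have mP : measurable_fun setT P.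
    apply: measurable_and; first exact: (measurable_ball reg).
    exact: measurable_fun_lee.
  have A0 : 0 < tpot z eh x by rewrite BE lte_fin (lt_trans _ (Bi _ iltn)).
  have hz := hK eh x z meh eh0 z0 A0 (finA x z z0).
  pose w := (k / t * (m i / (8 * z) `^ N))%R.
  have w0 : (0 <= w)%R.
    by rewrite mulr_ge0 ?divr_ge0 ?powR_ge0// ltW.
  apply: (@le_trans _ _ (w%:E * \int[mu]_y ind (P y))).
    apply: (@le_trans _ _ (w%:E * (c / 2 * z `^ N)%:E)); last first.
      by apply: lee_wpmul2l; rewrite ?lee_fin.
    rewrite -EFinM lee_fin /w powRM ?(ltW z0)//.
    rewrite le_eqVlt; apply/orP; left; apply/eqP; field.
    by rewrite !gt_eqF ?powR_gt0.
  rewrite -(intZ mu w0 (measurable_ind mP) (fun=> ind_ge0 _)).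
  apply: ae_ge0_le_integral => //.
  - by move=> y _; rewrite mule_ge0 ?ind_ge0 ?lee_fin.
  - by apply: measurable_funeM; exact: measurable_ind.
  - by move=> y _; rewrite mule_ge0 ?ind_ge0 ?lee_fin.
  - apply: emeasurable_funM => //; apply: measurable_ind.
    exact: (measurable_ball reg).
  apply: filterS HM => y hy _; rewrite /P.
  have [xy|_] := leP (rho x y) z; last by rewrite /= indF mule0 mul0e.
  have [uy|_] := leP (u y) _; last by rewrite /= indF mule0 indT mul1e lee_fin.
  rewrite /= !indT mule1 mul1e lee_fin /g /level_fun.
  have -> : (c1 * t)%:E < u y.
    have h1 := pot_low reg b_gt0 meh eh0 z0 xy; rewrite BE in h1.
    have h2 : (4 `^ (- b) * B i)%:E <= u y.
      have : (4 `^ (- b))%:E * (B i)%:E <= (4 `^ (- b))%:E * ((4 `^ b)%:E * u y).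
        by apply: lee_wpmul2l => //; rewrite lee_fin powR_ge0.
      by rewrite muleA -!EFinM -powRD0// addrC subrr powRr0 mul1e.
    apply: lt_le_trans h2; rewrite lte_fin c1E -mulrA (mulrC _ t).
    by rewrite ltr_pM2l ?powR_gt0// Bi.
  have -> /= : u y <= (C1 * t)%:E.
    apply: (le_trans uy); rewrite BE -EFinM lee_fin C1E -mulrA ler_pM2l//.
    by rewrite (le_trans (Bnd 0 i _))%N.
  rewrite mulr1 ler_wpM2l ?divr_ge0 ?(ltW k0) ?(ltW t0)//.
  rewrite ler_pdivrMr ?powR_gt0 ?mulr_gt0// mulrC -lee_fin.
  (* The ball of radius 2z about x lies in the ball of radius 8z about y. *)
  apply: le_trans (hy (8 * z)%R _); last by rewrite mulr_gt0.
  rewrite -mE; apply: leI => v; first by rewrite mule_ge0 ?ind_ge0.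
  apply: lee_wpmul2r; first exact: eh0.
  rewrite lee_fin ler_nat; case: (leP (rho x v)) => // xv.
  have -> // : (rho y v <= 8 * z)%R.
  apply: (le_trans (rho_qtri reg y x v)).
  rewrite (_ : 8 * z = 4 * (2 * z))%R; last by ring.
  rewrite ler_pM2l// ge_max xv andbT (rho_sym reg).
  by rewrite (le_trans xy)// ler_peMl ?ler1n// ltW.
have hsum : (1 <= \sum_(i < n) e * (2 ^+ i * r) `^ (- b) *
    (c / 2 * (k / t) * (8 `^ N)^-1 * m i))%R.
  rewrite (eq_bigr (fun i : 'I_n => e * (c / 2 * (k / t) * (8 `^ N)^-1) *
    ((2 ^+ i * r) `^ (- b) * m i)))%R; last by move=> i _; ring.
  rewrite -mulr_sumr.
  apply: (@le_trans _ _ (e * (c / 2 * (k / t) * (8 `^ N)^-1) * (t / 2))%R).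
    rewrite kE le_eqVlt; apply/orP; left; apply/eqP; field.
    by rewrite !gt_eqF ?powR_gt0.
  apply: ler_wpM2l => //; rewrite !mulr_ge0 ?invr_ge0 ?powR_ge0 ?(ltW e0) ?(ltW c0) ?(ltW k0) ?(ltW t0)//.
apply: (@le_trans _ _ (\sum_(i < n) (e * (2 ^+ i * r) `^ (- b))%:E *
    \int[mu]_y (ind (rho x y <= 2 ^+ i * r)%R * (g y)%:E))).
  apply: (@le_trans _ _ (\sum_(i < n) (e * (2 ^+ i * r) `^ (- b) *
    (c / 2 * (k / t) * (8 `^ N)^-1 * m i))%:E)).
    by rewrite sumEFin lee_fin.
  apply: lee_sum => i _; rewrite EFinM; apply: lee_wpmul2l; last exact: gball.
  by rewrite lee_fin mulr_ge0 ?powR_ge0// ltW.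
have mig i : measurable_fun setT (fun y => ind (rho x y <= 2 ^+ i * r)%R * (g y)%:E).
  apply: emeasurable_funM => //; apply: measurable_ind.
  exact: (measurable_ball reg).
rewrite (eq_bigr (fun i : 'I_n => \int[mu]_y ((e * (2 ^+ i * r) `^ (- b))%:E *
    (ind (rho x y <= 2 ^+ i * r)%R * (g y)%:E)))); last first.
  move=> i _; rewrite (intZ mu _ (mig i))//.
    by rewrite mulr_ge0 ?powR_ge0// ltW.
  by move=> y; rewrite mule_ge0 ?ind_ge0 ?lee_fin.
rewrite -ge0_integral_sum//; last 2 first.
- by move=> i; exact: measurable_funeM.
- move=> i y _; rewrite !mule_ge0 ?ind_ge0 ?lee_fin//.
  by rewrite mulr_ge0 ?powR_ge0// ltW.
apply: leI => y.
  apply: sume_ge0 => i _; rewrite !mule_ge0 ?ind_ge0 ?lee_fin//.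
  by rewrite mulr_ge0 ?powR_ge0// ltW.
rewrite (eq_bigr (fun i : 'I_n => (e * (2 ^+ i * r) `^ (- b) *
   (rho x y <= 2 ^+ i * r)%R%:R * g y)%:E)); last first.
  by move=> i _; rewrite /ind -!EFinM !mulrA.
rewrite sumEFin -mulr_suml EFinM; apply: lee_wpmul2r; first by rewrite lee_fin.
refine (le_trans _ (tker_le reg b_gt0 x y r0)).
rewrite lee_fin; apply: le_trans (tker_telescope n r0 (rho0 x y)).
by rewrite lerDl powR_ge0.
Qed.

End test_functions.

(** * Capacities and Choquet integrals *)

Section capacity.
Context d {T : measurableType d} {R : realType}.
Variable mu : {sigma_finite_measure set T -> \bar R}.
Variables (rho : T -> T -> R) (b s : R).
Local Open Scope ereal_scope.
Local Notation pot := (pot mu rho b).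
Implicit Types (E : set T) (g : T -> \bar R).

Definition cap_test E : set (T -> R) :=
  [set f : T -> R | [/\ measurable_fun setT f, (forall x, 0 <= f x)%R &
               forall x, E x -> 1 <= pot (EFin \o f) x]].

Definition cap E : \bar R :=
  ereal_inf [set \int[mu]_y (f y `^ s)%:E | f in cap_test E].

Definition capint g : \bar R :=
  \int[lebesgue_measure]_(t in `]0%R, +oo[) cap [set x | t%:E < g x].

Lemma cap_ge0 E : 0 <= cap E.
Proof.
apply: le_ereal_inf_tmp => _ [f _ <-].
by apply: int_ge0 => y; rewrite lee_fin powR_ge0.
Qed.

Lemma cap_le E (f : T -> R) : cap_test E f -> cap E <= \int[mu]_y (f y `^ s)%:E.
Proof. by move=> h; apply: ereal_inf_lbound; exists f. Qed.

Lemma cap_sub E E' : E `<=` E' -> cap E <= cap E'.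
Proof.
move=> EE'; apply/ereal_inf_le_tmp => _ [f [mf f0 fE] <-].
by exists f => //; split => // x /EE'; exact: fE.
Qed.

Lemma cap0 : s != 0%R -> cap set0 = 0.
Proof.
move=> s0; apply/eqP; rewrite eq_le cap_ge0 andbT.
apply: le_trans (cap_le (f := fun=> 0%R) _) _; first by split.
by rewrite integral0_eq// => y _; rewrite powR0.
Qed.

Lemma capintE g : capint g =
  \int[lebesgue_measure]_t (ind (0 < t)%R * cap [set x | t%:E < g x]).
Proof.
rewrite (@int_ind _ _ R lebesgue_measure (fun t : R => 0 < t)%R) /capint; congr (integral _ _ _).
by apply/seteqP; split => t /=; rewrite in_itv/= andbT.
Qed.

Lemma int_ind_itv (a c : R) : (a <= c)%R ->
  \int[@lebesgue_measure R]_t ind ((a < t) && (t < c))%R = (c - a)%:E.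
Proof.
move=> ac; rewrite (@int_indE _ _ R lebesgue_measure); last first.
  by apply: measurable_and; exact: measurable_fun_ltr.
rewrite (_ : [set x | _] = `]a, c[%classic :> set R); last first.
  by apply/seteqP; split => t /=; rewrite in_itv.
apply: etrans (lebesgue_measure_itv `]a, c[) _.
rewrite /= lte_fin; case: ltP => // ca.
by rewrite (le_anti (_ : a <= c <= a)%R) ?subrr// ac ca.
Qed.

(** Chebyshev's inequality for the Choquet integral: for every level z in ]0, t[ the set where g > z
    contains the one where g >= t. *)
Lemma cap_le_capint g (t : R) : (0 < t)%R ->
  t%:E * cap [set x | t%:E <= g x] <= capint g.
Proof.
move=> t0; set k := cap _; have k0 : 0 <= k by exact: cap_ge0.
have mi : measurable_fun setT (fun z : R => ind ((0 < z) && (z < t))%R : \bar R).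
  by apply: measurable_ind; apply: measurable_and; exact: measurable_fun_ltr.
have : \int[@lebesgue_measure R]_z (ind ((0 < z) && (z < t))%R * k) = t%:E * k.
  rewrite ge0_integralZr//; first by rewrite int_ind_itv ?ltW// subr0.
  by move=> *; exact: ind_ge0.
move=> <-; rewrite capintE; apply: leI => z; first by rewrite mule_ge0 ?ind_ge0.
have [z0|_] := ltP 0%R z; last by rewrite !indF !mul0e.
have [zt|_] := ltP z t; last by rewrite indF mul0e mule_ge0 ?ind_ge0 ?cap_ge0.
rewrite !indT !mul1e; apply: cap_sub => x /=.
by apply: lt_le_trans; rewrite lte_fin.
Qed.

End capacity.

(** * The capacitary strong type inequality *)

Section strong_type.
Context d {T : measurableType d} {R : realType}.
Variable mu : {sigma_finite_measure set T -> \bar R}.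
Variables (rho : T -> T -> R) (N c C b : R).
Hypothesis reg : regular_space mu rho N c C.
Hypotheses (b_gt0 : 0 < b) (b_ltN : b < N).
Variables (I : finType) (Q : I -> int -> T -> T -> bool) (sc : int -> R) (kd : R).
Hypothesis dya : dyadic_system mu rho Q sc kd.
Variables (q s : R).
Hypotheses (q_ge1 : 1 <= q) (q_lts : q < s).
Local Open Scope ereal_scope.
Local Notation pot := (pot mu rho b).
Local Notation tpot := (tpot mu rho b).

Let q0 : (0 < q)%R := lt_le_trans ltr01 q_ge1.
Let s0 : (0 < s)%R := lt_trans q0 q_lts.
Let qs0 : (q - s < 0)%R. Proof. by rewrite subr_lt0. Qed.
Let qn0 : q != 0%R. Proof. by rewrite gt_eqF. Qed.

(** Tonelli's theorem. For fixed y and v = u(y), only levels with t^(1/q) between v / C1 and v / c1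
    contribute: their length is at most (v / c1)^q and t^(-s/q) is at most (v / C1)^(-s). The
    product is a multiple of v^(q - s). *)
Lemma level_int (k c1 C1 : R) (u : T -> \bar R) (H : T -> R) :
  (0 < k)%R -> (0 < c1)%R -> (0 < C1)%R ->
  measurable_fun setT u -> (forall x, 0 <= u x) ->
  measurable_fun setT H -> (forall x, 0 <= H x)%R ->
  \int[lebesgue_measure]_t (ind (0 < t)%R *
     \int[mu]_y (level_fun k c1 C1 u H (t `^ q^-1) y `^ s)%:E) <=
  (k `^ s * C1 `^ s * c1 `^ (- q))%:E *
     \int[mu]_y ((H y `^ s)%:E * epow (u y) (q - s)).
Proof.
move=> k0 c10 C10 mu_ u0 mH H0.
pose P (t : R) y := [&& (0 < t)%R, (c1 * t `^ q^-1)%:E < u y & u y <= (C1 * t `^ q^-1)%:E].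
pose F (t : measurableTypeR R) y := ind (P t y) * ((t `^ (- (s / q)))%:E * (k `^ s * H y `^ s)%:E).
have F0 t y : 0 <= F t y.
  by rewrite /F mule_ge0 ?ind_ge0// -EFinM lee_fin !mulr_ge0 ?powR_ge0.
have mfst (r : R) : measurable_fun setT (fun p : measurableTypeR R * T => (p.1 : R) `^ r)%R.
  exact: (measurableT_comp (measurable_powR r) measurable_fst).
have mpw (r : R) : measurable_fun setT (fun p : measurableTypeR R * T => (r * (p.1 : R) `^ q^-1)%:E).
  by apply/measurable_EFinP; apply: measurable_funM.
have mu2 : measurable_fun setT (fun p : measurableTypeR R * T => u p.2).
  exact: (measurableT_comp mu_ measurable_snd).
have mF : measurable_fun setT (fun p : measurableTypeR R * T => F p.1 p.2).
  apply: emeasurable_funM.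
    apply: measurable_ind; apply: measurable_and.
      by apply: measurable_fun_ltr => //; exact: measurable_fst.
    by apply: measurable_and; [exact: measurable_fun_lte|exact: measurable_fun_lee].
  apply: emeasurable_funM; first exact/measurable_EFinP.
  apply/measurable_EFinP; apply: measurable_funM => //.
  exact: (measurableT_comp (measurable_powR s) (measurableT_comp mH measurable_snd)).
apply: (@le_trans _ _ (\int[lebesgue_measure]_t \int[mu]_y F t y)).
  apply: leI => t.
    by rewrite mule_ge0 ?ind_ge0// int_ge0// => y; rewrite lee_fin powR_ge0.
  have [t0|_] := ltP 0%R t; last by rewrite indF mul0e int_ge0.
  rewrite indT mul1e; apply: leI => y; first by rewrite lee_fin powR_ge0.
  have tq0 : (0 < t `^ q^-1)%R by rewrite powR_gt0.
  rewrite /F /P t0/= /level_fun; case: (_ && _); last first.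
    by rewrite indF mul0e mulr0 powR0 ?gt_eqF.
  rewrite indT mul1e mulr1 -EFinM lee_fin le_eqVlt; apply/orP; left; apply/eqP.
  rewrite powRM ?(H0 y) ?divr_ge0 ?(ltW k0) ?(ltW tq0)//.
  rewrite powRM ?(ltW k0) ?invr_ge0 ?(ltW tq0)//.
  rewrite -powR_inv1 ?(ltW tq0)// -!powRrM.
  by rewrite (_ : q^-1 * (-1 * s) = - (s / q))%R; [ring|ring].
rewrite (tonelli mF F0 lebesgue_measure mu) -intZ; first last.
- by move=> y; rewrite mule_ge0 ?epow_ge0 ?lee_fin ?powR_ge0.
- apply: emeasurable_funM; last exact: (measurableT_comp (measurable_epow _) mu_).
  by apply/measurable_EFinP; exact: (measurableT_comp (measurable_powR s) mH).
- by rewrite !mulr_ge0 ?powR_ge0.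
apply: leI => y; first exact: int_ge0.
have rhs0 : 0 <= (k `^ s * C1 `^ s * c1 `^ (- q))%:E * ((H y `^ s)%:E * epow (u y) (q - s)).
  by rewrite !mule_ge0 ?epow_ge0 ?lee_fin ?mulr_ge0 ?powR_ge0.
have F00 : (forall t, P t y = false) -> \int[lebesgue_measure]_x F x y <=
    (k `^ s * C1 `^ s * c1 `^ (- q))%:E * ((H y `^ s)%:E * epow (u y) (q - s)).
  by move=> P0; rewrite integral0_eq// => t _; rewrite /F P0 indF mul0e.
(* Where u is 0 or +oo no positive level is comparable to u, and the left-hand side vanishes. *)
have := u0 y; case uy : (u y) rhs0 F00 => [v| |] rhs0 F00 // v0; last first.
  by apply: F00 => t; rewrite /P uy/= !andbF.
rewrite lee_fin le_eqVlt in v0; case/orP: v0 => [/eqP v0|v0].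
  apply: F00 => t; rewrite /P uy -v0 lte_fin [(_ * _ < 0)%R]ltNge.
  by rewrite (mulr_ge0 (ltW c10) (powR_ge0 _ _)) andbF.
pose X := ((v / c1) `^ q)%R; pose M := ((v / C1) `^ (- s) * (k `^ s * H y `^ s))%R.
have vc1 : (0 < v / c1)%R by rewrite divr_gt0.
have vC1 : (0 < v / C1)%R by rewrite divr_gt0.
apply: (@le_trans _ _ (\int[@lebesgue_measure R]_t (M%:E * ind ((0 < t) && (t < X))%R))).
  apply: leI => t; first exact: F0.
  rewrite /F /P uy; have [t0|_] := ltP 0%R t; last first.
    by rewrite /= !indF mul0e mule0.
  have tq0 : (0 < t `^ q^-1)%R by rewrite powR_gt0.
  have ME : 0 <= M%:E by rewrite lee_fin !mulr_ge0 ?powR_ge0.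
  rewrite lte_fin (lee_fin v)/=; have [h1|_] := ltP (c1 * t `^ q^-1)%R v; last first.
    by rewrite indF mul0e mule_ge0 ?ind_ge0.
  have [h2|_] := leP v (C1 * t `^ q^-1)%R; last first.
    by rewrite indF mul0e mule_ge0 ?ind_ge0.
  have tX : (t < X)%R.
    rewrite /X -{1}(powRr1 (ltW t0)) -(mulVf qn0).
    rewrite powRrM gt0_ltr_powR ?nnegrE ?powR_ge0 ?(ltW vc1)//.
    by rewrite ltr_pdivlMr// mulrC.
  rewrite tX indT mul1e mule1 -EFinM lee_fin /M ler_wpM2r ?mulr_ge0 ?powR_ge0//.
  have -> : (- (s / q) = q^-1 * - s)%R by ring.
  rewrite powRrM powR_leN ?oppr_le0 ?(ltW s0)//.
  by rewrite ler_pdivrMr// mulrC.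
rewrite intZ; first last.
- by move=> t; exact: ind_ge0.
- by apply: measurable_ind; apply: measurable_and; exact: measurable_fun_ltr.
- by rewrite !mulr_ge0 ?powR_ge0.
rewrite int_ind_itv ?powR_ge0// subr0 epow_EFin// -!EFinM lee_fin.
rewrite le_eqVlt; apply/orP; left; apply/eqP; rewrite /M /X.
rewrite (powRM _ (ltW v0)) ?invr_ge0 ?(ltW C10)// (powRM _ (ltW v0)) ?invr_ge0 ?(ltW c10)//.
rewrite -!powR_inv1 ?(ltW C10) ?(ltW c10)// -!powRrM.
rewrite (_ : -1 * - s = s)%R; last by ring.
rewrite (_ : -1 * q = - q)%R; last by ring.
by rewrite (powRD0 _ _ v0); ring.
Qed.

(* [muckenhoupt] replaces [h] by a maximal function [H],
   and [H] cut to the level [u ~ t^(1/q)] is a test function for [u^q > t]. *)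
Lemma strong_type : exists2 K : R, (0 < K)%R & forall h : T -> R,
  measurable_fun setT h -> (forall x, 0 <= h x)%R ->
  (forall x r, (0 < r)%R -> tpot r (EFin \o h) x < +oo) ->
  capint mu rho b s (fun x => pot (EFin \o h) x `^ q) <=
    K%:E * \int[mu]_x ((h x `^ s)%:E * epow (pot (EFin \o h) x) (q - s)).
Proof.
have [K K0 hK] := muckenhoupt reg b_gt0 b_ltN dya q_ge1 q_lts.
have [k [c1 [C1 [k0 c10 C10 hl]]]] := level_test reg b_gt0 b_ltN.
pose D := (k `^ s * C1 `^ s * c1 `^ (- q))%R.
have D0 : (0 < D)%R by rewrite !mulr_gt0 ?powR_gt0.
exists (D * K)%R; first exact: mulr_gt0.
move=> h mh h0 fin; set J := \int[mu]_x _.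
have meh : measurable_fun setT (EFin \o h) by exact/measurable_EFinP.
have eh0 x : 0 <= (EFin \o h) x by rewrite lee_fin.
have J0 : 0 <= J by apply: int_ge0 => y; rewrite mule_ge0 ?epow_ge0 ?lee_fin ?powR_ge0.
have [Joo|Jy] := eqVneq J +oo.
  by rewrite Joo gt0_muley ?leey// lte_fin mulr_gt0.
have {}Jy : J < +oo by rewrite ltey.
(* [muckenhoupt] asks for a nonzero h. If h is 0 almost everywhere its potential vanishes at every
   point and the level sets are empty. *)
have [h00|hn0] := eqVneq (\int[mu]_x (h x)%:E) 0.
  rewrite (_ : capint _ _ _ _ _ = 0); first by rewrite mule_ge0// lee_fin ltW// mulr_gt0.
  apply: integral0_eq => t /=; rewrite in_itv/= andbT => t0.
  rewrite (_ : [set x | _] = set0) ?cap0 ?gt_eqF//.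
  apply/seteqP; split => x //=; rewrite (_ : pot _ x = 0); last first.
    have : {ae mu, forall x, (h x)%:E = 0} by apply: int0_ae.
    move=> ae0; rewrite (eq_pot b reg x meh (measurable_cst (0 : \bar R)) eh0 (fun=> lexx 0) ae0).
    by apply: integral0_eq => y _; rewrite mule0.
  by rewrite poweR_EFin powR0 ?gt_eqF// lte_fin ltNge ltW.
have hp : 0 < \int[mu]_x (h x)%:E by rewrite lt_neqAle eq_sym hn0 int_ge0.
have [H [mH H0 HM HJ]] := hK h mh h0 hp fin Jy.
apply: (@le_trans _ _ (D%:E * \int[mu]_x ((H x `^ s)%:E * epow (pot (EFin \o h) x) (q - s)))); last first.
  have D0' : 0 <= D%:E by rewrite lee_fin (ltW D0).
  rewrite (EFinM D K) -[leRHS]muleA; apply: (lee_wpmul2l D0'); exact: HJ.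
have mp := measurable_pot b reg meh eh0.
have p0 x : 0 <= pot (EFin \o h) x by exact: pot_ge0.
apply: le_trans (level_int k0 c10 C10 mp p0 mH H0).
rewrite capintE; apply: leI => t; first by rewrite mule_ge0 ?ind_ge0 ?cap_ge0.
have [t0|_] := ltP 0%R t; last by rewrite indF !mul0e.
have tq0 : (0 < t `^ q^-1)%R by rewrite powR_gt0.
rewrite indT !mul1e; apply: cap_le; split.
- apply: measurable_funM; first by apply: measurable_funM => //; exact: measurable_cst.
  apply: (@measurableT_comp _ _ _ _ _ _ (fun b : bool => b%:R : R)) => //.
  by apply: measurable_and; [exact: measurable_fun_lte|exact: measurable_fun_lee].
- move=> x; rewrite /level_fun !mulr_ge0 ?invr_ge0//; first exact: ltW.
  exact: ltW.
- move=> x /= tx; apply: hl => //.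
  move: tx (p0 x); case: (pot _ x) => [v| |]//; last by move=> _ _; exact: ltry.
  rewrite poweR_EFin !lte_fin lee_fin => tv v0.
  rewrite -[ltRHS](powRr1 v0) -(mulfV qn0) powRrM.
  by rewrite gt0_ltr_powR ?invr_gt0// nnegrE ?powR_ge0// ltW.
Qed.

End strong_type.

(** * From weights to potentials *)

Section monotone.
Context d {T : measurableType d} {R : realType}.
Local Open Scope ereal_scope.

(** Monotone convergence in the form suited to truncations, which reach the integrand after finitely
    many steps at each point. *)
Lemma int_le_mono (mu : {measure set T -> \bar R}) (f : T -> \bar R)
    (F : nat -> T -> \bar R) (c : \bar R) :
  (forall m, measurable_fun setT (F m)) -> (forall m x, 0 <= F m x) ->
  (forall x i j, (i <= j)%N -> F i x <= F j x) -> (forall x, 0 <= f x) ->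
  (forall x, exists m, f x <= F m x) -> (forall m, \int[mu]_x F m x <= c) ->
  \int[mu]_x f x <= c.
Proof.
move=> mF F0 Fmono f0 fF Fc.
have nd x : nondecreasing_seq (F^~ x) by move=> i j; exact: Fmono.
apply: (@le_trans _ _ (\int[mu]_x limn (F^~ x))).
  apply: leI => // x; have [m fm] := fF x.
  apply: (le_trans fm); apply: (lime_ge (ereal_nondecreasing_is_cvgn (nd x))).
  by exists m => // i /= mi; exact: Fmono.
rewrite monotone_convergence//.
apply: lime_le; last by near=> m; exact: Fc.
apply: ereal_nondecreasing_is_cvgn => i j ij.
by apply: leI => // x; exact: Fmono.
Unshelve. all: by end_near. Qed.

(** Transfers an estimate valid for every test function to the capacity, which is the infimum. *)
Lemma le_affine_inf (S : set \bar R) (m e D : R) : (0 < D)%R ->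
  (forall X, S X -> 0 <= X) -> (forall X, S X -> m%:E <= e%:E + D%:E * X) ->
  m%:E <= e%:E + D%:E * ereal_inf S.
Proof.
move=> D0 S0 h.
have : (((m - e) / D)%:E <= ereal_inf S).
  apply: le_ereal_inf_tmp => X SX; move: (S0 _ SX) (h _ SX).
  case: X {SX} => [x| |] //; last by move=> _ _; exact: leey.
  by rewrite lee_fin -EFinM -EFinD !lee_fin => _ hx; rewrite ler_pdivrMr//; lra.
case: (ereal_inf S) => [x| |]//; last by move=> _; rewrite gt0_muley ?lte_fin// addey// leey.
by rewrite -EFinM -EFinD !lee_fin ler_pdivrMr// => hx; lra.
Qed.

End monotone.

Section levels.
Context {R : realType}.

(** An enumeration of the integers: sums over all dyadic levels 2^j become series over [nat]. *)
Definition zenum (i : nat) : int := if odd i then Negz i./2 else Posz i./2.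

Definition lev (i : nat) : R := 2 ^ zenum i.

Lemma zenum_surj (j : int) : exists i, zenum i = j.
Proof.
case: j => m.
  by exists m.*2; rewrite /zenum odd_double doubleK.
by exists m.*2.+1; rewrite /zenum /= odd_double/= uphalf_double.
Qed.

Lemma zenum_inj : injective zenum.
Proof.
move=> i j; rewrite /zenum => h.
rewrite -(odd_double_half i) -(odd_double_half j).
by move: h; case: (odd i); case: (odd j) => // -[->].
Qed.

Lemma lev_gt0 i : 0 < lev i.
Proof. by rewrite exprz_gt0. Qed.

Lemma lev_disj i j t : i != j -> lev i / 2 < t <= lev i -> lev j / 2 < t <= lev j -> False.
Proof.
wlog ij : i j / zenum i < zenum j.
  move=> h ij hi hj; case: (ltgtP (zenum i) (zenum j)) => [l|l|/zenum_inj e].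
  - exact: (h i j).
  - by apply: (h j i) => //; rewrite eq_sym.
  - by move: ij; rewrite e eqxx.
move=> _ /andP[_ ti] /andP[tj _].
suff ij2 : lev i <= lev j / 2 by have := le_lt_trans (le_trans ti ij2) tj; rewrite ltxx.
rewrite /lev ler_pdivlMr// -{2}(expr1z (2 : R)) -expfzDr ?pnatr_eq0//.
by rewrite ler_weXz2l ?ler1n// lezD1.
Qed.

Lemma lev_cover v : 0 < v -> exists i, lev i < v <= 2 * lev i.
Proof.
move=> v0; have [i0 hi0] : exists i, (2^-1 ^+ i <= v / 2 :> R)%R.
  by apply: ex_dyadic_le; rewrite divr_gt0.
have [n0 hn0] := ex_dyadic_ge v.
have hk : v <= 2 ^ ((n0 + i0)%N%:Z - i0%:Z).
  by rewrite PoszD addrK.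
have := ex_minnP (ex_intro (fun k : nat => v <= 2 ^ (k%:Z - i0%:Z)) _ hk).
case=> -[|k] vk mink.
  move: vk; rewrite sub0r -exprz_inv => vk.
  by have := le_lt_trans (le_trans vk hi0) (ltac:(lra) : v / 2 < v); rewrite ltxx.
have [i iE] := zenum_surj (k%:Z - i0%:Z); exists i; rewrite /lev iE; apply/andP; split.
  by rewrite ltNge; apply/negP => /mink; rewrite ltnn.
apply: (le_trans vk); rewrite -{2}(expr1z (2 : R)) -expfzDr ?pnatr_eq0//.
by rewrite ler_weXz2l ?ler1n//; lia.
Qed.

End levels.

Lemma le_poweR {R : realType} (x y : \bar R) (r : R) : 0 <= r ->
  (0 <= x -> x <= y -> x `^ r <= y `^ r)%E.
Proof.
move=> r0 x0 xy; apply: gt0_ler_poweR => //.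
- by rewrite in_itv/= x0 leey.
- by rewrite in_itv/= (le_trans x0 xy) leey.
Qed.

(** * Capacity against measure, and potentials that dominate a weight *)

Section weights.
Context d {T : measurableType d} {R : realType}.
Variable mu : {sigma_finite_measure set T -> \bar R}.
Variables (rho : T -> T -> R) (N c C b : R).
Hypothesis reg : regular_space mu rho N c C.
Hypotheses (b_gt0 : 0 < b) (b_ltN : b < N).
Variables (q s : R).
Hypotheses (q_ge1 : 1 <= q) (q_lts : q < s).
Hypothesis s_small : N < b * (s / (s - 1)).
Local Open Scope ereal_scope.
Local Notation pot := (pot mu rho b).
Local Notation tpot := (tpot mu rho b).
Local Notation cap := (cap mu rho b s).
Local Notation capint := (capint mu rho b s).

Let q0 : (0 < q)%R := lt_le_trans ltr01 q_ge1.
Let s0 : (0 < s)%R := lt_trans q0 q_lts.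
Let s1 : (1 < s)%R := le_lt_trans q_ge1 q_lts.
Let qs0 : (q - s < 0)%R. Proof. by rewrite subr_lt0. Qed.

(** A test function f of E has potential at least 1 on E, so the measure is at most the integral of
    [pot f] over the ball; [pot_ball_int] and [tpot_Lp] bound this. The term e can be made small,
    which gives [cap_null]. *)
Lemma measure_le_cap x (r e : R) : (0 < r)%R -> (0 < e)%R ->
  exists2 D : R, (0 < D)%R & forall E, measurable E ->
    mu (E `&` [set y | rho x y <= r]%R) <= e%:E + D%:E * cap E.
Proof.
move=> r0 e0; have [K K0 hK] := pot_ball_int reg b_gt0 b_ltN.
have [k k0 kE] : exists2 k : R, (0 < k)%R & k = (K * r `^ N)%R.
  by eexists; last reflexivity; rewrite mulr_gt0// powR_gt0.
have ek0 : (0 < e / k)%R by rewrite divr_gt0.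
have [D D0 hD] := tpot_Lp reg b_gt0 x s1 s_small r0 ek0.
exists (k * D)%R; first exact: mulr_gt0.
move=> E mE; set B := [set y | _].
have mB : measurable B by exact: (measurable_ballset reg).
have fin : mu (E `&` B) < +oo.
  apply: (@le_lt_trans _ _ (mu B)).
    by apply: le_measure; rewrite ?inE//; exact: measurableI.
  by apply: le_lt_trans (ball_upp reg x r0) _; rewrite ltry.
have [m mE'] : exists m, mu (E `&` B) = m%:E.
  by exists (fine (mu (E `&` B))); rewrite fineK// ge0_fin_numE.
rewrite mE'; apply: le_affine_inf; first exact: mulr_gt0.
  by move=> _ [f _ <-]; apply: int_ge0 => y; rewrite lee_fin powR_ge0.
move=> _ [f [mf f0 fE] <-]; rewrite -mE'.
have mef : measurable_fun setT (EFin \o f) by exact/measurable_EFinP.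
have ef0 y : 0 <= (EFin \o f) y by rewrite lee_fin.
have mEB : measurable (E `&` B) by exact: measurableI.
apply: (@le_trans _ _ (\int[mu]_y (ind (rho x y <= r)%R * pot (EFin \o f) y))).
  rewrite -[leLHS]mul1e -integral_cst// int_ind.
  apply: (@le_trans _ _ (\int[mu]_(y in E `&` B) pot (EFin \o f) y)).
    by apply: le_int => y [Ey _]; [exact: lee01|exact: fE].
  apply: ge0_subset_integral => //.
    by apply: measurable_funTS; exact: (measurable_pot b reg).
  by move=> y _; exact: pot_ge0.
apply: le_trans (hK _ x r mef ef0 r0) _; rewrite -kE.
have k0' : 0 <= k%:E by rewrite lee_fin ltW.
apply: le_trans (lee_wpmul2l k0' (hD f mf f0)) _.
rewrite ge0_muleDr; first last.
- rewrite mule_ge0 ?lee_fin ?(ltW D0)//; apply: int_ge0 => y.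
  by rewrite lee_fin powR_ge0.
- by rewrite lee_fin ltW.
rewrite muleA -!EFinM (_ : k * (e / k) = e)%R//.
by rewrite mulrCA mulfV ?mulr1// gt_eqF.
Qed.

(** Lets e tend to 0 in [measure_le_cap] on balls that exhaust the space. This turns properties
    valid quasi-everywhere into properties valid almost everywhere. *)
Lemma cap_null E : measurable E -> cap E = 0 -> mu E = 0.
Proof.
move=> mE E0.
have hB x r : (0 < r)%R -> mu (E `&` [set y | rho x y <= r]%R) = 0.
  move=> r0; apply/eqP; rewrite eq_le measure_ge0 andbT.
  apply/lee_addgt0Pr => e e0; rewrite add0e.
  by have [D _ /(_ E mE)] := measure_le_cap x r0 e0; rewrite E0 mule0 adde0.
have x0 : T := point.
apply/eqP; rewrite eq_le measure_ge0 andbT.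
rewrite (_ : E = \bigcup_i (E `&` [set y | rho x0 y <= i.+1%:R]%R)); last first.
  apply/seteqP; split => [y Ey|y [i _ []]]//.
  have [i] := ex_dyadic_ge (rho x0 y); exists (2 ^ i)%N => //; split => //=.
  by rewrite (le_trans p)// -natrX ler_nat.
have mEi i : measurable (E `&` [set y | rho x0 y <= i.+1%:R]%R).
  by apply: measurableI => //; exact: (measurable_ballset reg).
rewrite le_eqVlt; apply/orP; left; apply/eqP; apply: measure_negligible.
  exact: bigcup_measurable.
by apply: negligible_bigcup => i; apply/negligibleP => //; exact: hB.
Qed.

Lemma cap_ball_gt0 x (r : R) : (0 < r)%R -> 0 < cap [set y | rho x y <= r]%R.
Proof.
move=> r0; rewrite lt_neqAle cap_ge0 andbT; apply/eqP => /esym.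
move=> /(cap_null (measurable_ballset reg x r)) B0.
have := ball_low reg x r0; rewrite B0 lee_fin leNgt mulr_gt0 ?powR_gt0//.
exact: (low_gt0 reg).
Qed.

Lemma pot_split f x (r : R) : measurable_fun setT f -> (forall x, 0 <= f x) ->
  (0 < r)%R ->
  pot f x <= tpot r f x + \int[mu]_y (ind (rho x y <= r)%R * (epow (rho x y)%:E (- b) * f y)).
Proof.
move=> mf f0 r0; rewrite -(intD mu).
- apply: leI => y; first by rewrite mule_ge0 ?ker_ge0.
  have [xy|xy] := leP (rho x y) r.
    rewrite indT mul1e leeDr//; apply: mule_ge0 => //.
    by rewrite lee_fin powR_ge0.
  rewrite indF mul0e adde0 epow_EFin; last exact: lt_trans xy.
  exact: lexx.
- by apply: emeasurable_funM => //; exact: (measurable_tkerx b reg).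
- apply: emeasurable_funM; first by apply: measurable_ind; exact: (measurable_ball reg).
  by apply: emeasurable_funM => //; exact: (measurable_kerx b reg).
- by move=> y; rewrite mule_ge0 ?lee_fin ?powR_ge0.
- by move=> y; rewrite !mule_ge0 ?ker_ge0 ?ind_ge0.
Qed.

(* At the radius where the truncated potential crosses [t / 2], half of
   [pot f x] comes from a ball on which [pot f] is at least a multiple of [t]. *)
Lemma pot_iterate (k : R) : (0 < k)%R -> exists2 D : R, (0 < D)%R &
  forall f x (t : R), measurable_fun setT f -> (forall x, 0 <= f x) ->
  tpot 1 f x < +oo -> (0 < t)%R -> t%:E < pot f x ->
  (D * t `^ (k + 1))%:E <= pot (fun y => f y * pot f y `^ k) x.
Proof.
move=> k0; exists ((8 `^ (- b) / 2) `^ k / 2)%R.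
  by rewrite divr_gt0// !powR_gt0// divr_gt0// powR_gt0.
move=> f x t mf f0 fin t0 tx.
have mp := measurable_pot b reg mf f0.
have t20 : (0 < t / 2)%R by rewrite divr_gt0.
have t2x : (t / 2)%:E < pot f x by apply: lt_trans tx; rewrite lte_fin; lra.
have [r [r0 tr rt]] := tpot_stop reg b_gt0 mf f0 t20 t2x fin.
have r20 : (0 < 2 * r)%R by rewrite mulr_gt0.
pose G y := ind (rho x y <= 2 * r)%R * (epow (rho x y)%:E (- b) * f y).
have G0 y : 0 <= G y by rewrite !mule_ge0 ?ker_ge0 ?ind_ge0.
have mG : measurable_fun setT G.
  apply: emeasurable_funM; first by apply: measurable_ind; exact: (measurable_ball reg).
  by apply: emeasurable_funM => //; exact: (measurable_kerx b reg).
have hG : (t / 2)%:E <= \int[mu]_y G y.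
  have : t%:E <= (t / 2)%:E + \int[mu]_y G y.
    apply: (le_trans (ltW tx)); apply: le_trans (pot_split x mf f0 r20) _.
    by rewrite leeD2r.
  have := int_ge0 mu G0; case: (\int[mu]_y G y) => [z| |]// _; last by move=> _; rewrite leey.
  by rewrite -EFinD !lee_fin; lra.
(* 8^b = 2^b 4^b: doubling the radius loses 2^b, moving the centre loses 4^b. *)
pose A := ((8 `^ (- b) / 2 * t) `^ k)%R; have A0 : (0 <= A)%R by exact: powR_ge0.
apply: (@le_trans _ _ (A%:E * \int[mu]_y G y)).
  apply: (@le_trans _ _ (A%:E * (t / 2)%:E)); last by apply: lee_wpmul2l.
  have z0 : (0 <= 8 `^ (- b) / 2 :> R)%R by rewrite divr_ge0// powR_ge0.
  rewrite -EFinM lee_fin /A (powRM k z0 (ltW t0)).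
  rewrite (powRD0 k 1 t0) powRr1 ?(ltW t0)//.
  by rewrite le_eqVlt; apply/orP; left; apply/eqP; ring.
rewrite -(intZ mu A0 mG G0); apply: leI => y; first by rewrite mule_ge0.
rewrite /G; have [xy|_] := leP (rho x y) (2 * r)%R; last first.
  by rewrite indF mul0e mule0 !mule_ge0 ?ker_ge0 ?poweR_ge0.
rewrite indT mul1e muleCA; apply: lee_wpmul2l; first exact: ker_ge0.
rewrite muleC; apply: lee_wpmul2l => //.
suff hpot : (8 `^ (- b) / 2 * t)%:E <= pot f y.
  have z0 : 0 <= (8 `^ (- b) / 2 * t)%:E :> \bar R.
    by rewrite lee_fin mulr_ge0 ?(ltW t0)// divr_ge0// powR_ge0.
  exact: (le_poweR (ltW k0) z0 hpot).
have h1 := pot_low reg b_gt0 mf f0 r20 xy.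
have h2 := tpot_scale reg b_gt0 x mf f0 r0 (ler1n R 2).
have h3 : (t / 2)%:E <= (8 `^ b)%:E * pot f y.
  apply: (le_trans (ltW tr)); apply: (le_trans h2).
  have b20 : 0 <= (2 `^ b)%:E :> \bar R by rewrite lee_fin powR_ge0.
  apply: (le_trans (lee_wpmul2l b20 h1)).
  by rewrite muleA -EFinM -powRM// -natrM.
have b80 : 0 <= (8 `^ (- b))%:E :> \bar R by rewrite lee_fin powR_ge0.
have := lee_wpmul2l b80 h3.
move: (pot f y) => U; rewrite muleA -!EFinM -(powRD0 _ _ (ltr0n R 8)) addNr powRr0.
rewrite mul1e; apply: le_trans.
by rewrite lee_fin -mulrA [(2^-1 * t)%R]mulrC.
Qed.

Lemma disjoint_series (a : nat -> \bar R) (M : \bar R) : 0 <= M ->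
  (forall i, 0 <= a i) -> (forall i, a i <= M) ->
  (forall i j, i != j -> a i != 0 -> a j != 0 -> False) ->
  \sum_(i <oo) a i <= M.
Proof.
move=> M0 a0 aM dis; have [[i ai]|h] := pselect (exists i, a i != 0); last first.
  rewrite eseries0// => i _ _; apply/eqP; apply/negPn/negP => ai.
  by apply: h; exists i.
rewrite (@nneseriesD1 _ _ i)//= eseries0 ?adde0// => j _ ji.
by apply/eqP; apply/negPn/negP => aj; exact: (dis j i).
Qed.

(** The intervals ]lev i / 2, lev i[ are disjoint, have length lev i / 2, and on each of them the
    capacity of the level set is at least its value at lev i. *)
Lemma capint_levels (W : T -> \bar R) :
  \sum_(i <oo) ((lev i / 2)%:E * cap [set x | (lev i)%:E < W x]) <= capint W.
Proof.
pose I (i : nat) (t : R) := ((lev i / 2 < t) && (t < lev i))%R.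
pose k i := cap [set x | (lev i)%:E < W x].
have k0 i : 0 <= k i by exact: cap_ge0.
have mI i : measurable_fun setT (fun t : R => ind (I i t) : \bar R).
  by apply: measurable_ind; apply: measurable_and; exact: measurable_fun_ltr.
have kE i : (lev i / 2)%:E * k i = \int[lebesgue_measure]_t (ind (I i t) * k i).
  rewrite ge0_integralZr//; last by move=> *; exact: ind_ge0.
    2: exact: mI.
  have l0 := @lev_gt0 R i.
  rewrite int_ind_itv; last by lra.
  by congr (_%:E * _); lra.
rewrite (eq_eseriesr (fun i _ => kE i)) -integral_nneseries//; first last.
- by move=> i t _; rewrite mule_ge0 ?ind_ge0.
- move=> i; apply: emeasurable_funM; first exact: mI.
  exact: measurable_cst.
rewrite capintE; apply: leI => t.
  by apply: nneseries_ge0 => i _ _; rewrite mule_ge0 ?ind_ge0.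
apply: disjoint_series.
- by rewrite mule_ge0 ?ind_ge0 ?cap_ge0.
- by move=> i; rewrite mule_ge0 ?ind_ge0.
- move=> i; rewrite /I; have [l1|_] := ltP (lev i / 2)%R t; last first.
    by rewrite indF mul0e mule_ge0 ?ind_ge0 ?cap_ge0.
  have t0 : (0 < t)%R by rewrite (lt_trans _ l1)// divr_gt0// lev_gt0.
  have [l2|_] := ltP t (lev i); last first.
    by rewrite indF mul0e mule_ge0 ?ind_ge0 ?cap_ge0.
  rewrite t0 !indT !mul1e; apply: cap_sub => x /=.
  by apply: lt_trans; rewrite lte_fin.
- move=> i j ij; rewrite /I.
  case: (ltP (lev i / 2)%R t) => [l1|_]; last by rewrite indF mul0e eqxx.
  case: (ltP t (lev i)) => [l2|_]; last by rewrite indF mul0e eqxx.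
  move=> _; case: (ltP (lev j / 2)%R t) => [l3|_]; last by rewrite indF mul0e eqxx.
  case: (ltP t (lev j)) => [l4|_]; last by rewrite indF mul0e eqxx.
  by move=> _; apply: (@lev_disj _ _ _ t ij); apply/andP; split=> //; exact: ltW.
Qed.

(** Nearly optimal test functions F_i of the sets W > lev i are combined as f^s = sum of 2 lev i
    F_i^s. The integral of f^s is additive in i, and f >= (2 lev i)^(1/s) F_i for each i separately,
    so the potential of f is at least W^(1/s) where lev i < W <= 2 lev i. *)
Lemma pot_majorant (W : T -> \bar R) : capint W <= 1 ->
  exists f : T -> R, [/\ measurable_fun setT f, (forall x, 0 <= f x)%R,
    \int[mu]_x (f x `^ s)%:E <= 6%:E &
    forall x, 0 <= W x -> W x `^ s^-1 <= pot (EFin \o f) x].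
Proof.
move=> W1; pose k i := cap [set x | (lev i)%:E < W x].
have k0 i : 0 <= k i by exact: cap_ge0.
have s'0 : (0 < s^-1)%R by rewrite invr_gt0.
have l0 i := @lev_gt0 R i.
have ksum : \sum_(i <oo) ((lev i / 2)%:E * k i) <= 1.
  exact: le_trans (capint_levels W) W1.
have lk0 i : 0 <= (lev i / 2)%:E * k i by rewrite mule_ge0 ?lee_fin ?divr_ge0// ltW.
have kfin i : k i \is a fin_num.
  rewrite ge0_fin_numE// ltey; apply/eqP => koo.
  have := le_trans (esum_ge i lk0) ksum.
  by rewrite koo gt0_muley ?lte_fin ?divr_gt0// leNgt ltry.
(* The errors satisfy 2 lev i e_i = 2 / 2^(i + 1) and add up to 2; with four times the sum of
   [capint_levels] the total is 6. *)
pose e i : R := (1 / (2 ^ i.+1)%:R / lev i)%R.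
have e0 i : (0 < e i)%R by rewrite !divr_gt0// ltr0n expn_gt0.
have [F PF] : {F : nat -> T -> R & forall i,
    cap_test mu rho b [set x | (lev i)%:E < W x] (F i) /\
    \int[mu]_y (F i y `^ s)%:E <= k i + (e i)%:E}.
  apply: (@choice _ _ (fun i (f : T -> R) =>
    cap_test mu rho b [set x | (lev i)%:E < W x] f /\
    \int[mu]_y (f y `^ s)%:E <= k i + (e i)%:E)) => i.
  have [_ [f hf <-] /ltW lf] := lb_ereal_inf_adherent (e0 i) (kfin i).
  by exists f.
have mF i : measurable_fun setT (F i) by have [[]] := PF i.
have F0 i y : (0 <= F i y)%R by have [[_ + _] _] := PF i.
have F1 i x : (lev i)%:E < W x -> 1 <= pot (EFin \o F i) x.
  by move=> h; have [[_ _ h'] _] := PF i; exact: h'.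
pose G i y := (2 * lev i)%:E * (F i y `^ s)%:E.
have G0 i y : 0 <= G i y.
  by rewrite /G -EFinM lee_fin mulr_ge0 ?powR_ge0// mulr_ge0// ltW.
have mFs i : measurable_fun setT (fun y => (F i y `^ s)%:E).
  by apply/measurable_EFinP; exact: (measurableT_comp (measurable_powR s) (mF i)).
have mG i : measurable_fun setT (G i) by exact: measurable_funeM.
pose P y := \sum_(i <oo) G i y.
have P0 y : 0 <= P y by apply: nneseries_ge0 => i _ _.
have mP : measurable_fun setT P.
  rewrite (_ : P = fun y => \sum_(i <oo | i \in predT) G i y); last first.
    by apply/funext => y; apply: eq_eseriesl.
  by apply: ge0_emeasurable_sum.
have IP : \int[mu]_y P y <= 6%:E.
  rewrite /P integral_nneseries//.
  apply: (@le_trans _ _ (\sum_(i <oo) (4%:E * ((lev i / 2)%:E * k i) +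
      (2 / (2 ^ i.+1)%:R)%:E))).
    apply: lee_nneseries => [i _ _|i _]; first exact: int_ge0.
    have ll : (0 <= 2 * lev i :> R)%R by rewrite mulr_ge0// ltW.
    rewrite intZ//; last by move=> y; rewrite lee_fin powR_ge0.
    have ll' : 0 <= (2 * lev i)%:E :> \bar R by rewrite lee_fin.
    apply: (le_trans (lee_wpmul2l ll' (PF i).2)).
    have [z zE] : exists z, k i = z%:E by exists (fine (k i)); rewrite fineK.
    rewrite zE -EFinD -!EFinM -EFinD lee_fin le_eqVlt; apply/orP; left; apply/eqP.
    by rewrite /e; field; rewrite !gt_eqF// ltr0n expn_gt0.
  rewrite nneseriesD; first last.
  - by move=> i _ _; rewrite lee_fin divr_ge0.
  - by move=> i _ _; rewrite mule_ge0.
  rewrite nneseriesZl//.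
  have h4 : 0 <= 4%:E :> \bar R by rewrite lee_fin.
  have := leeD (lee_wpmul2l h4 ksum) (epsilon_trick0 predT (ler0n R 2)).
  by move=> /le_trans; apply; rewrite -EFinM -EFinD lee_fin; lra.
pose f y := (fine (P y) `^ s^-1)%R.
have mf : measurable_fun setT f.
  apply: (measurableT_comp (measurable_powR s^-1)).
  exact: (measurableT_comp (@fine_measurable R setT measurableT) mP).
have f0 y : (0 <= f y)%R by exact: powR_ge0.
have meF i : measurable_fun setT (EFin \o F i) by exact/measurable_EFinP.
have eF0 i y : 0 <= (EFin \o F i) y by rewrite lee_fin.
have ae_fin : {ae mu, forall y, P y < +oo}.
  by apply: int_lty_ae => //; apply: (le_lt_trans IP); rewrite ltry.
have hpot i x : (lev i)%:E < W x -> ((2 * lev i) `^ s^-1)%:E <= pot (EFin \o f) x.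
  move=> h; have z0 : (0 <= (2 * lev i) `^ s^-1)%R by exact: powR_ge0.
  have z0' : 0 <= ((2 * lev i) `^ s^-1)%:E by rewrite lee_fin.
  have := lee_wpmul2l z0' (F1 i x h); rewrite mule1 => /le_trans; apply.
  rewrite -(intZ mu z0); first last.
  - by move=> y; rewrite mule_ge0 ?ker_ge0.
  - by apply: emeasurable_funM => //; exact: (measurable_kerx b reg).
  apply: ae_ge0_le_integral => //.
  - by move=> y _; rewrite !mule_ge0 ?ker_ge0.
  - apply: measurable_funeM; apply: emeasurable_funM => //.
    exact: (measurable_kerx b reg).
  - by move=> y _; rewrite mule_ge0 ?ker_ge0 ?lee_fin.
  - apply: emeasurable_funM; first exact: (measurable_kerx b reg).
    exact/measurable_EFinP.
  apply: filterS ae_fin => y Py _; rewrite muleCA.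
  apply: lee_wpmul2l; first exact: ker_ge0.
  rewrite /= -EFinM lee_fin /f.
  have : ((2 * lev i) * F i y `^ s <= fine (P y))%R.
    by rewrite -lee_fin fineK ?ge0_fin_numE//; exact: (esum_ge i (G0^~ y)).
  have l20 : (0 <= 2 * lev i :> R)%R by rewrite mulr_ge0// ltW.
  have h1 : (0 <= 2 * lev i * F i y `^ s)%R by rewrite mulr_ge0// powR_ge0.
  move=> /(powR_le (ltW s'0) h1); apply: le_trans.
  rewrite (powRM s^-1 l20 (powR_ge0 _ _)).
  by rewrite -powRrM mulfV ?gt_eqF// powRr1// F0.
exists f; split => //.
  apply: le_trans IP; apply: leI => y; first by rewrite lee_fin powR_ge0.
  rewrite /f -powRrM mulVf ?gt_eqF// powRr1; last by rewrite fine_ge0.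
  by have := P0 y; case: (P y) => [z| |]//=; rewrite leey.
move=> x; case WE : (W x) => [v| |]//; last first.
  move=> _; rewrite (_ : pot (EFin \o f) x = +oo) ?leey//.
  apply/eqyP => M M0.
  have v0 : (0 < M `^ s)%R by rewrite powR_gt0.
  (* Where W is infinite every level is exceeded, so the potential is at least any given M. *)
  have [i /andP[_ h2]] := lev_cover v0.
  apply: le_trans (hpot i x _); last by rewrite WE ltry.
  rewrite lee_fin; have := powR_le (ltW s'0) (ltW v0) h2.
  by rewrite -powRrM mulfV ?gt_eqF// powRr1// ltW.
rewrite lee_fin le_eqVlt => /orP[/eqP <-|v0].
  rewrite poweR_EFin powR0 ?gt_eqF//; apply: pot_ge0 => y.
  by rewrite lee_fin.
have [i /andP[h1 h2]] := lev_cover v0.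
apply: le_trans (hpot i x _); last by rewrite WE lte_fin.
by rewrite poweR_EFin lee_fin; exact: (powR_le (ltW s'0) (ltW v0) h2).
Qed.

End weights.

(** * Passage between admissible weights and functions of finite energy *)

Section duality.
Context d {T : measurableType d} {R : realType}.
Variable mu : {sigma_finite_measure set T -> \bar R}.
Variables (rho : T -> T -> R) (N c C b : R).
Hypothesis reg : regular_space mu rho N c C.
Hypotheses (b_gt0 : 0 < b) (b_ltN : b < N).
Variables (I : finType) (Q : I -> int -> T -> T -> bool) (sc : int -> R) (kd : R).
Hypothesis dya : dyadic_system mu rho Q sc kd.
Variables (q s : R).
Hypotheses (q_ge1 : 1 <= q) (q_lts : q < s).
Hypothesis s_small : N < b * (s / (s - 1)).
Local Open Scope ereal_scope.
Local Notation pot := (pot mu rho b).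
Local Notation tpot := (tpot mu rho b).
Local Notation cap := (cap mu rho b s).
Local Notation capint := (capint mu rho b s).

Let q0 : (0 < q)%R := lt_le_trans ltr01 q_ge1.
Let s0 : (0 < s)%R := lt_trans q0 q_lts.
Let s1 : (1 < s)%R := le_lt_trans q_ge1 q_lts.
Let qs0 : (q - s < 0)%R. Proof. by rewrite subr_lt0. Qed.
Let p := (s / q)%R.
Let k := ((s - q) / q)%R.
Let p0 : (0 < p)%R. Proof. by rewrite divr_gt0. Qed.
Let k0 : (0 < k)%R. Proof. by rewrite divr_gt0// subr_gt0. Qed.
Let kp : (k + 1 = p)%R. Proof. by rewrite /k /p mulrBl mulfV ?subrK// gt_eqF. Qed.
Let kps : (k * s + p * (q - s) = 0)%R.
Proof. by rewrite /k /p; field; rewrite gt_eqF. Qed.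

(** Since k + 1 = s / q, its potential is at least of the order of the power s / q of [pot f]. The
    use of [fine] makes it 0 where that potential is infinite. *)
Definition iter_fun (f : T -> R) (y : T) : R :=
  (f y * fine (pot (EFin \o f) y) `^ k)%R.

Lemma iter_fun_ge0 (f : T -> R) : (forall x, 0 <= f x)%R ->
  forall y, (0 <= iter_fun f y)%R.
Proof. by move=> f0 y; rewrite mulr_ge0// powR_ge0. Qed.

Lemma measurable_iter_fun (f : T -> R) : measurable_fun setT f ->
  (forall x, 0 <= f x)%R -> measurable_fun setT (iter_fun f).
Proof.
move=> mf f0; apply: measurable_funM => //.
apply: (measurableT_comp (measurable_powR k)).
apply: (measurableT_comp (@fine_measurable R setT measurableT)).
by apply: (measurable_pot b reg) => [|y]; [exact/measurable_EFinP|rewrite lee_fin].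
Qed.

(** The powers of the potential cancel because k s + p (q - s) = 0. Where the potential is 0 or
    infinite [iter_fun] vanishes, and 0 * +oo = 0. *)
Lemma iter_fun_weight (f : T -> R) y : (forall x, 0 <= f x)%R ->
  (iter_fun f y `^ s)%:E * epow (pot (EFin \o f) y `^ p) (q - s) <= (f y `^ s)%:E.
Proof.
move=> f0; rewrite /iter_fun.
have : 0 <= pot (EFin \o f) y by apply: pot_ge0 => z; rewrite lee_fin.
case: (pot _ y) => [v| |] // v0; last first.
  by rewrite /= powR0 ?gt_eqF// mulr0 powR0 ?gt_eqF// mul0e lee_fin powR_ge0.
move: v0; rewrite lee_fin le_eqVlt => /orP[/eqP <-|v0].
  by rewrite /= powR0 ?gt_eqF// mulr0 powR0 ?gt_eqF// mul0e lee_fin powR_ge0.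
rewrite poweR_EFin epow_EFin ?powR_gt0// -EFinM lee_fin /=.
rewrite (powRM s (f0 y) (powR_ge0 _ _)) -!powRrM -mulrA -powRD0// kps powRr0 mulr1.
exact: lexx.
Qed.

Lemma pot_iter_fun : exists2 D : R, (0 < D)%R & forall (f : T -> R) x,
  measurable_fun setT f -> (forall x, 0 <= f x)%R ->
  (forall x r, (0 < r)%R -> tpot r (EFin \o f) x < +oo) ->
  D%:E * pot (EFin \o f) x `^ p <= pot (EFin \o iter_fun f) x.
Proof.
have [D D0 hD] := pot_iterate reg b_gt0 k0.
have D20 : (0 < D * 2 `^ (- p))%R by rewrite mulr_gt0// powR_gt0.
(* [pot_iterate] requires t strictly below the potential; taking half of a finite potential costs
   2^(-p). *)
exists (D * 2 `^ (- p))%R => // f x mf f0 fin.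
have mef : measurable_fun setT (EFin \o f) by exact/measurable_EFinP.
have ef0 y : 0 <= (EFin \o f) y by rewrite lee_fin.
have mp := measurable_pot b reg mef ef0.
have ae_fin := pot_lty_ae reg b_gt0 b_ltN mef ef0 fin.
have g0 y : 0 <= (EFin \o iter_fun f) y by rewrite lee_fin; exact: iter_fun_ge0.
have mg : measurable_fun setT (EFin \o iter_fun f).
  by apply/measurable_EFinP; exact: measurable_iter_fun.
have P0 := pot_ge0 mu rho b x ef0.
have {}hD (t : R) : (0 < t)%R -> t%:E < pot (EFin \o f) x ->
    (D * t `^ p)%:E <= pot (EFin \o iter_fun f) x.
  move=> t0 tx; have := hD _ x t mef ef0 (fin x 1%R ltr01) t0 tx; rewrite kp.
  move=> /le_trans; apply.
  rewrite le_eqVlt; apply/orP; left; apply/eqP.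
  apply: (eq_pot b reg x) => //.
  - apply: emeasurable_funM => //; exact: (measurableT_comp (measurable_poweR k) mp).
  - by move=> y; rewrite mule_ge0 ?poweR_ge0.
  apply: filterS ae_fin => y yfin; rewrite /= /iter_fun EFinM -poweR_EFin.
  have Py := pot_ge0 mu rho b y ef0.
  by rewrite fineK// ge0_fin_numE.
move: hD P0; case: (pot (EFin \o f) x) => [v| |] // hD; last first.
  move=> _; rewrite (_ : pot (EFin \o iter_fun f) x = +oo) ?leey//.
  apply/eqyP => M M0.
  have MD0 : (0 < (M / D) `^ p^-1)%R by rewrite powR_gt0// divr_gt0.
  have := hD _ MD0 (ltry _); rewrite -powRrM mulVf ?gt_eqF// powRr1 ?divr_ge0 ?(ltW D0) ?(ltW M0)//.
  by rewrite mulrC divfK ?gt_eqF.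
rewrite lee_fin le_eqVlt => /orP[/eqP <-|v0].
  by rewrite poweR_EFin powR0 ?gt_eqF// mule0; exact: pot_ge0.
have v20 : (0 < v / 2)%R by rewrite divr_gt0.
have v2v : (v / 2)%:E < v%:E by rewrite lte_fin; lra.
apply: le_trans (hD _ v20 v2v).
rewrite poweR_EFin -EFinM lee_fin (powRM p (ltW v0)) ?invr_ge0//.
rewrite -powR_inv1// -powRrM mulN1r.
by rewrite le_eqVlt; apply/orP; left; apply/eqP; ring.
Qed.

Lemma tpot_bounded (f : T -> R) (M r1 : R) x0 x r : measurable_fun setT f ->
  (forall y, 0 <= f y)%R -> (0 <= M)%R -> (0 < r1)%R -> (0 < r)%R ->
  (forall y, f y <= M * (rho x0 y <= r1)%R%:R)%R ->
  tpot r (EFin \o f) x < +oo.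
Proof.
move=> mf f0 M0 r10 r0 fM.
have z0 : (0 <= r `^ (- b) * M)%R by rewrite mulr_ge0// powR_ge0.
apply: (@le_lt_trans _ _ ((r `^ (- b) * M)%:E * mu [set y | rho x0 y <= r1]%R)); last first.
  apply: lty_mulEFin => //; apply: le_lt_trans (ball_upp reg x0 r10) _.
  by rewrite ltry.
have mb : measurable_fun setT (fun y => rho x0 y <= r1)%R by exact: (measurable_ball reg).
rewrite -(int_indE mu mb) -(intZ mu z0 (measurable_ind mb) (fun=> ind_ge0 _)).
apply: leI => y; first by rewrite -EFinM lee_fin mulr_ge0 ?powR_ge0.
rewrite /= -!EFinM lee_fin -mulrA; apply: ler_pM => //; first exact: powR_ge0.
exact: tker_le_r.
Qed.

(** Truncation both in height and in support makes all truncated potentials finite, as [strong_type]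
    requires. The bound [m.+1] keeps the radius positive at m = 0. *)
Definition cut x0 (m : nat) (f : T -> R) (y : T) : R :=
  (f y * ((f y <= m.+1%:R) && (rho x0 y <= m.+1%:R))%:R)%R.

Lemma cut_ge0 x0 m (f : T -> R) y : (forall x, 0 <= f x)%R -> (0 <= cut x0 m f y)%R.
Proof. by move=> f0; rewrite mulr_ge0. Qed.

Lemma cut_le x0 m (f : T -> R) y : (forall x, 0 <= f x)%R -> (cut x0 m f y <= f y)%R.
Proof. by move=> f0; rewrite ler_piMr//; case: (_ && _). Qed.

Lemma cut_bounded x0 m (f : T -> R) y :
  (cut x0 m f y <= m.+1%:R * (rho x0 y <= m.+1%:R)%R%:R)%R.
Proof.
rewrite /cut; case: (leP (f y)) => [fy|_]; last by rewrite mulr0 mulr_ge0.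
by case: (rho x0 y <= _)%R; rewrite /= ?mulr1// !mulr0.
Qed.

Lemma le_cut x0 (f : T -> R) y i j : (forall x, 0 <= f x)%R -> (i <= j)%N ->
  (cut x0 i f y <= cut x0 j f y)%R.
Proof.
move=> f0 ij; rewrite ler_wpM2l//.
have ij' : (i.+1%:R <= j.+1%:R :> R)%R by rewrite ler_nat.
case: (leP (f y) i.+1%:R) => // fi; case: (leP (rho x0 y) i.+1%:R) => // ri.
by rewrite (le_trans fi ij') (le_trans ri ij').
Qed.

Lemma cut_eventually x0 (f : T -> R) y : exists m, cut x0 m f y = f y.
Proof.
have [m] := ex_dyadic_ge (Num.max (f y) (rho x0 y)); rewrite ge_max => /andP[h1 h2].
have h : (2 ^+ m <= (2 ^ m).+1%:R :> R)%R by rewrite -natrX ler_nat.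
by exists (2 ^ m)%N; rewrite /cut (le_trans h1 h) (le_trans h2 h) mulr1.
Qed.

Lemma measurable_cut x0 m (f : T -> R) : measurable_fun setT f ->
  measurable_fun setT (cut x0 m f).
Proof.
move=> mf; apply: measurable_funM => //.
apply: (@measurableT_comp _ _ _ _ _ _ (fun b : bool => b%:R : R)) => //.
apply: measurable_and; last exact: (measurable_ball reg).
by apply: measurable_fun_ler => //; exact: measurable_cst.
Qed.

Lemma pot_cut_bounded x0 m (f : T -> R) : measurable_fun setT f ->
  (forall x, 0 <= f x)%R -> exists2 M : R, (0 <= M)%R &
  forall x, pot (EFin \o cut x0 m f) x <= M%:E.
Proof.
move=> mf f0; have [K K0 hK] := ker_ball_int reg b_gt0 b_ltN.
have m0 : (0 < m.+1%:R :> R)%R by rewrite ltr0n.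
exists (m.+1%:R * (K * m.+1%:R `^ N * m.+1%:R `^ (- b)))%R.
  by rewrite !mulr_ge0 ?powR_ge0// ltW.
move=> x; apply: (@le_trans _ _ ((m.+1%:R)%:E *
    \int[mu]_y (ind (rho x0 y <= m.+1%:R)%R * epow (rho y x)%:E (- b)))).
  rewrite -intZ; first last.
  - by move=> y; rewrite mule_ge0 ?ind_ge0 ?ker_ge0.
  - apply: emeasurable_funM; first by apply: measurable_ind; exact: (measurable_ball reg).
    under eq_fun do rewrite (rho_sym reg); exact: (measurable_kerx b reg).
  - exact: ltW.
  apply: leI => y; first by rewrite mule_ge0 ?ker_ge0 ?lee_fin ?cut_ge0.
  rewrite (rho_sym reg y x) muleA [leRHS]muleC; apply: lee_wpmul2l; first exact: ker_ge0.
  by rewrite -EFinM lee_fin; exact: cut_bounded.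
rewrite EFinM; apply: lee_wpmul2l; first by rewrite lee_fin ltW.
apply: (le_trans (hK x0 x _ m0)); rewrite lee_fin.
apply: ler_wpM2l; first by rewrite mulr_ge0 ?powR_ge0// ltW.
exact: tker_le_r.
Qed.

Lemma int_powR_cut x0 m (f : T -> R) : (forall x, 0 <= f x)%R ->
  \int[mu]_x (cut x0 m f x `^ s)%:E <= \int[mu]_x (f x `^ s)%:E.
Proof.
move=> f0; apply: leI => y; first by rewrite lee_fin powR_ge0.
by rewrite lee_fin powR_le ?cut_le ?cut_ge0// ltW.
Qed.

Lemma tpot_Lp_fin (f : T -> R) : measurable_fun setT f -> (forall x, 0 <= f x)%R ->
  \int[mu]_x (f x `^ s)%:E < +oo ->
  forall x r, (0 < r)%R -> tpot r (EFin \o f) x < +oo.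
Proof.
move=> mf f0 fin x r r0.
have [D D0 hD] := tpot_Lp reg b_gt0 x s1 s_small r0 ltr01.
apply: le_lt_trans (hD f mf f0) _; apply: lte_add_pinfty; first exact: ltry.
exact: (lty_mulEFin (ltW D0) fin).
Qed.

(** If the potentials of all truncations were below half of [pot f] at y, monotone convergence would
    bound [pot f] there by half of itself, hence it would be 0, where m = 0 works. *)
Lemma pot_cut_eventually x0 (f : T -> R) y : measurable_fun setT f ->
  (forall x, 0 <= f x)%R -> pot (EFin \o f) y < +oo ->
  exists m, pot (EFin \o f) y <= 2%:E * pot (EFin \o cut x0 m f) y.
Proof.
move=> mf f0 Uy; apply: contrapT => h.
have mef : measurable_fun setT (EFin \o f) by exact/measurable_EFinP.
have ef0 z : 0 <= (EFin \o f) z by rewrite lee_fin.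
have U0 := pot_ge0 mu rho b y ef0.
have [v vE] : exists v, pot (EFin \o f) y = v%:E.
  by exists (fine (pot (EFin \o f) y)); rewrite fineK// ge0_fin_numE.
have : pot (EFin \o f) y <= (v / 2)%:E.
  apply: (@int_le_mono _ _ _ mu _
    (fun m z => epow (rho y z)%:E (- b) * (cut x0 m f z)%:E)).
  - move=> m; apply: emeasurable_funM; first exact: (measurable_kerx b reg).
    by apply/measurable_EFinP; exact: measurable_cut.
  - by move=> m z; rewrite mule_ge0 ?ker_ge0 ?lee_fin ?cut_ge0.
  - move=> z i j ij; apply: lee_wpmul2l; first exact: ker_ge0.
    by rewrite lee_fin le_cut.
  - by move=> z; rewrite mule_ge0 ?ker_ge0.
  - by move=> z; have [m mE] := cut_eventually x0 f z; exists m; rewrite mE.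
  - move=> m; rewrite leNgt; apply/negP => hm; apply: h; exists m.
    move: hm; rewrite vE; rewrite -/(pot (EFin \o cut x0 m f) y).
    case: (pot _ y) => [z| |]//=; last by rewrite gt0_muley ?lte_fin// leey.
    by rewrite lte_fin -EFinM lee_fin; lra.
rewrite vE lee_fin => v2; move: U0; rewrite vE lee_fin => v0.
apply: h; exists 0%N; rewrite vE (_ : v = 0%R); last by lra.
by rewrite mule_ge0 ?pot_ge0// => z; rewrite lee_fin cut_ge0.
Qed.

(* [cap_le_capint] at the level reached on the unit ball bounds the truncated
   potential, since the ball has positive capacity. *)
Lemma capint_tpot x0 (A : R) : exists M : R, forall h : T -> R,
  measurable_fun setT h -> (forall x, 0 <= h x)%R ->
  (forall x r, (0 < r)%R -> tpot r (EFin \o h) x < +oo) ->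
  capint (fun x => pot (EFin \o h) x `^ q) <= A%:E ->
  tpot 1 (EFin \o h) x0 <= M%:E.
Proof.
have cB := cap_ball_gt0 reg b_gt0 b_ltN q_ge1 q_lts s_small x0 ltr01.
have [c0 c00 c0B] : exists2 c0 : R, (0 < c0)%R & c0%:E <= cap [set y | rho x0 y <= 1]%R.
  move: cB; case: (cap _) => [z| |]//; last by exists 1%R => //; exact: leey.
  by rewrite lte_fin => z0; exists z.
(* If the truncated potential tau exceeded M, the potential would be at least 4^(-b) tau on the unit
   ball, and (4^(-b) tau)^q c0 would exceed A. *)
pose M := (4 `^ b * (`|A| / c0) `^ q^-1)%R.
exists M => h mh h0 fin hA.
have meh : measurable_fun setT (EFin \o h) by exact/measurable_EFinP.
have eh0 z : 0 <= (EFin \o h) z by rewrite lee_fin.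
have M0 : (0 <= M)%R by rewrite mulr_ge0 ?powR_ge0.
have [tau tauE] : exists tau, tpot 1 (EFin \o h) x0 = tau%:E.
  exists (fine (tpot 1 (EFin \o h) x0)); rewrite fineK// ge0_fin_numE.
    exact: (fin x0 1%R ltr01).
  exact: tpot_ge0.
rewrite tauE lee_fin leNgt; apply/negP => Mtau.
have tau0 : (0 < tau)%R := le_lt_trans M0 Mtau.
have t40 : (0 < 4 `^ (- b) * tau)%R by rewrite mulr_gt0// powR_gt0.
have t0 : (0 < (4 `^ (- b) * tau) `^ q)%R by rewrite powR_gt0.
have h1 := cap_le_capint mu rho b s (fun x => pot (EFin \o h) x `^ q) t0.
have h2 : ((4 `^ (- b) * tau) `^ q)%:E * c0%:E <= A%:E.
  apply: le_trans hA; apply: le_trans h1; apply: lee_wpmul2l.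
    by rewrite lee_fin ltW.
  apply: (le_trans c0B); apply: cap_sub => y /= xy.
  rewrite -poweR_EFin; apply: (le_poweR (ltW q0)); first by rewrite lee_fin ltW.
  have h3 := pot_low reg b_gt0 meh eh0 ltr01 xy; rewrite tauE in h3.
  have b40 : 0 <= (4 `^ (- b))%:E :> \bar R by rewrite lee_fin powR_ge0.
  have := lee_wpmul2l b40 h3; move: (pot _ y) => U.
  by rewrite muleA -!EFinM -(powRD0 _ _ (ltr0n R 4)) addNr powRr0 mul1e.
have h4 : ((4 `^ (- b) * tau) `^ q <= `|A| / c0)%R.
  rewrite ler_pdivlMr//; move: h2; rewrite -EFinM lee_fin => /le_trans; apply.
  exact: ler_norm.
have q'0 : (0 <= q^-1)%R by rewrite invr_ge0 ltW.
have := powR_le q'0 (ltW t0) h4; rewrite -powRrM mulfV ?gt_eqF// powRr1 ?(ltW t40)// => h5.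
have := ler_wpM2l (powR_ge0 4 b) h5; rewrite mulrA -(powRD0 _ _ (ltr0n R 4)) subrr powRr0 mul1r.
by rewrite leNgt Mtau.
Qed.

(** [strong_type] cannot be applied to h, whose truncated potentials are the unknown. It is applied
    to maxima G of a truncation of h and [iter_fun] of a truncation of f: these are bounded with
    bounded support, and the second part keeps the potential of G large, so that the energies of G
    are bounded uniformly. [capint_tpot] then bounds the truncated potentials uniformly, and the
    truncations of h increase to h almost everywhere. *)
Lemma finite_weighted (f h : T -> R) :
  measurable_fun setT f -> (forall x, 0 <= f x)%R ->
  measurable_fun setT h -> (forall x, 0 <= h x)%R ->
  \int[mu]_x (f x `^ s)%:E < +oo ->
  \int[mu]_x ((h x `^ s)%:E * epow (pot (EFin \o f) x `^ p) (q - s)) < +oo ->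
  forall x r, (0 < r)%R -> tpot r (EFin \o h) x < +oo.
Proof.
move=> mf f0 mh h0 fs hs.
have x0 : T := point.
have mef : measurable_fun setT (EFin \o f) by exact/measurable_EFinP.
have ef0 z : 0 <= (EFin \o f) z by rewrite lee_fin.
have meh : measurable_fun setT (EFin \o h) by exact/measurable_EFinP.
have eh0 z : 0 <= (EFin \o h) z by rewrite lee_fin.
suff fin1 : tpot 1 (EFin \o h) x0 < +oo.
  exact: (tpot_fin_all reg b_gt0 meh eh0 ltr01 fin1).
have ffin := tpot_Lp_fin mf f0 fs.
have mU := measurable_pot b reg mef ef0.
have [D D0 hD] := pot_iter_fun.
have [K K0 hK] := strong_type reg b_gt0 b_ltN dya q_ge1 q_lts.
pose fm m := cut x0 m f.
have fm0 m y : (0 <= fm m y)%R by exact: cut_ge0.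
have mfm m : measurable_fun setT (fm m) by exact: measurable_cut.
have fmfin m : forall x r, (0 < r)%R -> tpot r (EFin \o fm m) x < +oo.
  apply: tpot_Lp_fin => //.
  exact: le_lt_trans (int_powR_cut _ _ f0) fs.
have mefm m : measurable_fun setT (EFin \o fm m) by exact/measurable_EFinP.
have efm0 m z : 0 <= (EFin \o fm m) z by rewrite lee_fin.
have mUm m := measurable_pot b reg (mefm m) (efm0 m).
(* [h] is truncated and restricted to the points where [pot f] is already
   comparable to the potential of the truncated [f]. *)
pose P m y := pot (EFin \o f) y <= 2%:E * pot (EFin \o fm m) y.
have mP m : measurable_fun setT (P m).
  by apply: measurable_fun_lee => //; exact: measurable_funeM.
pose hm m y := (cut x0 m h y * (P m y)%:R)%R.
have hm0 m y : (0 <= hm m y)%R by rewrite mulr_ge0// cut_ge0.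
have mhm m : measurable_fun setT (hm m).
  apply: measurable_funM; first exact: measurable_cut.
  exact: (@measurableT_comp _ _ _ _ _ _ (fun b : bool => b%:R : R)).
pose gm m := iter_fun (fm m).
have gm0 m y : (0 <= gm m y)%R by exact: iter_fun_ge0.
have mgm m : measurable_fun setT (gm m) by exact: measurable_iter_fun.
pose G m y := Num.max (hm m y) (gm m y).
have G0 m y : (0 <= G m y)%R by rewrite le_max hm0.
have mG m : measurable_fun setT (G m) by exact: measurable_maxr.
have Gfin m : forall x r, (0 < r)%R -> tpot r (EFin \o G m) x < +oo.
  move=> x r r0; have [M M0 hM] := pot_cut_bounded x0 m mf f0.
  have z0 : (0 <= Num.max m.+1%:R (m.+1%:R * M `^ k) :> R)%R by rewrite le_max ler0n.
  apply: (tpot_bounded x (mG m) (G0 m) z0 (ltr0Sn R m) r0 (x0 := x0)) => y.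
  rewrite /G ge_max; apply/andP; split.
    apply: (@le_trans _ _ (cut x0 m h y)).
      by rewrite /hm ler_piMr ?cut_ge0//; case: (P m y).
    apply: (le_trans (cut_bounded x0 m h y)); apply: ler_wpM2r => //.
    by rewrite le_max lexx.
  rewrite /gm /iter_fun; apply: (@le_trans _ _
      (m.+1%:R * (rho x0 y <= m.+1%:R)%R%:R * M `^ k)%R).
    apply: ler_pM => //; [exact: powR_ge0|exact: cut_bounded|].
    apply: powR_le; [exact: ltW|by apply: fine_ge0; exact: pot_ge0|].
    have := hM y; have := pot_ge0 mu rho b y (efm0 m).
    by rewrite -/(fm m); case: (pot _ y).
  by rewrite mulrAC; apply: ler_wpM2r => //; rewrite le_max lexx orbT.
pose W y := epow (pot (EFin \o f) y `^ p) (q - s).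
have W0 y : 0 <= W y by exact: epow_ge0.
have mW : measurable_fun setT W.
  exact: (measurableT_comp (measurable_epow _) (measurableT_comp (measurable_poweR p) mU)).
(* D is lost in the potential of [iter_fun], and 2^(-p) in replacing [pot f] by the potential of its
   truncation where [P m] holds. *)
pose L1 := (D `^ (q - s) * (2 `^ (- p)) `^ (q - s))%R.
have L10 : (0 <= L1)%R by rewrite mulr_ge0 ?powR_ge0.
pose L2 := (D `^ (q - s))%R; have L20 : (0 <= L2)%R by exact: powR_ge0.
pose X y := L1%:E * ((h y `^ s)%:E * W y) + L2%:E * (f y `^ s)%:E.
have hW0 y : 0 <= (h y `^ s)%:E * W y by rewrite mule_ge0 ?lee_fin ?powR_ge0.
have fW0 y : 0 <= (f y `^ s)%:E by rewrite lee_fin powR_ge0.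
have mhW : measurable_fun setT (fun y => (h y `^ s)%:E * W y).
  apply: emeasurable_funM => //; apply/measurable_EFinP.
  exact: (measurableT_comp (measurable_powR s) mh).
have mfs : measurable_fun setT (fun y => (f y `^ s)%:E).
  by apply/measurable_EFinP; exact: (measurableT_comp (measurable_powR s) mf).
have IX : \int[mu]_y X y < +oo.
  rewrite /X intD; first last.
  - by move=> y; rewrite mule_ge0.
  - by move=> y; rewrite mule_ge0.
  - exact: measurable_funeM.
  - exact: measurable_funeM.
  rewrite !intZ//; apply: lte_add_pinfty; exact: lty_mulEFin.
have IG m : \int[mu]_y ((G m y `^ s)%:E * epow (pot (EFin \o G m) y) (q - s)) <=
    \int[mu]_y X y.
  apply: leI => y; first by rewrite mule_ge0 ?epow_ge0 ?lee_fin ?powR_ge0.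
  have eG0 z : 0 <= (EFin \o gm m) z by rewrite lee_fin.
  have lG : pot (EFin \o gm m) y <= pot (EFin \o G m) y.
    by apply: le_pot => // z; rewrite lee_fin le_max lexx orbT.
  have lg := hD (fm m) y (mfm m) (fm0 m) (fmfin m).
  have lG2 : D%:E * pot (EFin \o fm m) y `^ p <= pot (EFin \o G m) y := le_trans lg lG.
  have u0 : 0 <= pot (EFin \o fm m) y by exact: pot_ge0.
  have up0 : 0 <= pot (EFin \o fm m) y `^ p by exact: poweR_ge0.
  have Du0 : 0 <= D%:E * pot (EFin \o fm m) y `^ p by rewrite mule_ge0// lee_fin ltW.
  have lE : epow (pot (EFin \o G m) y) (q - s) <=
      (D `^ (q - s))%:E * epow (pot (EFin \o fm m) y `^ p) (q - s).
    by apply: le_trans (le_epow qs0 Du0 lG2) _; rewrite epowM.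
  have X1 : 0 <= L1%:E * ((h y `^ s)%:E * W y) by rewrite mule_ge0.
  have X2 : 0 <= L2%:E * (f y `^ s)%:E by rewrite mule_ge0.
  have Gs0 : 0 <= (G m y `^ s)%:E by rewrite lee_fin powR_ge0.
  apply: (le_trans (lee_wpmul2l Gs0 lE)); rewrite muleCA.
  have [hg|gh] := leP (hm m y) (gm m y).
    have -> : G m y = gm m y by rewrite /G; apply/max_idPr.
    apply: (le_trans _ (leeDr _ X1)); apply: lee_wpmul2l => //.
    apply: le_trans (iter_fun_weight y (fm0 m)) _.
    by rewrite lee_fin powR_le ?cut_le// ltW.
  have -> : G m y = hm m y by rewrite /G; apply/max_idPl; exact: ltW.
  apply: (le_trans _ (leeDl _ X2)); rewrite /L1 EFinM -muleA.
  apply: lee_wpmul2l => //.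
  rewrite {1}/hm; case Pm : (P m y); last by rewrite mulr0 powR0 ?gt_eqF// mul0e mule_ge0 ?lee_fin ?powR_ge0.
  rewrite mulr1 muleCA; apply: lee_pmul.
  - by rewrite lee_fin powR_ge0.
  - exact: epow_ge0.
  - by rewrite lee_fin powR_le ?cut_ge0 ?cut_le// ltW.
  have l2 : (2 `^ (- p))%:E * pot (EFin \o f) y `^ p <= pot (EFin \o fm m) y `^ p.
    have b20 : 0 <= (2 `^ (- p))%:E :> \bar R by rewrite lee_fin powR_ge0.
    have := lee_wpmul2l b20 (le_poweR (ltW p0) (pot_ge0 mu rho b y ef0) Pm).
    move/le_trans; apply; rewrite poweRM//.
    rewrite muleA poweR_EFin -EFinM -(powRD0 _ _ (ltr0n R 2)) addNr powRr0 mul1e.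
    exact: lexx.
  have z0 : 0 <= (2 `^ (- p))%:E * pot (EFin \o f) y `^ p.
    by rewrite mule_ge0 ?poweR_ge0 ?lee_fin ?powR_ge0.
  apply: (le_trans (le_epow qs0 z0 l2)); rewrite epowM ?powR_gt0//.
  exact: poweR_ge0.
have [B BE] : exists B, K%:E * \int[mu]_y X y = B%:E.
  exists (fine (K%:E * \int[mu]_y X y)); rewrite fineK// ge0_fin_numE.
    exact: (lty_mulEFin (ltW K0) IX).
  rewrite mule_ge0 ?lee_fin ?(ltW K0)//; apply: int_ge0 => y.
  by apply: adde_ge0; [exact: (mule_ge0 _ (hW0 y))|exact: (mule_ge0 _ (fW0 y))].
have [M hM] := capint_tpot x0 B.
have tM m : tpot 1 (EFin \o hm m) x0 <= M%:E.
  apply: (@le_trans _ _ (tpot 1 (EFin \o G m) x0)).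
    apply: le_tpot => z; first by rewrite lee_fin.
    by rewrite lee_fin le_max lexx.
  apply: (hM _ (mG m) (G0 m) (Gfin m)).
  apply: le_trans (hK _ (mG m) (G0 m) (Gfin m)) _; rewrite -BE.
  have K0' : 0 <= K%:E by rewrite lee_fin ltW.
  exact: (lee_wpmul2l K0' (IG m)).
(* Where [pot f] is infinite [P m] never holds, the potentials of truncations being bounded. On this
   null set h is replaced by 0. *)
pose h' y := (h y * (pot (EFin \o f) y < +oo)%E%:R)%R.
have mh' : measurable_fun setT h'.
  apply: measurable_funM => //.
  apply: (@measurableT_comp _ _ _ _ _ _ (fun b : bool => b%:R : R)) => //.
  by apply: measurable_fun_lte => //; exact: measurable_cst.
have h'0 y : (0 <= h' y)%R by rewrite mulr_ge0.
have ae_fin := pot_lty_ae reg b_gt0 b_ltN mef ef0 ffin.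
rewrite (eq_tpot b reg 1%R x0 meh (g := EFin \o h')) //; first last.
- by apply: filterS ae_fin => y yfin; rewrite /= /h' yfin mulr1.
- exact/measurable_EFinP.
apply: (@le_lt_trans _ _ M%:E); last exact: ltry.
apply: (@int_le_mono _ _ _ mu _
    (fun m z => (Num.max 1 (rho x0 z) `^ (- b))%R%:E * (hm m z)%:E)).
- move=> m; apply: emeasurable_funM; first exact: (measurable_tkerx b reg).
  exact/measurable_EFinP.
- by move=> m z; rewrite -EFinM lee_fin mulr_ge0 ?powR_ge0.
- move=> z i j ij; rewrite -!EFinM lee_fin; apply: ler_wpM2l; first exact: powR_ge0.
  apply: ler_pM => //; [exact: cut_ge0|exact: le_cut|].
  rewrite ler_nat; case Pi : (P i z) => //.
  suff -> : P j z by [].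
  apply: (le_trans Pi); apply: lee_wpmul2l; first by rewrite lee_fin.
  by apply: le_pot => // v; rewrite lee_fin; exact: le_cut.
- by move=> z; rewrite -EFinM lee_fin mulr_ge0 ?powR_ge0.
- move=> z; rewrite /= /h'; case Uz : (pot (EFin \o f) z < +oo); last first.
    by exists 0%N; rewrite mulr0 mule0 -EFinM lee_fin mulr_ge0 ?powR_ge0.
  have [m1 hm1] := cut_eventually x0 h z.
  have [m2 hm2] := pot_cut_eventually x0 mf f0 Uz.
  exists (maxn m1 m2); rewrite mulr1 -!EFinM lee_fin; apply: ler_wpM2l; first exact: powR_ge0.
  have -> : hm (maxn m1 m2) z = cut x0 (maxn m1 m2) h z.
    rewrite /hm; suff -> : P (maxn m1 m2) z by rewrite mulr1.
    apply: (le_trans hm2); apply: lee_wpmul2l; first by rewrite lee_fin.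
    apply: le_pot => v; first by rewrite lee_fin cut_ge0.
    rewrite lee_fin; apply: (le_cut x0 v f0); exact: leq_maxr.
  by rewrite -[leLHS]hm1; apply: le_cut => //; exact: leq_maxl.
- exact: tM.
Qed.

(** Pure scaling: g = h / (L e) with L = K^(1/q) normalizes the Choquet integral of [strong_type] to
    at most 1, and the energy becomes (L e)^(s - q) e^q = L^(s - q) e^s. *)
Lemma potential_weight : exists2 D : R, (0 < D)%R & forall (h : T -> R) (e : R),
  measurable_fun setT h -> (forall x, 0 <= h x)%R ->
  (forall x r, (0 < r)%R -> tpot r (EFin \o h) x < +oo) -> (0 < e)%R ->
  \int[mu]_x ((h x `^ s)%:E * epow (pot (EFin \o h) x) (q - s)) <= (e `^ q)%:E ->
  exists g : T -> R, [/\ measurable_fun setT g, (forall x, 0 <= g x)%R,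
    (forall x r, (0 < r)%R -> tpot r (EFin \o g) x < +oo),
    capint (fun x => pot (EFin \o g) x `^ q) <= 1 &
    \int[mu]_x ((h x `^ s)%:E * epow (pot (EFin \o g) x) (q - s)) <= ((D * e) `^ s)%:E].
Proof.
have [K K0 hK] := strong_type reg b_gt0 b_ltN dya q_ge1 q_lts.
pose L := (K `^ q^-1)%R; have L0 : (0 < L)%R by rewrite powR_gt0.
exists (L `^ ((s - q) / s))%R; first by rewrite powR_gt0.
move=> h e mh h0 fin e0 hI.
have l0 : (0 < L * e)%R by rewrite mulr_gt0.
pose l := ((L * e)^-1)%R; have l'0 : (0 < l)%R by rewrite invr_gt0.
pose g y := (l * h y)%R.
have g0 y : (0 <= g y)%R by rewrite mulr_ge0// ltW.
have mg : measurable_fun setT g by exact: measurable_funM.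
have meh : measurable_fun setT (EFin \o h) by exact/measurable_EFinP.
have eh0 y : 0 <= (EFin \o h) y by rewrite lee_fin.
have potg x : pot (EFin \o g) x = l%:E * pot (EFin \o h) x.
  rewrite -(intZ mu (ltW l'0)); first last.
  - by move=> y; rewrite mule_ge0 ?ker_ge0.
  - by apply: emeasurable_funM => //; exact: (measurable_kerx b reg).
  by apply: eq_integral => y _; rewrite /= EFinM muleCA.
have tpotg x r : tpot r (EFin \o g) x = l%:E * tpot r (EFin \o h) x.
  rewrite -(intZ mu (ltW l'0)); first last.
  - by move=> y; rewrite mule_ge0 ?lee_fin ?powR_ge0.
  - by apply: emeasurable_funM => //; exact: (measurable_tkerx b reg).
  by apply: eq_integral => y _; rewrite /= EFinM muleCA.
have gfin x r : (0 < r)%R -> tpot r (EFin \o g) x < +oo.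
  by move=> r0; rewrite tpotg; apply: (lty_mulEFin (ltW l'0)); exact: fin.
have mU := measurable_pot b reg meh eh0.
pose J y := (h y `^ s)%:E * epow (pot (EFin \o h) y) (q - s).
have J0 y : 0 <= J y by rewrite mule_ge0 ?epow_ge0 ?lee_fin ?powR_ge0.
have mJ : measurable_fun setT J.
  apply: emeasurable_funM; last exact: (measurableT_comp (measurable_epow _) mU).
  by apply/measurable_EFinP; exact: (measurableT_comp (measurable_powR s) mh).
have lE x : epow (pot (EFin \o g) x) (q - s) =
    (l `^ (q - s))%:E * epow (pot (EFin \o h) x) (q - s).
  by rewrite potg epowM//; exact: pot_ge0.
have IJ (z : R) : (0 <= z)%R -> \int[mu]_x (z%:E * J x) <= (z * e `^ q)%:E.
  move=> z0; rewrite intZ// EFinM; have z0' : 0 <= z%:E by rewrite lee_fin.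
  exact: (lee_wpmul2l z0' hI).
exists g; split => //.
  apply: le_trans (hK g mg g0 gfin) _.
  have -> : \int[mu]_x ((g x `^ s)%:E * epow (pot (EFin \o g) x) (q - s)) =
      \int[mu]_x ((l `^ q)%:E * J x).
    apply: eq_integral => x _; rewrite lE /J muleA -EFinM muleA -EFinM.
    congr (_%:E * _); rewrite /g (powRM s (ltW l'0) (h0 x)) mulrAC -(powRD0 _ _ l'0).
    by congr (l `^ _ * _)%R; ring.
  have K0' : 0 <= K%:E by rewrite lee_fin ltW.
  apply: (le_trans (lee_wpmul2l K0' (IJ _ (powR_ge0 l q)))).
  rewrite -EFinM lee_fin le_eqVlt; apply/orP; left; apply/eqP.
  rewrite -(powRM q (ltW l'0) (ltW e0)) /l invfM -mulrA mulVf ?mulr1 ?gt_eqF//.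
  rewrite /L -(powR_inv1 (powR_ge0 K q^-1)) -!powRrM.
  rewrite (_ : q^-1 * (-1 * q) = -1)%R; last by field; rewrite gt_eqF.
  by rewrite powR_inv1 ?(ltW K0)// mulfV// gt_eqF.
under eq_integral => x _ do rewrite lE muleCA -/(J x).
apply: (le_trans (IJ _ (powR_ge0 _ _))).
rewrite lee_fin le_eqVlt; apply/orP; left; apply/eqP.
rewrite (powRM s (powR_ge0 _ _) (ltW e0)) -powRrM divfK ?gt_eqF//.
rewrite /l -powR_inv1 ?(ltW l0)// -powRrM (_ : -1 * (q - s) = s - q)%R; last by ring.
rewrite (powRM _ (ltW L0) (ltW e0)) -mulrA -(powRD0 _ _ e0).
by congr (_ * e `^ _)%R; ring.
Qed.

Lemma weight_potential : exists2 D : R, (0 < D)%R & forall (w : T -> \bar R),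
  (forall x, 0 <= w x) -> capint (fun x => w x `^ q) <= 1 ->
  forall (f : T -> R) (e : R), measurable_fun setT f -> (forall x, 0 <= f x)%R ->
  (0 < e)%R -> \int[mu]_x ((f x `^ s)%:E * epow (w x) (q - s)) <= (e `^ s)%:E ->
  exists h : T -> R, [/\ measurable_fun setT h, (forall x, 0 <= h x)%R,
    (forall x, f x <= h x)%R,
    (forall x r, (0 < r)%R -> tpot r (EFin \o h) x < +oo) &
    \int[mu]_x ((h x `^ s)%:E * epow (pot (EFin \o h) x) (q - s)) <= ((D * e) `^ q)%:E].
Proof.
have [D D0 hD] := pot_iter_fun.
(* 7 = 1 + 6: f contributes e^s, and e g contributes the bound 6 of [pot_majorant] times e^s. The
   potential of h is at least e D U^p, which gives the factor (e D)^(q - s). *)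
exists ((7 * D `^ (q - s)) `^ q^-1)%R; first by rewrite powR_gt0// mulr_gt0// powR_gt0.
move=> w w0 wq f e mf f0 e0 fI.
have [phi [mphi phi0 phis phiw]] := pot_majorant reg q_ge1 q_lts wq.
have phis' : \int[mu]_x (phi x `^ s)%:E < +oo by apply: (le_lt_trans phis); exact: ltry.
have phifin := tpot_Lp_fin mphi phi0 phis'.
have mephi : measurable_fun setT (EFin \o phi) by exact/measurable_EFinP.
have ephi0 y : 0 <= (EFin \o phi) y by rewrite lee_fin.
have mU := measurable_pot b reg mephi ephi0.
pose U := pot (EFin \o phi).
have U0 y : 0 <= U y by exact: pot_ge0.
have Up0 y : 0 <= U y `^ p by exact: poweR_ge0.
pose W y := epow (U y `^ p) (q - s).
have W0 y : 0 <= W y by exact: epow_ge0.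
have mW : measurable_fun setT W.
  exact: (measurableT_comp (measurable_epow _) (measurableT_comp (measurable_poweR p) mU)).
(* [pot_majorant] is applied to w^q, so U >= w^(q/s); raising to the power p = s / q isolates w. *)
have wU y : w y <= U y `^ p.
  have := phiw y (poweR_ge0 _ _); rewrite -poweRrM => h1.
  have h2 : 0 <= w y `^ (q * s^-1) by exact: poweR_ge0.
  have := le_poweR (ltW p0) h2 h1; rewrite -poweRrM -/(U y) => /le_trans h3.
  apply: le_trans (h3 _ (lexx _)); rewrite (_ : q * s^-1 * p = 1)%R.
    by rewrite poweRe1.
  by rewrite /p; field; rewrite !gt_eqF.
have fW : \int[mu]_x ((f x `^ s)%:E * W x) <= (e `^ s)%:E.
  apply: le_trans fI; apply: leI => y.
    by rewrite mule_ge0 ?lee_fin ?powR_ge0.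
  apply: lee_wpmul2l; first by rewrite lee_fin powR_ge0.
  exact: le_epow.
pose g := iter_fun phi.
have g0 y : (0 <= g y)%R by exact: iter_fun_ge0.
have mg : measurable_fun setT g by exact: measurable_iter_fun.
pose h y := Num.max (f y) (e * g y)%R.
have h0 y : (0 <= h y)%R by rewrite le_max f0.
have mh : measurable_fun setT h.
  by apply: measurable_maxr => //; exact: measurable_funM.
pose X y := (f y `^ s)%:E * W y + (e `^ s)%:E * (phi y `^ s)%:E.
have fW0 y : 0 <= (f y `^ s)%:E * W y by rewrite mule_ge0 ?lee_fin ?powR_ge0.
have phis0 y : 0 <= (phi y `^ s)%:E by rewrite lee_fin powR_ge0.
have es0 : (0 <= e `^ s)%R by exact: powR_ge0.
have es0' : 0 <= (e `^ s)%:E by rewrite lee_fin.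
have mfW : measurable_fun setT (fun y => (f y `^ s)%:E * W y).
  apply: emeasurable_funM => //; apply/measurable_EFinP.
  exact: (measurableT_comp (measurable_powR s) mf).
have mphis : measurable_fun setT (fun y => (phi y `^ s)%:E).
  by apply/measurable_EFinP; exact: (measurableT_comp (measurable_powR s) mphi).
have X0 y : 0 <= X y by rewrite /X adde_ge0// mule_ge0.
have mX : measurable_fun setT X.
  by apply: emeasurable_funD => //; exact: measurable_funeM.
have IX : \int[mu]_y X y <= (7 * e `^ s)%:E.
  rewrite /X intD//; first last.
  - by move=> y; rewrite mule_ge0.
  - exact: measurable_funeM.
  rewrite intZ//; apply: le_trans (leeD fW (lee_wpmul2l es0' phis)) _.
  by rewrite -EFinM -EFinD lee_fin; lra.
have hX y : (h y `^ s)%:E * W y <= X y.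
  have X2 : 0 <= (e `^ s)%:E * (phi y `^ s)%:E by rewrite mule_ge0.
  rewrite /X /h; have [fg|gf] := leP (f y) (e * g y)%R; last exact: leeDl.
  apply: (le_trans _ (leeDr _ (fW0 y))); rewrite (powRM s (ltW e0) (g0 y)) EFinM -muleA.
  by apply: lee_wpmul2l => //; exact: iter_fun_weight.
have hfin : forall x r, (0 < r)%R -> tpot r (EFin \o h) x < +oo.
  apply: (finite_weighted mphi phi0 mh h0 phis').
  apply: (@le_lt_trans _ _ (7 * e `^ s)%:E); last exact: ltry.
  apply: le_trans IX; apply: leI => // y.
  by apply: mule_ge0 (W0 y); rewrite lee_fin powR_ge0.
exists h; split => //; first by move=> y; rewrite le_max lexx.
have eD0 : (0 < e * D)%R by rewrite mulr_gt0.
have lpot y : (e * D)%:E * U y `^ p <= pot (EFin \o h) y.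
  have h1 := hD phi y mphi phi0 phifin.
  have e0' : 0 <= e%:E by rewrite lee_fin ltW.
  rewrite EFinM -muleA; apply: (le_trans (lee_wpmul2l e0' h1)).
  rewrite -(intZ mu (ltW e0)); first last.
  - by move=> z; rewrite mule_ge0 ?ker_ge0 ?lee_fin.
  - apply: emeasurable_funM; first exact: (measurable_kerx b reg).
    exact/measurable_EFinP.
  apply: leI => z; first by rewrite !mule_ge0 ?ker_ge0 ?lee_fin.
  rewrite muleCA; apply: lee_wpmul2l; first exact: ker_ge0.
  by rewrite -EFinM lee_fin le_max lexx orbT.
have z0 : (0 <= (e * D) `^ (q - s))%R by exact: powR_ge0.
have z0' : 0 <= ((e * D) `^ (q - s))%:E by rewrite lee_fin.
apply: (@le_trans _ _ (((e * D) `^ (q - s))%:E * (7 * e `^ s)%:E)).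
  apply: le_trans (lee_wpmul2l z0' IX); rewrite -intZ//.
  apply: leI => y; first by rewrite mule_ge0 ?epow_ge0 ?lee_fin ?powR_ge0.
  apply: le_trans (lee_wpmul2l z0' (hX y)); rewrite muleCA.
  apply: lee_wpmul2l; first by rewrite lee_fin powR_ge0.
  have eDU : 0 <= (e * D)%:E * U y `^ p by rewrite mule_ge0// lee_fin ltW.
  by apply: le_trans (le_epow qs0 eDU (lpot y)) _; rewrite epowM.
rewrite -EFinM lee_fin le_eqVlt; apply/orP; left; apply/eqP.
rewrite [RHS](powRM q (powR_ge0 _ _) (ltW e0)) -powRrM mulVf ?gt_eqF// powRr1; last first.
  by rewrite mulr_ge0 ?powR_ge0.
rewrite (powRM (q - s) (ltW e0) (ltW D0)).
have -> : (e `^ q = e `^ (q - s) * e `^ s)%R by rewrite -(powRD0 _ _ e0) subrK.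
by ring.
Qed.

End duality.

(** * Lebesgue measure on R^n *)

Section slicing.
Context {R : realType}.
Local Open Scope ereal_scope.

Lemma int_itvoc (k a b : R) : (0 <= k)%R ->
  \int[@lebesgue_measure R]_t (k * (a < t <= b)%R%:R)%:E = (k * Num.max 0 (b - a))%:E.
Proof.
move=> k0.
have mP : measurable_fun setT (fun t : R => (a < t <= b)%R).
  by apply: measurable_and; [exact: measurable_fun_ltr|exact: measurable_fun_ler].
under eq_integral do rewrite EFinM -/(ind _).
rewrite intZ; first last.
- by move=> t; exact: ind_ge0.
- exact: measurable_ind.
- exact: k0.
rewrite (@int_indE _ _ R lebesgue_measure _ mP) EFinM.
congr (_ * _); rewrite (_ : [set t | _] = `]a, b]%classic :> set R); last first.
  by apply/seteqP; split => t /=; rewrite in_itv.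
apply: etrans (lebesgue_measure_itv `]a, b]) _.
rewrite /= lte_fin; case: ltP => ab.
  by congr _%:E; apply/esym/max_idPr; rewrite subr_ge0 ltW.
by congr _%:E; apply/esym/max_idPl; rewrite subr_le0.
Qed.

(* Integrating the inequality between indicators in the last coordinate
   removes that coordinate. *)
Lemma slicing n (c0 : R) (c : nat -> R) (a b : nat -> R) (A B : nat -> nat -> R) :
  (0 <= c0)%R -> (forall k, 0 <= c k)%R ->
  (forall x : nat -> R, (c0 * \prod_(i < n) (a i < x i <= b i)%R%:R)%:E <=
     \sum_(k <oo) (c k * \prod_(i < n) (A k i < x i <= B k i)%R%:R)%:E) ->
  (c0 * \prod_(i < n) Num.max 0 (b i - a i))%:E <=
    \sum_(k <oo) (c k * \prod_(i < n) Num.max 0 (B k i - A k i))%:E.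
Proof.
have max0 (z : R) : (0 <= Num.max 0 z)%R by rewrite le_max lexx.
elim: n c0 c => [|n IH] c0 c c00 ck0 h.
  have := h (fun=> 0%R); rewrite !big_ord0 => h'; apply: (le_trans h').
  by apply: lee_nneseries => [k _ _|k _]; rewrite !big_ord0 ?mulr1 ?lee_fin.
rewrite big_ord_recr/= [X in (_ * X)%R]mulrC mulrA.
rewrite (eq_eseriesr (g := fun k => ((c k * Num.max 0 (B k n - A k n)) *
   \prod_(i < n) Num.max 0 (B k i - A k i))%:E)); last first.
  by move=> k _; rewrite big_ord_recr/= [X in (_ * X)%R]mulrC mulrA.
apply: IH => [|k|x]; [exact: mulr_ge0|exact: mulr_ge0|].
have p0 (P : nat -> bool) : (0 <= \prod_(i < n) (P i)%:R :> R)%R by apply: prodr_ge0.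
rewrite mulrAC -int_itvoc; last by rewrite mulr_ge0// (p0 (fun i => a i < x i <= b i)%R).
have cp0 k : (0 <= c k * \prod_(i < n) (A k i < x i <= B k i)%R%:R)%R.
  by rewrite mulr_ge0// (p0 (fun i => A k i < x i <= B k i)%R).
rewrite (eq_eseriesr (g := fun k => \int[@lebesgue_measure R]_t
    (c k * \prod_(i < n) (A k i < x i <= B k i)%R%:R * (A k n < t <= B k n)%R%:R)%:E)); last first.
  by move=> k _; rewrite int_itvoc// mulrAC.
rewrite -integral_nneseries//; last 2 first.
- move=> k; apply/measurable_EFinP; apply: measurable_funM => //.
  apply: (@measurableT_comp _ _ _ _ _ _ (fun b : bool => b%:R : R)) => //.
  by apply: measurable_and; [exact: measurable_fun_ltr|exact: measurable_fun_ler].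
- by move=> k t _; rewrite lee_fin mulr_ge0.
apply: leI => t.
  by rewrite lee_fin !mulr_ge0// (p0 (fun i => a i < x i <= b i)%R).
have xE (a' b' : nat -> R) :
    (\prod_(i < n.+1) (a' i < (if i == n :> nat then t else x i) <= b' i)%R%:R =
    \prod_(i < n) (a' i < x i <= b' i)%R%:R * (a' n < t <= b' n)%R%:R :> R)%R.
  rewrite big_ord_recr/= eqxx; congr (_ * _)%R; apply: eq_bigr => i _.
  by rewrite (ltn_eqF (ltn_ord i)).
have := h (fun i => if i == n then t else x i); rewrite xE mulrA => /le_trans; apply.
apply: lee_nneseries => [k _ _|k _]; rewrite xE mulrA; last exact: lexx.
by rewrite lee_fin (mulr_ge0 (cp0 k)).
Qed.

End slicing.

Section lebesgue_Rn_theory.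
Context {R : realType} {n : nat}.
Local Open Scope ereal_scope.
Local Notation mu := (@lebesgue_Rn R n).

(** The box covers itself. Conversely, its indicator is at most the sum of the indicators of any
    cover, and [slicing] integrates this inequality one coordinate at a time. *)
Lemma lebesgue_box (a b : 'rV[R]_n) :
  mu (box (Some (a, b))) = (\prod_i Num.max 0 (b 0%R i - a 0%R i)%R)%:E.
Proof.
apply/eqP; rewrite eq_le; apply/andP; split.
  apply: ereal_inf_lbound; exists (fun k => if k == 0%N then Some (a, b) else None).
    by move=> x abx; exists 0%N.
  rewrite (@nneseriesD1 _ _ 0%N)//=; last by move=> k _; exact: box_volume_ge0.
  rewrite eseries0 ?adde0// => k _ /= /negPf ->; exact: erefl.
apply: le_ereal_inf_tmp => _ [B abB <-].
(* Vectors are extended by 0 to sequences, because [slicing] uses coordinates indexed by [nat] for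
   its induction on n. *)
pose ext (v : 'rV[R]_n) (i : nat) := if insub i is Some j then v 0%R j else 0%R : R.
have extE v (i : 'I_n) : ext v i = v 0%R i by rewrite /ext valK.
pose lo k := if B k is Some (u, v) then ext u else fun=> 0%R.
pose hi k := if B k is Some (u, v) then ext v else fun=> 0%R.
pose c k : R := (B k : bool)%:R.
have volE k : box_volume (B k) = (c k * \prod_(i < n) Num.max 0 (hi k i - lo k i)%R)%:E.
  rewrite /c /lo /hi; case: (B k) => [[u v]|] /=; last by rewrite mul0r.
  by congr _%:E; rewrite mul1r; apply: eq_bigr => i _; rewrite !extE.
rewrite (eq_eseriesr (fun k _ => volE k)).
rewrite (_ : (\prod_i _)%R = (1 * \prod_(i < n) Num.max 0 (ext b i - ext a i))%R); last first.
  by rewrite mul1r; apply: eq_bigr => i _; rewrite !extE.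
apply: slicing => // x; rewrite mul1r.
have t0 k : 0 <= (c k * \prod_(i < n) (lo k i < x i <= hi k i)%R%:R)%:E.
  by rewrite lee_fin mulr_ge0// prodr_ge0.
have bE (u v : 'rV[R]_n) : (\prod_(i < n) (ext u i < x i <= ext v i)%R%:R)%R =
    ((\row_i x i) \in box (Some (u, v)))%:R%R :> R.
  have [xB|xB] := boolP (_ \in _).
    rewrite big1// => i _; rewrite !extE; move: xB; rewrite inE /= => /(_ i).
    by rewrite mxE => ->.
  apply/eqP; move: xB; apply: contraR => /prodf_neq0 h.
  rewrite inE /= => i; rewrite mxE; have := h i isT; rewrite !extE.
  by case: (_ && _) => //; rewrite eqxx.
rewrite bE; have [xab|_] := boolP (_ \in _); last exact: nneseries_ge0.
have [k _ xk] := abB _ (set_mem xab).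
apply: le_trans (esum_ge k t0).
rewrite lee_fin /c /lo /hi; move: xk; case: (B k) => [[u v]|] // xk.
by rewrite bE mem_set// mul1r.
Qed.

Definition half_space (i : 'I_n) (z : R) : set (Rn R n) := [set x : 'rV[R]_n | (x 0%R i <= z)%R].

(** The hyperplane cuts each box of a cover into two half-open boxes whose volumes add up exactly;
    this is the Caratheodory condition. *)
Lemma measurable_half_space i z : measurable (half_space i z).
Proof.
apply: le_caratheodory_measurable => X.
apply: le_ereal_inf_tmp => _ [B XB <-].
pose lo (B : option ('rV[R]_n * 'rV[R]_n)) := if B is Some (u, v) then
  Some (u, \row_j (if j == i then Num.min (v 0%R j) z else v 0%R j)) else None.
pose hi (B : option ('rV[R]_n * 'rV[R]_n)) := if B is Some (u, v) then
  Some (\row_j (if j == i then Num.max (u 0%R j) z else u 0%R j), v) else None.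
have volE k : box_volume (B k) = box_volume (lo (B k)) + box_volume (hi (B k)).
  case: (B k) => [[u v]|] /=; last by rewrite adde0.
  rewrite -EFinD; congr _%:E.
  rewrite (bigD1 i) //= [X in _ = (X + _)%R](bigD1 i) //= [X in _ = (_ + X)%R](bigD1 i) //= !mxE eqxx.
  rewrite [X in (_ + _ * X)%R](eq_bigr (fun j => Num.max 0 (v 0%R j - u 0%R j))%R); last first.
    by move=> j /negPf ji; rewrite !mxE ji.
  rewrite [X in (_ * X + _)%R](eq_bigr (fun j => Num.max 0 (v 0%R j - u 0%R j))%R); last first.
    by move=> j /negPf ji; rewrite !mxE ji.
  rewrite -mulrDl; congr (_ * _)%R.
  by rewrite /Num.max /Num.min; do !case: ifPn; rewrite -?leNgt => *; lra.
rewrite (eq_eseriesr (fun k _ => volE k)) nneseriesD; first last.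
- by move=> k _ _; exact: box_volume_ge0.
- by move=> k _ _; exact: box_volume_ge0.
apply: leeD; apply: ereal_inf_lbound.
  exists (fun k => lo (B k)) => // x [Xx xz]; have [k _ xk] := XB x Xx; exists k => //.
  move: xk; case: (B k) => [[u v]|] //= xk j; rewrite mxE.
  by case: eqP => [->|_]; rewrite ?le_min ?andbA ?xk.
exists (fun k => hi (B k)) => // x [Xx /negP]; rewrite -ltNge => xz.
have [k _ xk] := XB x Xx; exists k => //.
move: xk; case: (B k) => [[u v]|] //= xk j; rewrite mxE.
by case: eqP => [->|_]; rewrite ?gt_max ?xz ?andbT ?xk.
Qed.

Lemma measurable_coord (i : 'I_n) : measurable_fun setT (fun x : Rn R n => (x : 'rV[R]_n) 0%R i).
Proof.
apply: (measurability _ (RGenOInfty.measurableE R)) => _ [_ [z ->] <-].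
rewrite setTI (_ : _ @^-1` _ = ~` half_space i z); last first.
  apply/seteqP; split => x /=; rewrite in_itv/= andbT /half_space/= ltNge.
    by move/negP.
  by move=> h; apply/negP.
by apply: measurableC; exact: measurable_half_space.
Qed.

Lemma measurable_box (B : option ('rV[R]_n * 'rV[R]_n)) : measurable (box B : set (Rn R n)).
Proof.
case: B => [[a b]|]; last exact: measurable0.
rewrite (_ : box _ = \bigcap_(i in [set: 'I_n]) (~` half_space i (a 0%R i) `&` half_space i (b 0%R i))).
  apply: fin_bigcap_measurable; first exact: finite_finset.
  move=> i _; apply: measurableI; last exact: measurable_half_space.
  by apply: measurableC; exact: measurable_half_space.
apply/seteqP; split => [x /= h i _|x /= h i].
  have /andP[h1 h2] := h i.
  by split=> //=; apply/negP; rewrite -ltNge.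
by have [/negP h1 h2] := h i I; rewrite ltNge h1.
Qed.

Lemma sigma_finite_lebesgue_Rn : sigma_finite setT mu.
Proof.
pose F (k : nat) := box (Some (\row__ - (k%:R : R), \row__ (k%:R : R)))%R : set (Rn R n).
exists F; last first.
  move=> k; split; first exact: measurable_box.
  by apply: le_lt_trans (ltry _); rewrite lebesgue_box; exact: lexx.
apply/seteqP; split => // x _.
have [k hk] := ex_dyadic_ge (\sum_i `|(x : 'rV[R]_n) 0%R i| + 1)%R.
exists (2 ^ k)%N => // i; rewrite !mxE.
have : (`|(x : 'rV[R]_n) 0%R i| < 2 ^+ k)%R.
  apply: lt_le_trans hk; rewrite ltr_pwDr// (bigD1 i)//= lerDl.
  by apply: sumr_ge0.
by rewrite natrX ltr_norml => /andP[-> /ltW ->].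
Qed.

End lebesgue_Rn_theory.

HB.instance Definition _ (R : realType) (n : nat) :=
  Measure_isSigmaFinite.Build _ (Rn R n) R (@lebesgue_Rn R n) sigma_finite_lebesgue_Rn.

(** * Regularity of Euclidean balls *)

Section euclidean.
Context {R : realType} {n : nat}.
Implicit Types x y z : 'rV[R]_n.

Lemma enorm_ge0 x : 0 <= enorm x.
Proof. exact: sqrtr_ge0. Qed.

Lemma enorm_sqr x : enorm x ^+ 2 = \sum_i x 0 i ^+ 2.
Proof. by rewrite sqr_sqrtr// sumr_ge0// => i _; rewrite sqr_ge0. Qed.

Lemma enorm_le x (t : R) : 0 <= t -> \sum_i x 0 i ^+ 2 <= t ^+ 2 -> enorm x <= t.
Proof. by move=> t0 h; rewrite -(ger0_norm t0) -sqrtr_sqr ler_sqrt// sqr_ge0. Qed.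

Lemma coord_le_enorm x i : `|x 0 i| <= enorm x.
Proof.
rewrite -sqrtr_sqr ler_sqrt; last by rewrite sumr_ge0// => j _; rewrite sqr_ge0.
by rewrite (bigD1 i)//= lerDl sumr_ge0// => j _; rewrite sqr_ge0.
Qed.

Lemma enorm_le_coord x (t : R) : 0 <= t -> (forall i, `|x 0 i| <= t) ->
  enorm x <= n%:R * t.
Proof.
move=> t0 h; apply: enorm_le; first exact: mulr_ge0.
apply: (@le_trans _ _ (\sum_(i < n) t ^+ 2)).
  apply: ler_sum => i _; rewrite -[leLHS]ger0_norm ?sqr_ge0// normrX.
  by apply: lerXn2r; rewrite ?nnegrE.
rewrite sumr_const card_ord -[leLHS]mulr_natl exprMn; apply: ler_wpM2r; first exact: sqr_ge0.
by rewrite -natrX ler_nat; case: (n) => // m; rewrite -mulnn leq_pmulr.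
Qed.

Lemma enorm_sub_sym x y : enorm (x - y) = enorm (y - x).
Proof. by congr Num.sqrt; apply: eq_bigr => i _; rewrite !mxE -sqrrN opprB. Qed.

(** From (a + b)^2 <= 2 a^2 + 2 b^2 in each coordinate. *)
Lemma enorm_sub_le x y z : enorm (x - z) <= 2 * Num.max (enorm (x - y)) (enorm (y - z)).
Proof.
set m := Num.max _ _; have m0 : 0 <= m by rewrite le_max enorm_ge0.
apply: enorm_le; first exact: mulr_ge0.
apply: (@le_trans _ _ (\sum_i (2 * (x - y) 0 i ^+ 2 + 2 * (y - z) 0 i ^+ 2))).
  apply: ler_sum => i _; rewrite !mxE -subr_ge0.
  rewrite (_ : _ - _ = (x 0 i - 2 * y 0 i + z 0 i) ^+ 2); first exact: sqr_ge0.
  by ring.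
rewrite big_split/= -!mulr_sumr -!enorm_sqr.
have h1 : enorm (x - y) ^+ 2 <= m ^+ 2.
  by apply: lerXn2r; rewrite ?nnegrE ?enorm_ge0// le_max lexx.
have h2 : enorm (y - z) ^+ 2 <= m ^+ 2.
  by apply: lerXn2r; rewrite ?nnegrE ?enorm_ge0// le_max lexx orbT.
by rewrite exprMn; lra.
Qed.

Lemma measurable_enorm_sub :
  measurable_fun setT (fun p : Rn R n * Rn R n => enorm (p.1 - p.2 : 'rV[R]_n)).
Proof.
rewrite (_ : (fun _ => _) = (fun p : Rn R n * Rn R n =>
    (\sum_(i < n) ((p.1 : 'rV[R]_n) 0 i - (p.2 : 'rV[R]_n) 0 i) ^+ 2) `^ 2^-1)); last first.
  apply/funext => p; rewrite powR12_sqrt; last by rewrite sumr_ge0// => i _; rewrite sqr_ge0.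
  by congr Num.sqrt; apply: eq_bigr => i _; rewrite !mxE.
apply: (measurableT_comp (measurable_powR _)); apply: measurable_sum => i.
apply: measurable_funX; apply: measurable_funB.
  exact: (measurableT_comp (measurable_coord i) measurable_fst).
exact: (measurableT_comp (measurable_coord i) measurable_snd).
Qed.

Lemma lebesgue_cube (a : 'rV[R]_n) (t u : R) : 0 <= t + u ->
  lebesgue_Rn (box (Some (\row_i (a 0 i - t), \row_i (a 0 i + u)))) = ((t + u) ^+ n)%:E.
Proof.
move=> tu; rewrite lebesgue_box; congr _%:E.
rewrite (eq_bigr (fun=> t + u)) ?prodr_const ?card_ord// => i _.
rewrite !mxE (_ : _ - _ = t + u); last by ring.
exact/max_idPr.
Qed.

(** The ball contains a cube of half side r / (g n) and lies in one of half side 2 r / g; the extra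
    factor 2 leaves room for the missing faces of half-open boxes. *)
Lemma regular_Rn (g : R) : (0 < n)%N -> 0 < g ->
  regular_space lebesgue_Rn (fun x y : Rn R n => g * enorm (x - y : 'rV[R]_n)) n%:R
    ((2 / (g * n%:R)) ^+ n) ((4 / g) ^+ n).
Proof.
move=> n0 g0; have nr0 : 0 < n%:R :> R by rewrite ltr0n.
split.
- by move=> x y; rewrite mulr_ge0 ?enorm_ge0// ltW.
- move=> x; apply/eqP; rewrite mulf_eq0; apply/orP; right.
  by rewrite subrr /enorm big1 ?sqrtr0// => i _; rewrite mxE expr0n.
- by move=> x y; rewrite enorm_sub_sym.
- move=> x y z; have h := enorm_sub_le x y z.
  rewrite -maxr_pMr ?(ltW g0)// mulrCA ler_pM2l//; apply: (le_trans h).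
  by rewrite ler_wpM2r ?ler_nat// le_max enorm_ge0.
- by apply: measurable_funM => //; exact: measurable_enorm_sub.
- exact: nr0.
- by rewrite exprn_gt0// divr_gt0// mulr_gt0.
- by rewrite exprn_gt0// divr_gt0.
- move=> x r r0; rewrite powR_mulrn ?(ltW r0)// -exprMn.
  pose t := r / (g * n%:R); have t0 : 0 < t by rewrite divr_gt0// mulr_gt0.
  have -> : 2 / (g * n%:R) * r = t + t by rewrite /t; field; rewrite !gt_eqF.
  rewrite -(lebesgue_cube x); last by rewrite addr_ge0// ltW.
  apply: lebesgue_outer_le => y /= h.
  have : enorm (x - y : 'rV[R]_n) <= n%:R * t.
    apply: enorm_le_coord => [|i]; first exact: ltW.
    by have := h i; rewrite !mxE ler_norml => /andP[h1 h2]; apply/andP; split; lra.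
  move=> /(ler_wpM2l (ltW g0))/le_trans; apply.
  by rewrite /t le_eqVlt; apply/orP; left; apply/eqP; field; rewrite !gt_eqF.
- move=> x r r0; rewrite powR_mulrn ?(ltW r0)// -exprMn.
  pose t := 2 * r / g; have t0 : 0 < t by rewrite divr_gt0// mulr_gt0.
  have -> : 4 / g * r = t + t by rewrite /t; field; rewrite !gt_eqF.
  rewrite -(lebesgue_cube x); last by rewrite addr_ge0// ltW.
  apply: lebesgue_outer_le => y /= h i; rewrite !mxE.
  have := coord_le_enorm (x - y : 'rV[R]_n) i; rewrite !mxE => h1.
  have h2 : enorm (x - y : 'rV[R]_n) < t.
    have h3 : enorm (x - y : 'rV[R]_n) <= r / g by rewrite ler_pdivlMr// mulrC.
    apply: (le_lt_trans h3); rewrite /t -mulrA ltr_pMl ?divr_gt0//.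
    by rewrite ltr1n.
  have := le_lt_trans h1 h2; rewrite ltr_norml => /andP[h3 h4].
  by apply/andP; split; lra.
Qed.

End euclidean.

(** * Shifted grids on the line *)

Section grids.
Context {R : realType}.
Implicit Types u v : R.

Lemma measurable_floor_int : measurable_fun setT (fun u : R => (Num.floor u)%:~R : R).
Proof.
apply: (measurability _ (RGenOInfty.measurableE R)) => _ [_ [z ->] <-].
rewrite setTI (_ : _ @^-1` _ = `[(Num.floor z + 1)%:~R, +oo[%classic); first exact: measurable_itv.
apply/seteqP; split => u /=; rewrite !in_itv/= !andbT.
  by move=> zu; rewrite -floor_ge_int lezD1 floor_lt_int.
by rewrite -floor_ge_int lezD1 floor_lt_int.
Qed.

(* Base 4 is used because 4 / 3 = 1 + 1 / 3: the grids shifted by [1 / 3] are nested too. *)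
Lemma floor_nest u v (a : bool) :
  Num.floor (4 * u + a%:R / 3) = Num.floor (4 * v + a%:R / 3) ->
  Num.floor (u + a%:R / 3) = Num.floor (v + a%:R / 3).
Proof.
move=> e; set m := Num.floor (4 * u + _) in e.
have /andP[u1 u2] := floor_itv (4 * u + a%:R / 3); rewrite -/m in u1 u2.
have /andP[v1 v2] := floor_itv (4 * v + a%:R / 3); rewrite -e in v1 v2.
set k := Num.floor (u + a%:R / 3).
have /andP[k1 k2] := floor_itv (u + a%:R / 3); rewrite -/k in k1 k2.
apply/esym/floor_def.
have km : 4 * k - (a : nat)%:Z <= m.
  by rewrite floor_ge_int !(rmorphB, rmorphM) /=; lra.
have mk : m < 4 * k + 4 - (a : nat)%:Z.
  by rewrite floor_lt_int !(rmorphB, rmorphD, rmorphM) /=; move: k2; rewrite rmorphD /=; lra.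
have km' : 4 * k%:~R - a%:R <= m%:~R :> R.
  by move: km; rewrite -(ler_int R) !(rmorphB, rmorphM).
have mk' : m%:~R + 1 <= 4 * k%:~R + 4 - a%:R :> R.
  by move: mk; rewrite -lezD1 -(ler_int R) !(rmorphB, rmorphD, rmorphM).
by apply/andP; split; move: v2; rewrite !rmorphD /=; lra.
Qed.

(** The one-third trick: if u is within 1/12 of an integer, the shift by 1/3 moves the interval of
    radius 1/12 away from the integers; otherwise the unshifted grid already works. *)
Lemma floor_shift u : exists a : bool, forall v, `|u - v| <= 12^-1 ->
  Num.floor (u + a%:R / 3) = Num.floor (v + a%:R / 3).
Proof.
have /andP[u1 u2] := floor_itv u; set m := Num.floor u in u1 u2.
rewrite rmorphD /= in u2.
have [h1|h1] := ltP u (m%:~R + 12^-1).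
  exists true => v; rewrite ler_norml => /andP[v1 v2].
  by rewrite (@floor_def _ _ m); [apply/esym/floor_def|]; rewrite rmorphD /=; apply/andP; split; lra.
have [h2|h2] := ltP u (m%:~R + 1 - 12^-1).
  exists false => v; rewrite ler_norml => /andP[v1 v2].
  by rewrite (@floor_def _ _ m); [apply/esym/floor_def|]; rewrite rmorphD /=; apply/andP; split; lra.
exists true => v; rewrite ler_norml => /andP[v1 v2].
by rewrite (@floor_def _ _ (m + 1)); [apply/esym/floor_def|]; rewrite !rmorphD /=; apply/andP; split; lra.
Qed.

Lemma ex_pow4 v : 0 < v -> exists i : int, v <= 4 ^ i < 4 * v.
Proof.
move=> v0; have [z /andP[]] := lev_cover v0; rewrite /lev; set e := zenum z => h1 h2.
(* The exponent e + 1 is rounded up to an even number 2i. *)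
have [i ie] : exists i : int, e + 1 = 2 * i \/ e + 1 = 2 * i - 1.
  by exists ((e + 2) %/ 2)%Z; lia.
exists i; have -> : 4 ^ i = 2 ^ (2 * i) :> R.
  by rewrite -exprz_exp; congr (_ ^ i); rewrite -exprnP expr2 -natrM.
have z0 : 0 < 2 ^ e :> R by rewrite exprz_gt0.
have [ei|ei] := ie.
  rewrite -ei expfzDr ?pnatr_eq0// expr1z.
  by apply/andP; split; lra.
rewrite (_ : 2 * i = e + 2); last by lia.
rewrite expfzDr ?pnatr_eq0// -[X in _ * X](_ : 4 = _); first by apply/andP; split; lra.
by rewrite -exprnP expr2 -natrM.
Qed.

End grids.

Section cells.
Context {R : realType} {n : nat}.
Local Notation vec := 'rV[R]_n.

(** Coordinates in the unit 4^i, shifted by 0 or 1/3. The 2^n choices of [a] give the grids, and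
    cells are cubes of side 4^i. *)
Definition cell_coord (a : {ffun 'I_n -> bool}) (i : int) (j : 'I_n) (x : Rn R n) : R :=
  4 ^ (- i) * (x : vec) 0 j + (a j)%:R / 3.

Definition cell (a : {ffun 'I_n -> bool}) (i : int) (x y : Rn R n) : bool :=
  [forall j, Num.floor (cell_coord a i j x) == Num.floor (cell_coord a i j y)].

Let p4 (i : int) : 0 < 4 ^ i :> R. Proof. by rewrite exprz_gt0. Qed.

Lemma measurable_cell a i :
  measurable_fun setT (fun p : Rn R n * Rn R n => cell a i p.1 p.2).
Proof.
pose F (j : 'I_n) (p : Rn R n * Rn R n) :=
  ((Num.floor (cell_coord a i j p.1))%:~R == (Num.floor (cell_coord a i j p.2))%:~R :> R).
have mF j : measurable_fun setT (F j).
  have mc : measurable_fun setT (cell_coord a i j).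
    apply: measurable_funD; last exact: measurable_cst.
    apply: measurable_funM; first exact: measurable_cst.
    exact: measurable_coord.
  have mfc := measurableT_comp (@measurable_floor_int R) mc.
  apply: measurable_fun_eqr.
    exact: (measurableT_comp mfc measurable_fst).
  exact: (measurableT_comp mfc measurable_snd).
apply: (@measurable_fun_bool _ _ _ _ true); rewrite setTI.
rewrite (_ : _ @^-1` _ = \bigcap_(j in [set: 'I_n]) (F j @^-1` [set true])).
  apply: fin_bigcap_measurable; first exact: finite_finset.
  by move=> j _; rewrite -[X in measurable X]setTI; exact: mF.
apply/seteqP; split => [p /forallP h j _|p h].
  by rewrite /= /F eqr_int; exact: h.
by apply/forallP => j; rewrite -(eqr_int R); exact: (h j I).
Qed.

Lemma cell_near a i x y j : cell a i x y -> `|(x : vec) 0 j - (y : vec) 0 j| <= 4 ^ i.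
Proof.
move=> /forallP /(_ j) /eqP e.
have /andP[x1 x2] := floor_itv (cell_coord a i j x).
have /andP[y1 y2] := floor_itv (cell_coord a i j y).
rewrite -e in y1 y2; rewrite rmorphD /= /cell_coord in x1 x2 y1 y2.
have h : `|4 ^ (- i) * ((x : vec) 0 j - (y : vec) 0 j)| <= 1.
  by rewrite mulrBr ler_norml; apply/andP; split; lra.
move: h; rewrite normrM (gtr0_norm (p4 _)) -invr_expz.
by rewrite ler_pdivrMl// mulr1.
Qed.

(* The lower half of the cell of [x] contains a half-open box. *)
Lemma cell_gt0 a i x : (0 < lebesgue_Rn [set y | cell a i x y])%E.
Proof.
pose lo : vec := \row_j (4 ^ i * ((Num.floor (cell_coord a i j x))%:~R - (a j)%:R / 3)).
have h0 : 0 <= 0 + 4 ^ i / 2 :> R by rewrite add0r divr_ge0// ltW.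
apply: (@lt_le_trans _ _ (lebesgue_Rn (box (Some (\row_j (lo 0 j - 0), \row_j (lo 0 j + 4 ^ i / 2)))))).
  by rewrite lebesgue_cube// lte_fin exprn_gt0// add0r divr_gt0.
apply: lebesgue_outer_le => y /= h; apply/forallP => j; apply/eqP/esym/floor_def.
have := h j; rewrite !mxE subr0 => /andP[/ltW h1 h2].
rewrite rmorphD /=; set m := (Num.floor _)%:~R in h1 h2 *.
rewrite /cell_coord -invr_expz.
have h3 : m - (a j)%:R / 3 <= (4 ^ i)^-1 * (y : vec) 0 j by rewrite ler_pdivlMl.
have h4 : (4 ^ i)^-1 * (y : vec) 0 j <= m - (a j)%:R / 3 + 2^-1.
  by rewrite ler_pdivrMl// mulrDr.
by apply/andP; split; lra.
Qed.

(** For a ball of radius r the scale is chosen with 12 r / g <= 4^i < 48 r / g, and [floor_shift]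
    selects the shift in each coordinate independently. A cube of side 4^i has diameter at most n
    4^i, hence 48 n. *)
Lemma dyadic_Rn (g : R) : (0 < n)%N -> 0 < g ->
  dyadic_system lebesgue_Rn (fun x y : Rn R n => g * enorm (x - y : 'rV[R]_n))
    cell (fun i => g * (n%:R * 4 ^ i)) (48 * n%:R).
Proof.
move=> n0 g0; have nr0 : 0 < n%:R :> R by rewrite ltr0n.
split.
- exact: measurable_cell.
- by move=> a i x y; apply: eq_forallb => j; rewrite eq_sym.
- move=> a i x y z /forallP h1 /forallP h2; apply/forallP => j.
  by rewrite (eqP (h1 j)).
- move=> a i x y /forallP h; apply/forallP => j; apply/eqP.
  apply: floor_nest; have /eqP := h j; rewrite /cell_coord.
  suff e (z : R) : 4 * (4 ^ (- (i + 1)) * z) = 4 ^ (- i) * z by rewrite !e.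
  by rewrite mulrA opprD expfzDr ?pnatr_eq0// exprN1 mulrCA mulfV ?mulr1// pnatr_eq0.
- by move=> i; rewrite !mulr_gt0.
- by rewrite mulr_gt0.
- exact: cell_gt0.
- move=> a i x y h; rewrite ler_pM2l//; apply: enorm_le_coord => [|j].
    exact: ltW.
  by have := cell_near j h; rewrite !mxE.
- move=> x r r0.
  have r'0 : 0 < 12 * (r / g) by rewrite mulr_gt0// divr_gt0.
  have [i /andP[i1 i2]] := ex_pow4 r'0.
  have hb (j : 'I_n) := floor_shift (4 ^ (- i) * (x : vec) 0 j).
  have [b hb'] := choice hb.
  exists [ffun j => b j], i; split.
    apply: (@le_trans _ _ (g * (n%:R * (4 * (12 * (r / g)))))).
      by rewrite !ler_pM2l// ltW.
    by rewrite le_eqVlt; apply/orP; left; apply/eqP; field; rewrite gt_eqF.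
  move=> y xy; apply/forallP => j; apply/eqP; rewrite /cell_coord ffunE.
  apply: hb'; rewrite -mulrBr normrM (gtr0_norm (p4 _)) -invr_expz ler_pdivrMl//.
  have := coord_le_enorm (x - y : vec) j; rewrite !mxE => /le_trans; apply.
  apply: (@le_trans _ _ (r / g)); first by rewrite ler_pdivlMr// mulrC.
  lra.
Qed.

End cells.

(** * Riesz potentials on R^n *)

Section Gamma_function.
Context {R : realType}.
Local Open Scope ereal_scope.

Lemma lebesgue_ball (r : R) : (0 < r)%R ->
  (@lebesgue_measure R) [set t : R | (`|t| <= r)%R] <= (2 * r `^ 1)%:E.
Proof.
move=> r0; rewrite powRr1 ?(ltW r0)// (_ : [set t | _] = `[(- r)%R, r]%classic); last first.
  by apply/seteqP; split => t /=; rewrite in_itv/= ler_norml.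
rewrite lebesgue_measure_itv/= lte_fin; case: ltP => _.
  by rewrite -EFinB lee_fin; lra.
by rewrite lee_fin; lra.
Qed.

(** For an integer m >= p, exp t is the m-th power of exp (t / m), which is at least t / m. *)
Lemma powR_le_expR (p : R) : exists2 K : R, (0 < K)%R & forall t : R,
  (1 <= t)%R -> (t `^ p <= K * expR t)%R.
Proof.
have [m0 hm] := ex_dyadic_ge p; pose m := (2 ^ m0)%N.
have pm : (p <= m%:R)%R by rewrite natrX.
have m_gt0 : (0 < m)%N by rewrite expn_gt0.
have mr0 : (0 < m%:R :> R)%R by rewrite ltr0n.
exists (m%:R ^+ m)%R; first exact: exprn_gt0.
move=> t t1; have t0 : (0 < t)%R := lt_le_trans ltr01 t1.
apply: (@le_trans _ _ (t `^ m%:R)%R).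
  by rewrite ler_powR.
rewrite powR_mulrn ?(ltW t0)//.
have -> : (expR t = expR (t / m%:R) ^+ m)%R.
  by rewrite -expRM_natl mulrC divfK// gt_eqF.
rewrite -exprMn; apply: lerXn2r; rewrite ?nnegrE ?(ltW t0) ?mulr_ge0 ?expR_ge0//.
have h := expR_ge1Dx (t / m%:R).
apply: (@le_trans _ _ (m%:R * (1 + t / m%:R))%R); last by rewrite ler_pM2l.
by rewrite mulrDr mulrCA mulfV ?gt_eqF// !mulr1 lerDr ler0n.
Qed.

(** [Gamma] is the [fine] part of an integral, so its positivity includes finiteness of the
    integral. The integrand is dominated by t^(-g) with g < 1 up to 1 and by a multiple of t^(-2)
    beyond. *)
Lemma Gamma_gt0 (a : R) : (0 < a)%R -> (0 < Gamma a)%R.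
Proof.
move=> a0; rewrite /Gamma /Rintegral.
pose F (t : R) : \bar R := (t `^ (a - 1) * expR (- t))%:E.
have F0 t : 0 <= F t by rewrite lee_fin mulr_ge0 ?powR_ge0 ?expR_ge0.
have -> : \int[lebesgue_measure]_(t in `]0%R, +oo[) (t `^ (a - 1) * expR (- t))%:E =
    \int[lebesgue_measure]_t (ind (0 < t)%R * F t).
  rewrite (@int_ind _ _ R lebesgue_measure (fun t : R => 0 < t)%R).
  congr (integral _ _ _).
  by apply/seteqP; split => t /=; rewrite in_itv/= andbT.
have mnorm : measurable_fun setT (fun t : measurableTypeR R => `|t : R|%R) by exact: normr_measurable.
apply: fine_gt0; apply/andP; split.
  (* A lower bound for the integrand on ]1, 2[; the minimum covers both signs of a - 1. *)
  pose k := (Num.min 1 (2 `^ (a - 1)) * expR (- 2))%R.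
  have k0 : (0 < k)%R by rewrite mulr_gt0 ?expR_gt0// lt_min ltr01 powR_gt0.
  apply: (@lt_le_trans _ _ (\int[lebesgue_measure]_t (k%:E * ind ((1 < t) && (t < 2))%R))).
    rewrite intZ; first last.
    - by move=> t; exact: ind_ge0.
    - by apply: measurable_ind; apply: measurable_and; exact: measurable_fun_ltr.
    - exact: ltW.
    rewrite int_ind_itv ?ler1n// -EFinM lte_fin; lra.
  apply: leI => t; first by rewrite mule_ge0 ?ind_ge0// lee_fin ltW.
  have [t1|_] := ltP 1%R t; last by rewrite /= indF mule0 mule_ge0 ?ind_ge0.
  have [t2|_] := ltP t 2%R; last by rewrite /= indF mule0 mule_ge0 ?ind_ge0.
  have t0 : (0 < t)%R := lt_trans ltr01 t1.
  rewrite t0 /= !indT mule1 mul1e lee_fin; apply: ler_pM.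
  - by rewrite le_min ler01 powR_ge0.
  - exact: expR_ge0.
  - have [a1|a1] := leP 1%R a.
      rewrite ge_min; apply/orP; left.
      apply: (@le_trans _ _ (1 `^ (a - 1))%R); first by rewrite powR1.
      by apply: powR_le => //; [rewrite subr_ge0|exact: ltW].
    rewrite ge_min; apply/orP; right; apply: powR_leN => //; last exact: ltW.
    by rewrite subr_le0 ltW.
  - by rewrite ler_expR lerN2 ltW.
have [K K0 hK] := powR_le_expR (a + 1).
(* [int_ball_power] asks for an exponent strictly between 0 and 1, also when a >= 1. *)
pose g := Num.max (1 - a)%R (2^-1)%R.
have g0 : (0 < g)%R by rewrite lt_max invr_gt0 ltr0n orbT.
have g1 : (g < 1)%R by rewrite gt_max; apply/andP; split; lra.
have ag : (- g <= a - 1)%R.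
  have : (1 - a <= g)%R by rewrite le_max lexx.
  by lra.
have [K1 K10 h1] := @int_ball_power _ _ R lebesgue_measure 1%R g 2%R (ler0n R 2) g0 g1.
have l12 : (1 < 2 :> R)%R by rewrite ltr1n.
have l02 : (0 < 2 :> R)%R by rewrite ltr0n.
have [K2 K20 h2] := @int_tail_power _ _ R lebesgue_measure 1%R 2%R 2%R (ler0n R 2) l02 l12.
have {}h1 := h1 (fun t => `|t|%R) mnorm (fun t => normr_ge0 t) lebesgue_ball 1%R ltr01.
have {}h2 := h2 (fun t => `|t|%R) mnorm (fun t => normr_ge0 t) lebesgue_ball 1%R ltr01.
pose A (t : measurableTypeR R) := ind (`|t| <= 1)%R * epow (`|t|%R)%:E (- g).
pose B (t : measurableTypeR R) := ((Num.max 1 `|t|)%R `^ (- 2))%:E.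
have A0 t : 0 <= A t by rewrite mule_ge0 ?ind_ge0 ?epow_ge0.
have B0 t : 0 <= B t by rewrite lee_fin powR_ge0.
have mA : measurable_fun setT A.
  apply: emeasurable_funM.
    apply: measurable_ind; apply: measurable_fun_ler => //; exact: measurable_cst.
  apply: (measurableT_comp (measurable_epow _)); exact/measurable_EFinP.
have mB : measurable_fun setT B.
  apply/measurable_EFinP; apply: (measurableT_comp (measurable_powR _)).
  apply: measurable_maxr => //; exact: measurable_cst.
apply: (@le_lt_trans _ _ (\int[lebesgue_measure]_t (A t + K%:E * B t))).
  apply: leI => t; first by rewrite mule_ge0 ?ind_ge0.
  have KB0 : 0 <= K%:E * B t by rewrite mule_ge0// lee_fin ltW.
  have [t0|_] := ltP 0%R t; last by rewrite indF mul0e adde_ge0.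
  rewrite indT mul1e; have [t1|t1] := leP t 1%R.
    apply: (le_trans _ (leeDl _ KB0)); rewrite /A gtr0_norm// t1 indT mul1e.
    rewrite epow_EFin// lee_fin -[leRHS]mulr1; apply: ler_pM; rewrite ?powR_ge0 ?expR_ge0//.
      rewrite -[t]invrK -[in leLHS]powR_inv1 ?invr_ge0 ?(ltW t0)// -[in leRHS]powR_inv1 ?invr_ge0 ?(ltW t0)//.
      rewrite -!powRrM ler_powR ?invf_ge1//; lra.
    by rewrite -expR0 ler_expR; lra.
  apply: (le_trans _ (leeDr _ (A0 t))); rewrite /B gtr0_norm//.
  have -> : Num.max 1%R t = t by apply/max_idPr; exact: ltW.
  rewrite -EFinM lee_fin expRN.
  rewrite ler_pdivrMr ?expR_gt0//.
  have h := hK t (ltW t1); rewrite (_ : a - 1 = (a + 1) + - 2)%R; last by lra.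
  rewrite (powRD0 (a + 1) (- 2) t0) [leRHS]mulrAC.
  by apply: ler_wpM2r => //; exact: powR_ge0.
rewrite intD//; first last.
- by move=> t; rewrite mule_ge0// lee_fin ltW.
- exact: measurable_funeM.
rewrite intZ ?(ltW K0)//; apply: lte_add_pinfty.
  by apply: le_lt_trans h1 _; exact: ltry.
apply: lty_mulEFin; first exact: ltW.
by apply: le_lt_trans h2 _; exact: ltry.
Qed.

End Gamma_function.

Section riesz_theory.
Context {R : realType} {n : nat} (alpha s q : R).
Hypotheses (n_ge1 : (1 <= n)%N) (alpha_gt0 : 0 < alpha) (alpha_ltn : alpha < n%:R).
Hypotheses (s_lt : s < n%:R / alpha) (q_ge1 : 1 <= q) (q_lts : q < s).
Local Open Scope ereal_scope.
Local Notation mu := (@lebesgue_Rn R n).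
Implicit Types (f h : Rn R n -> R) (x y : Rn R n).

Let b := (n%:R - alpha)%R.
Let b_gt0 : (0 < b)%R. Proof. by rewrite subr_gt0. Qed.
Let b_ltN : (b < n%:R)%R. Proof. by rewrite gtrBl. Qed.
Let q0 : (0 < q)%R := lt_le_trans ltr01 q_ge1.
Let s0 : (0 < s)%R := lt_trans q0 q_lts.
Let s1 : (1 < s)%R := le_lt_trans q_ge1 q_lts.
Let qs0 : (q - s < 0)%R. Proof. by rewrite subr_lt0. Qed.
Let nr0 : (0 < n%:R :> R)%R. Proof. by rewrite ltr0n. Qed.

(** Equivalent to alpha s < n. *)
Let s_small : (n%:R < b * (s / (s - 1)))%R.
Proof.
rewrite mulrA ltr_pdivlMr ?subr_gt0// /b mulrBr mulr1 mulrBl ltrD2l ltrN2.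
by rewrite mulrC -ltr_pdivlMr.
Qed.

Lemma riesz_const_gt0 : (0 < @riesz_const R n alpha)%R.
Proof.
rewrite divr_gt0 ?Gamma_gt0 ?divr_gt0//.
by rewrite !mulr_gt0 ?powR_gt0 ?pi_gt0// Gamma_gt0// divr_gt0.
Qed.

Let g := (@riesz_const R n alpha `^ (- b^-1))%R.
Let g0 : (0 < g)%R. Proof. by rewrite powR_gt0// riesz_const_gt0. Qed.

(* Rescaling the distance absorbs the normalizing constant of the Riesz kernel. *)
Let rho x y := (g * enorm (x - y : 'rV[R]_n))%R.
Let reg := regular_Rn n_ge1 g0.
Let dya := dyadic_Rn n_ge1 g0.
Local Notation pot := (pot mu rho b).
Local Notation tpot := (tpot mu rho b).
Local Notation capn := (cap mu rho b s).
Local Notation capint := (capint mu rho b s).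

Lemma riesz_kernel x y : epow (rho x y)%:E (- b) =
  (@riesz_const R n alpha)%:E * epow (enorm (x - y : 'rV[R]_n))%:E (alpha - n%:R)%R.
Proof.
rewrite /rho EFinM epowM ?oppr_lt0 ?lee_fin ?enorm_ge0// /g -powRrM.
rewrite mulrNN mulVf ?gt_eqF// powRr1 ?(ltW riesz_const_gt0)//.
by rewrite /b opprB.
Qed.

Lemma riesz_potE f x : measurable_fun setT f -> (forall y, 0 <= f y)%R ->
  riesz_potential alpha f x = pot (EFin \o f) x.
Proof.
move=> mf f0; rewrite /riesz_potential -(intZ mu (ltW riesz_const_gt0)).
- by apply: eq_integral => y _; rewrite riesz_kernel muleA.
- apply: emeasurable_funM; last exact/measurable_EFinP.
  apply: (measurableT_comp (measurable_epow _)); apply/measurable_EFinP.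
  exact: (measurableT_comp measurable_enorm_sub (pair1_measurable x)).
- by move=> y; rewrite mule_ge0 ?epow_ge0// lee_fin.
Qed.

Lemma riesz_capE (E : set (Rn R n)) : riesz_cap alpha s E = capn E.
Proof.
have NE f : (forall x, 0 <= f x)%R ->
    ('N[mu]_(s%:E)[EFin \o f] `^ s)%E = \int[mu]_y (f y `^ s)%:E.
  move=> f0; rewrite unlock /Lnorm -poweRrM mulVf ?gt_eqF// poweRe1; last first.
    by apply: int_ge0 => y; exact: poweR_ge0.
  by apply: eq_integral => y _; rewrite /= ger0_norm.
congr ereal_inf; apply/seteqP; split => _ [f [mf f0 fE] <-].
  exists f; last by rewrite NE.
  by split => // x Ex; rewrite -riesz_potE//; exact: fE.
exists f; last by rewrite NE.
by split => // x Ex; rewrite riesz_potE//; exact: fE.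
Qed.

Lemma cap_integralE (u : Rn R n -> \bar R) : cap_integral alpha s u = capint u.
Proof. by apply: eq_integral => t _; rewrite riesz_capE. Qed.

Lemma Lq_cap_norm_le1 (u : Rn R n -> \bar R) :
  (Lq_cap_norm alpha s q u <= 1) = (capint (fun x => `|u x| `^ q) <= 1).
Proof.
rewrite /Lq_cap_norm cap_integralE; set X := capint _.
have X0 : 0 <= X by apply: integral_ge0 => t _; exact: cap_ge0.
have q'0 : (0 <= q^-1)%R by rewrite invr_ge0 ltW.
have one (r : R) : (1 : \bar R) `^ r = 1 by rewrite poweR_EFin powR1.
apply/idP/idP => h.
  have := le_poweR (ltW q0) (poweR_ge0 _ _) h.
  by rewrite one -poweRrM mulVf ?gt_eqF// poweRe1.
by have := le_poweR q'0 X0 h; rewrite one.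
Qed.

(** The exceptional set N may fail to be measurable; [cap_null] is applied to the measurable set
    where w < 0, which N contains. *)
Lemma qe_weight_ae (w : Rn R n -> \bar R) : qe_weight alpha s w ->
  {ae mu, forall x, 0 <= w x}.
Proof.
move=> [[N [N0 wN]] mw _].
have mE : measurable [set x | w x < 0].
  by rewrite -[X in measurable X]setTI; exact: emeasurable_fun_infty_o.
exists [set x | w x < 0]; split => //; last by move=> x /= /negP; rewrite -ltNge.
apply: (cap_null reg b_gt0 b_ltN q_ge1 q_lts s_small mE).
apply/eqP; rewrite eq_le cap_ge0 andbT.
apply: (@le_trans _ _ (capn N)); last by rewrite -riesz_capE N0.
by apply: cap_sub => x /= wx; apply: contrapT => /wN; rewrite leNgt wx.
Qed.

Lemma potential_qe_weight h : measurable_fun setT h -> (forall x, 0 <= h x)%R ->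
  (forall x r, (0 < r)%R -> tpot r (EFin \o h) x < +oo) ->
  qe_weight alpha s (pot (EFin \o h)).
Proof.
move=> mh h0 fin.
have meh : measurable_fun setT (EFin \o h) by exact/measurable_EFinP.
have eh0 y : 0 <= (EFin \o h) y by rewrite lee_fin.
have p0 x : 0 <= pot (EFin \o h) x by exact: pot_ge0.
split.
- exists set0; split; first by rewrite riesz_capE cap0// gt_eqF.
  by move=> x _; exact: p0.
- exact: (measurable_pot b reg).
- move=> K /compact_bounded[M [_ hM]].
  have [k k0 hk] := pot_ball_int reg b_gt0 b_ltN.
  (* K is bounded by |M| + 1 in the sup norm, hence by n times that in the Euclidean norm. *)
  pose r := (g * (n%:R * (`|M| + 1)))%R.
  have r0 : (0 < r)%R by rewrite !mulr_gt0// ltr_wpDl.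
  apply: (@le_lt_trans _ _ (\int[mu]_y (ind (rho (0%R : 'rV[R]_n) y <= r)%R * pot (EFin \o h) y))).
    rewrite int_ind; apply: (@le_trans _ _ (\int[mu]_(y in (K : set (Rn R n))) pot (EFin \o h) y)).
      by apply: le_int => y _; rewrite ?abse_ge0// gee0_abs.
    rewrite [leLHS]integral_mkcond [leRHS]integral_mkcond; apply: (@leI _ _ R mu) => y.
      by rewrite patchE; case: ifP.
    rewrite !patchE; case: ifPn => [yK|_]; last by case: ifP.
    rewrite ifT// inE /= /rho ler_pM2l//; apply: enorm_le_coord => [|i].
      by rewrite addr_ge0.
    have := hM (`|M| + 1)%R (ltac:(by rewrite ltr_pwDr// ler_norm)) y (set_mem yK).
    rewrite sub0r mxE normrN; apply: le_trans.
    by rewrite [leRHS]mx_normrE; apply: (le_bigmax _ (fun ij => `|(y : 'rV[R]_n) ij.1 ij.2|%R) (ord0, i)).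
  apply: le_lt_trans (hk _ _ r meh eh0 r0) _.
  apply: lty_mulEFin; last exact: fin.
  by rewrite mulr_ge0 ?powR_ge0// ltW.
Qed.

Lemma O_norm_ge0 f : 0 <= O_norm alpha s q f.
Proof. by apply: le_ereal_inf_tmp => _ [w _ <-]; exact: poweR_ge0. Qed.

Lemma KV_norm_ge0 f : 0 <= KV_norm alpha s q f.
Proof. by apply: le_ereal_inf_tmp => _ [w _ <-]; exact: poweR_ge0. Qed.

(** Both norms are infima that may fail to be attained, so estimates are first proved for every e
    above the norm. *)
Lemma le_scaled (X Y : \bar R) (D : R) : (0 < D)%R -> 0 <= X ->
  (forall e : R, (0 < e)%R -> X < e%:E -> Y <= (D * e)%:E) -> Y <= D%:E * X.
Proof.
move=> D0; case: X => [x| |]//; last by move=> *; rewrite gt0_muley ?lte_fin// leey.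
rewrite lee_fin => x0 h; apply/lee_addgt0Pr => e e0.
have z0 : (0 < x + e / D)%R by rewrite ltr_wpDl// divr_gt0.
apply: (le_trans (h _ z0 _)); first by rewrite lte_fin ltrDl divr_gt0.
by rewrite -EFinM -EFinD lee_fin mulrDr mulrCA mulfV ?mulr1// gt_eqF.
Qed.

(** The admissible weight is the normalized potential from [potential_weight]. The function f is
    kept apart from h because the estimate serves both the functions below h and, with f = h, the
    membership of h in the O-space. *)
Lemma O_norm_le_energy : exists2 D : R, (0 < D)%R & forall h f (e : R),
  measurable_fun setT h -> (forall x, 0 <= h x)%R ->
  (forall x r, (0 < r)%R -> tpot r (EFin \o h) x < +oo) -> (0 < e)%R ->
  \int[mu]_x ((h x `^ s)%:E * epow (pot (EFin \o h) x) (q - s)) <= (e `^ q)%:E ->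
  measurable_fun setT f -> {ae mu, forall x, (`|f x| <= h x)%R} ->
  O_norm alpha s q f <= (D * e)%:E.
Proof.
have [D D0 hD] := potential_weight reg b_gt0 b_ltN dya q_ge1 q_lts.
exists D => // h f e mh h0 fin e0 hI mf fh.
have [k [mk k0 kfin kcap kI]] := hD h e mh h0 fin e0 hI.
have mek : measurable_fun setT (EFin \o k) by exact/measurable_EFinP.
have ek0 y : 0 <= (EFin \o k) y by rewrite lee_fin.
have p0 x : 0 <= pot (EFin \o k) x by exact: pot_ge0.
have mw : measurable_fun setT (fun x => epow (pot (EFin \o k) x) (q - s)).
  exact: (measurableT_comp (measurable_epow _) (measurable_pot b reg mek ek0)).
have s'0 : (0 <= s^-1)%R by rewrite invr_ge0 ltW.
have De0 : (0 <= D * e)%R by rewrite mulr_ge0// ltW.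
apply: (@le_trans _ _ (((D * e) `^ s)%:E `^ s^-1)); last first.
  by rewrite poweR_EFin -powRrM mulfV ?gt_eqF// powRr1.
apply: (@le_trans _ _ ((\int[mu]_(x in [set x | f x != 0%R])
    ((`|f x| `^ s)%:E * epow (pot (EFin \o k) x) (q - s))) `^ s^-1)).
  apply: ereal_inf_lbound; exists (pot (EFin \o k)) => //; split.
    exact: potential_qe_weight.
  rewrite Lq_cap_norm_le1 (_ : (fun _ => _) = (fun x => pot (EFin \o k) x `^ q))//.
  by apply/funext => x; rewrite gee0_abs.
have F0 x : 0 <= (`|f x| `^ s)%:E * epow (pot (EFin \o k) x) (q - s).
  by rewrite mule_ge0 ?epow_ge0// lee_fin powR_ge0.
apply: (le_poweR s'0); first by apply: integral_ge0 => x _; exact: F0.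
apply: le_trans kI.
apply: (@le_trans _ _ (\int[mu]_x ((`|f x| `^ s)%:E * epow (pot (EFin \o k) x) (q - s)))).
  rewrite integral_mkcond; apply: (@leI _ _ R mu) => x; rewrite patchE.
    by case: ifP => // _; exact: F0.
  by case: ifP => // _; exact: F0.
apply: ae_ge0_le_integral.
- exact: measurableT.
- by move=> x _; exact: F0.
- apply: emeasurable_funM; last exact: mw.
  apply/measurable_EFinP; apply: (measurableT_comp (measurable_powR s)).
  exact: (measurableT_comp (@normr_measurable R setT)).
- by move=> x _; apply: mule_ge0; [rewrite lee_fin powR_ge0|exact: epow_ge0].
- apply: emeasurable_funM; last exact: mw.
  apply/measurable_EFinP.
  exact: (measurableT_comp (measurable_powR s) mh).
apply: filterS fh => x fx _; apply: lee_wpmul2r; first exact: epow_ge0.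
by rewrite lee_fin powR_le// ltW.
Qed.

Lemma O_norm_majorant : exists2 D : R, (0 < D)%R & forall f (e : R),
  measurable_fun setT f -> (0 < e)%R -> O_norm alpha s q f < e%:E ->
  exists h, [/\ measurable_fun setT h, (forall x, 0 <= h x)%R,
    (forall x, `|f x| <= h x)%R,
    (forall x r, (0 < r)%R -> tpot r (EFin \o h) x < +oo) &
    \int[mu]_x ((h x `^ s)%:E * epow (pot (EFin \o h) x) (q - s)) <= ((D * e) `^ q)%:E].
Proof.
have [D D0 hD] := weight_potential reg b_gt0 b_ltN dya q_ge1 q_lts s_small.
exists D => // f e mf e0 /ereal_inf_ltP[_ [w [ww w1] <-]] we.
have mw : measurable_fun setT w by case: ww.
have mfn : measurable_fun setT (fun x => `|f x|%R).
  exact: (measurableT_comp (@normr_measurable R setT)).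
rewrite Lq_cap_norm_le1 in w1.
(* w is nonnegative only quasi-everywhere. It is replaced by |w|, which has the same capacitary norm
   and equals w almost everywhere. *)
have w0 x : 0 <= `|w x| by exact: abse_ge0.
apply: (hD (fun x => `|w x|) w0 w1 (fun x => `|f x|%R) e mfn (fun x => normr_ge0 _) e0).
have mfs : measurable_fun setT (fun x => (`|f x| `^ s)%:E).
  by apply/measurable_EFinP; exact: (measurableT_comp (measurable_powR s) mfn).
pose P x := f x != 0%R.
have mP : measurable_fun setT (fun x => ind (P x) : \bar R).
  have mneg : measurable_fun setT (fun b : bool => ind (~~ b) : \bar R) by [].
  have meq : measurable_fun setT (fun x => f x == 0%R).
    by apply: measurable_fun_eqr; [exact: mf|exact: measurable_cst].
  exact: (measurableT_comp mneg meq).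
apply: (@le_trans _ _ (\int[mu]_x (ind (P x) * ((`|f x| `^ s)%:E * epow (w x) (q - s))))).
  apply: ae_ge0_le_integral.
  - exact: measurableT.
  - by move=> x _; apply: mule_ge0; [rewrite lee_fin powR_ge0|exact: epow_ge0].
  - apply: emeasurable_funM; first exact: mfs.
    apply: (measurableT_comp (measurable_epow _)).
    exact: measurableT_comp.
  - move=> x _; apply: mule_ge0; first exact: ind_ge0.
    by apply: mule_ge0; [rewrite lee_fin powR_ge0|exact: epow_ge0].
  - apply: emeasurable_funM; first exact: mP.
    apply: emeasurable_funM; first exact: mfs.
    exact: (measurableT_comp (measurable_epow _)).
  apply: filterS (qe_weight_ae ww) => x wx _; rewrite gee0_abs// /P.
  have [->|_] := eqVneq (f x) 0%R; last by rewrite indT mul1e.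
  by rewrite normr0 powR0 ?gt_eqF// indF !mul0e.
rewrite int_ind; set X := \int[_]_(x in _) _ in we *.
have X0 : 0 <= X.
  by apply: integral_ge0 => x _; rewrite mule_ge0 ?epow_ge0// lee_fin powR_ge0.
have := le_poweR (ltW s0) (poweR_ge0 _ _) (ltW we).
by rewrite -poweRrM mulVf ?gt_eqF// poweRe1// poweR_EFin.
Qed.

Lemma KV_norm_le : exists2 D : R, (0 < D)%R & forall f,
  measurable_fun setT f -> KV_norm alpha s q f <= D%:E * O_norm alpha s q f.
Proof.
have [D D0 hD] := O_norm_majorant; have [D1 D10 hD1] := O_norm_le_energy.
exists D => // f mf; apply: le_scaled => //; first exact: O_norm_ge0.
move=> e e0 fe; have [h [mh h0 fh hfin hI]] := hD f e mf e0 fe.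
have De0 : (0 < D * e)%R by rewrite mulr_gt0.
have q'0 : (0 <= q^-1)%R by rewrite invr_ge0 ltW.
apply: (@le_trans _ _ (((D * e) `^ q)%:E `^ q^-1)); last first.
  by rewrite poweR_EFin -powRrM mulfV ?gt_eqF// powRr1// ltW.
apply: (@le_trans _ _ ((\int[mu]_x (if h x == 0%R then 0 else (h x `^ s)%:E *
    epow (riesz_potential alpha h x) (q - s))) `^ q^-1)).
  (* A competitor must itself lie in the O-space; its finite energy gives this. *)
  apply: ereal_inf_lbound; exists h => //; split; last exact: aeW.
  split => //; apply: (@le_lt_trans _ _ (D1 * (D * e))%:E); last exact: ltry.
  apply: (hD1 h h (D * e)%R) => //; apply: aeW => x.
  by rewrite ger0_norm.
have F0 x : 0 <= (h x `^ s)%:E * epow (pot (EFin \o h) x) (q - s).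
  by rewrite mule_ge0 ?epow_ge0// lee_fin powR_ge0.
have G0 x : 0 <= if h x == 0%R then 0 else (h x `^ s)%:E *
    epow (riesz_potential alpha h x) (q - s).
  by rewrite riesz_potE//; case: ifP => // _; exact: F0.
apply: (le_poweR q'0); first exact: int_ge0.
apply: le_trans hI; apply: (@leI _ _ R mu) => x; first exact: G0.
by rewrite riesz_potE//; case: ifP => // _; exact: F0.
Qed.

(** The finiteness of truncated potentials is drawn from the membership of h in the O-space:
    [O_norm_majorant] gives a larger function that has it. *)
Lemma O_norm_le : exists2 D : R, (0 < D)%R & forall f,
  measurable_fun setT f -> O_norm alpha s q f <= D%:E * KV_norm alpha s q f.
Proof.
have [D D0 hD] := O_norm_majorant; have [D1 D10 hD1] := O_norm_le_energy.
exists D1 => // f mf; apply: le_scaled => //; first exact: KV_norm_ge0.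
move=> e e0 /ereal_inf_ltP[_ [h [[mh hO] fh] <-]] he.
(* A competitor is nonnegative only almost everywhere; its positive part k is nonnegative at every
   point and has the same potential. *)
pose k x := Num.max (h x) 0%R.
have k0 x : (0 <= k x)%R by rewrite le_max lexx orbT.
have mk : measurable_fun setT k by apply: measurable_maxr => //; exact: measurable_cst.
have mek : measurable_fun setT (EFin \o k) by exact/measurable_EFinP.
have ek0 y : 0 <= (EFin \o k) y by rewrite lee_fin.
have hk : {ae mu, forall x, h x = k x}.
  apply: filterS fh => x fx; apply/esym/max_idPl.
  exact: le_trans (normr_ge0 _) fx.
have kfin x r : (0 < r)%R -> tpot r (EFin \o k) x < +oo.
  have [e1 [e10 he1]] : exists e1 : R, (0 < e1)%R /\ O_norm alpha s q h < e1%:E.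
    have := O_norm_ge0 h; move: hO; case: (O_norm _ _ _ _) => [z| |]// _.
    rewrite lee_fin => z0; exists (z + 1)%R; split; first exact: ltr_wpDl.
    by rewrite lte_fin ltrDl.
  have [h' [_ h'0 hh' h'fin _]] := hD h e1 mh e10 he1.
  move=> r0; apply: le_lt_trans (h'fin x r r0); apply: le_tpot => // y.
  by rewrite lee_fin ge_max h'0 andbT (le_trans (ler_norm _)).
have hpot x : riesz_potential alpha h x = pot (EFin \o k) x.
  rewrite -riesz_potE// /riesz_potential; congr (_ * _).
  have me : measurable_fun setT (fun y : Rn R n =>
      epow (enorm (x - y : 'rV[R]_n))%:E (alpha - n%:R)%R).
    apply: (measurableT_comp (measurable_epow _)); apply/measurable_EFinP.
    exact: (measurableT_comp measurable_enorm_sub (pair1_measurable x)).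
  apply: ae_eq_integral.
  - exact: measurableT.
  - by apply: emeasurable_funM; [exact: me|exact/measurable_EFinP].
  - by apply: emeasurable_funM; [exact: me|exact/measurable_EFinP].
  by apply: filterS hk => y hky _; rewrite hky.
apply: (hD1 k f e) => //; last first.
  by apply: filterS fh => x fx; rewrite (le_trans fx)// le_max lexx.
have mP := measurable_pot b reg mek ek0.
have mE : measurable_fun setT (fun x => epow (pot (EFin \o k) x) (q - s)).
  exact: (measurableT_comp (measurable_epow _) mP).
pose J x := if h x == 0%R then 0 else (h x `^ s)%:E *
    epow (riesz_potential alpha h x) (q - s).
have JE : J = fun x => if h x == 0%R then 0 else (h x `^ s)%:E * epow (pot (EFin \o k) x) (q - s).
  by apply/funext => x; rewrite /J hpot.
have J0 x : 0 <= J x.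
  by rewrite JE; case: ifP => // _; rewrite mule_ge0 ?epow_ge0// lee_fin powR_ge0.
apply: (@le_trans _ _ (\int[mu]_x J x)).
  apply: ae_ge0_le_integral.
  - exact: measurableT.
  - by move=> x _; apply: mule_ge0; [rewrite lee_fin powR_ge0|exact: epow_ge0].
  - apply: emeasurable_funM; last exact: mE.
    apply/measurable_EFinP.
    exact: (measurableT_comp (measurable_powR s) mk).
  - by move=> x _; exact: J0.
  - rewrite JE; apply: measurable_fun_ifT.
    + by apply: measurable_fun_eqr; [exact: mh|exact: measurable_cst].
    + exact: measurable_cst.
    apply: emeasurable_funM; last exact: mE.
    apply/measurable_EFinP.
    exact: (measurableT_comp (measurable_powR s) mh).
  apply: filterS hk => x <- _; rewrite JE; have [->|_] := eqVneq (h x) 0%R; last exact: lexx.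
  by rewrite powR0 ?gt_eqF// mul0e.
have := le_poweR (ltW q0) (poweR_ge0 _ _) (ltW he).
by rewrite -poweRrM mulVf ?gt_eqF// poweRe1 ?poweR_EFin//; exact: int_ge0.
Qed.

End riesz_theory.

Theorem theorem1p4 (R : realType) (n : nat) (alpha s q : R)
    (n_ge1 : (1 <= n)%N)
    (alpha_gt0 : 0 < alpha) (alpha_ltn : alpha < n%:R)
    (s_gt0 : 0 < s) (s_lt : s < n%:R / alpha)
    (q_ge1 : 1 <= q) (q_lts : q < s) :
  @KV_space R n alpha s q = @O_space R n alpha s q /\
  exists c1 c2 : R, [/\ 0 < c1, 0 < c2 &
    forall f : Rn R n -> R, O_space alpha s q f ->
      (c1%:E * KV_norm alpha s q f <= O_norm alpha s q f)%E /\
      (O_norm alpha s q f <= c2%:E * KV_norm alpha s q f)%E].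
Proof.
have [D1 D10 h1] := KV_norm_le n_ge1 alpha_gt0 alpha_ltn s_lt q_ge1 q_lts.
have [D2 D20 h2] := O_norm_le n_ge1 alpha_gt0 alpha_ltn s_lt q_ge1 q_lts.
split.
  apply/seteqP; split => f [mf fin]; split => //.
    by apply: le_lt_trans (h2 f mf) _; exact: (lty_mulEFin (ltW D20) fin).
  by apply: le_lt_trans (h1 f mf) _; exact: (lty_mulEFin (ltW D10) fin).
exists D1^-1, D2; split; rewrite ?invr_gt0// => f [mf _]; split; last exact: h2.
by rewrite lee_pdivrMl//; exact: h1.
Qed.
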